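(* The spectrum of $\mathcal{A}_a(\ell)$ is purely imaginary, for any real $\ell$ and $a$ sufficiently small.
   Context: Periodic waves (KP-II equation). For real $a$ sufficiently small, $(P_a,k_a)$ denotes the one-parameter family of small solutions, $P_a$ being $2\pi$-periodic and even and $k_a>0$, of $k_a^2P_a''=-P_a-\frac12P_a^2$ parameterized by $a=\frac1\pi\int_0^{2\pi}P_a(z)\cos(z)\,dz$, with expansions $P_a(z)=a\cos(z)+\frac14\left(\frac13\cos(2z)-1\right)a^2+O(|a|^3)$ and $k_a^2=1-\frac{5}{24}a^2+O(a^4)$; it satisfies $P_a(z+\pi)=P_{-a}(z)$, $k_a=k_{-a}$. $L^2_0(0,2\pi)=\{f\in L^2(0,2\pi): \int_0^{2\pi}f(z)\,dz=0\}$ (complex-valued functions), $H^m_{\mathrm{per}}(0,2\pi)$ is the space of $2\pi$-periodic functions in $H^m_{\mathrm{loc}}(\mathbb{R})$, $\partial_z^{-1}$ is the inverse of the restriction of $\partial_z$ to $L^2_0(0,2\pi)$, and $\partial_z^{-2}=(\partial_z^{-1})^2$. Here (KP-II case) $\mathcal{A}_a(\ell)=-\partial_z\mathcal{L}_a(\ell)$ with $\mathcal{L}_a(\ell)=-\partial_z^2-\frac1{k_a^2}\big((1+P_a)\,\cdot\,\big)+\ell^2\partial_z^{-2}$, i.e. $\mathcal{A}_a(\ell)=\partial_z^3+\frac1{k_a^2}\partial_z\big((1+P_a)\,\cdot\,\big)-\ell^2\partial_z^{-1}$, acting in $L^2_0(0,2\pi)$ with domain $H^3_{\mathrm{per}}(0,2\pi)\cap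 L^2_0(0,2\pi)$. ''Purely imaginary'' means contained in $i\mathbb{R}$. ''For any $\ell$ and $a$ sufficiently small'' means: there are $\ell_*>0$, $a_*>0$ such that the statement holds whenever $|\ell|\leq\ell_*$ and $|a|\leq a_*$. *)

(* Defs.v *)
From mathcomp Require Import all_boot all_order all_algebra.
From mathcomp Require Import complex.
From mathcomp Require Import all_classical all_reals all_analysis.

Set Implicit Arguments.
Unset Strict Implicit.
Unset Printing Implicit Defensive.
Import Order.TTheory GRing.Theory Num.Theory.
Import numFieldNormedType.Exports.

Local Open Scope classical_set_scope.
Local Open Scope complex_scope.
Local Open Scope ring_scope.

Section FunctionSpaces.
Context {R : realType}.
Implicit Types (D : set R) (f g u : R -> R[i]) (m : nat).

Definition Cintegral D f : R[i] :=
  (\int[lebesgue_measure]_(x in D) complex.Re (f x)) +i*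
  (\int[lebesgue_measure]_(x in D) complex.Im (f x)).

Definition L2 D f : Prop :=
  [/\ measurable_fun D (fun x => complex.Re (f x)),
      measurable_fun D (fun x => complex.Im (f x)) &
      lebesgue_measure.-integrable D (fun x => (Normc.normc (f x) ^+ 2)%:E)].

Definition L2loc f : Prop := forall M : R, L2 `[- M, M] f.

(* Elements of L^2(0,2pi) are represented by functions on R, of which only the
   values on ]0, 2pi[ matter, and only almost everywhere. *)
Definition period : set R := `]0, 2 * pi[.

Definition L2eq f g : Prop :=
  {ae lebesgue_measure, forall x, period x -> f x = g x}.

Definition L2norm f : R :=
  Num.sqrt (\int[lebesgue_measure]_(x in period) (Normc.normc (f x) ^+ 2)).

Definition L20 f : Prop := L2 period f /\ Cintegral period f = 0.

Definition test_function (phi : R -> R) : Prop :=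
  (forall n x, derivable (derive1n n phi) x 1) /\
  (exists M, forall x, M < `|x| -> phi x = 0).

(* [g] is a distributional derivative of [f], both being locally in L^2. *)
Definition weak_derivative f g : Prop :=
  [/\ L2loc f, L2loc g &
      forall phi, test_function phi ->
        Cintegral setT (fun x => f x * (derive1 phi x)%:C) =
        - Cintegral setT (fun x => g x * (phi x)%:C)].

Fixpoint Hloc m f : Prop :=
  if m is m'.+1 then exists2 g, weak_derivative f g & Hloc m' g else L2loc f.

Definition Hper m f : Prop := periodic f (2 * pi) /\ Hloc m f.

(* The distributional derivative, unique up to equality almost everywhere;
   the value is 0 when [f] has none. *)
Definition dz f : R -> R[i] := xget (fun=> 0) [set g | weak_derivative f g].

(* The inverse of the restriction of d/dz to L^2_0(0,2pi), whose domain is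
   H^1_per /\ L^2_0; again determined up to equality almost everywhere. *)
Definition dzinv f : R -> R[i] :=
  xget (fun=> 0) [set g | [/\ Hper 1 g, L20 g & L2eq (dz g) f]].

(* Resolvent set of an operator [A] in L^2_0(0,2pi) with domain [dom]:
   A - lambda is a bijection from [dom] onto L^2_0 with a bounded inverse. *)
Definition resolvent_set (dom : set (R -> R[i]))
    (A : (R -> R[i]) -> R -> R[i]) : set R[i] :=
  [set lambda | let T u := fun x => A u x - lambda * u x in
    [/\ forall u v, dom u -> dom v -> L2eq (T u) (T v) -> L2eq u v,
        forall g, L20 g -> exists2 u, dom u & L2eq (T u) g &
        exists C : R, forall u, dom u -> L2norm u <= C * L2norm (T u)]].

Definition spectrum dom A : set R[i] := ~` resolvent_set dom A.

End FunctionSpaces.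

Section KP2.
Context {R : realType}.

(* The one-parameter family of small periodic waves. Only the values for small
   [a] are constrained; the remainders are uniform in [z]. *)
Definition periodic_waves (P : R -> R -> R) (k : R -> R) : Prop :=
  exists a0 C : R, 0 < a0 /\ forall a, `|a| <= a0 ->
    (periodic (P a) (2 * pi) /\ (forall z, P a (- z) = P a z)) /\
    (forall z, derivable (P a) z 1 /\ derivable (derive1 (P a)) z 1) /\
    0 < k a /\
    (forall z, k a ^+ 2 * derive1n 2 (P a) z = - P a z - 2^-1 * P a z ^+ 2) /\
    a = pi^-1 * \int[lebesgue_measure]_(z in `[0, 2 * pi]) (P a z * cos z) /\
    (forall z, `|P a z - (a * cos z
         + 4^-1 * (3^-1 * cos (2 * z) - 1) * a ^+ 2)| <= C * `|a| ^+ 3) /\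
    `|k a ^+ 2 - (1 - 5 / 24 * a ^+ 2)| <= C * a ^+ 4 /\
    (forall z, P a (z + pi) = P (- a) z) /\
    k a = k (- a).

Definition domA : set (R -> R[i]) := [set u | Hper 3 u /\ L20 u].

Definition opA (P : R -> R -> R) (k : R -> R) (a l : R) (u : R -> R[i]) :
    R -> R[i] :=
  fun z => dz (dz (dz u)) z
    + ((k a ^+ 2)^-1)%:C * dz (fun y => (1 + P a y)%:C * u y) z
    - (l ^+ 2)%:C * dzinv u z.

End KP2.

(* Main.v *)
(** Write an eigenfunction as [u = V'], so that [V''' + q V' - lam V = Z] with
    [Z' = l^2 V] and [q = (1 + P_a) / k_a^2] even. The odd part [f] and the even part [g]
    of [V] satisfy two equations coupled through [lam]. Pairing them with [P_a'], which
    spans the kernel of the linearization at [l = 0], and with a function [Q] close to cos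
    for which [Q'' + q Q] is explicit up to [O(a^3)], one finds for the first Fourier
    coefficients [x] of [f] and [y] of [g], up to small relative errors,
    [lam x = l^2 y] and [lam y = - (l^2 + a^2/12) x]; the higher modes are controlled by
    energy identities and a Poincare inequality. Pairing with the conjugates of [f'] and
    [g'] shows that [lam s] and [lam conj(s)] are real for [s = <g, f'>], so if
    [Re lam <> 0] then either [s = 0], whence [V' = 0], or [lam] is real, which
    contradicts the opposite signs in the two relations.

    Injectivity gives the resolvent: [A - lam], integrated once, is a periodic
    problem for a linear system of ODEs with right-hand side [G(x) = int_0^x T u], and
    such a problem is Fredholm. The passage from distributional to classical
    derivatives is du Bois-Reymond's lemma, proved at Lebesgue points. *)

From mathcomp Require Import all_boot all_order all_algebra.
From mathcomp Require Import complex.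
From mathcomp Require Import ring lra.
From mathcomp Require Import all_classical all_reals all_analysis.
From mathcomp Require Import measurable_realfun.
Require Import Defs.
Set Implicit Arguments.
Unset Strict Implicit.
Unset Printing Implicit Defensive.
Import Order.TTheory GRing.Theory Num.Theory.
Import numFieldNormedType.Exports.
Local Open Scope classical_set_scope.
Local Open Scope complex_scope.
Local Open Scope ring_scope.

(** * Calculus on the line and on a period *)

(** The delicate point is the double eigenvalue 0 at [a = l = 0], spanned by cosine and sine. The
    two relations for [x] and [y] amount to [lam ^ 2] close to [- l ^ 2 * (l ^ 2 + a ^ 2 / 12)], so
    errors that are merely small compared with 1 cannot tell on which side of the imaginary axis
    [lam] lies. Each error has to be small relative to the right-hand side of its own relation,
    however [l] and [a] compare. This dictates the two test functions: [P_a'] is annihilated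
    exactly, so that the first relation has [l ^ 2] as a factor of its error too, and [Q] is
    corrected to second order, so that its remainder is small against [a ^ 2 / 12]. Nothing bounds
    [lam] in advance, and neither a spectral projection nor a separation of eigenvalues is used: the
    estimates hold for every [lam] off the imaginary axis, with a case distinction at
    [|lam| = 1/16]. For large [lam] the structure enters a second time: [s] being real controls
    [Im t], the only quantity that [lam] multiplies in the sum of the energy identities. *)

Section RealCalculus.
Context {R : realType}.
Implicit Types (f g h : R -> R) (a b x y : R).
Notation mu := (@lebesgue_measure R).

(** A relation rather than an operator: the derivative is carried along as data, so that
    differentiability never becomes a separate side condition. *)
Definition deriv_of f g := forall x, is_derive x (1 : R) f (g x).

Lemma deriv_ext f f1 g g1 : deriv_of f g -> f =1 f1 -> g =1 g1 -> deriv_of f1 g1.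
Proof. by move=> D /funext <- /funext <-. Qed.

Lemma deriv_extr f g g1 : deriv_of f g -> g =1 g1 -> deriv_of f g1.
Proof. by move=> D /funext <-. Qed.

Lemma deriv_cst (c : R) : deriv_of (fun=> c) (fun=> 0).
Proof. by move=> x; exact: is_derive_cst. Qed.

Lemma deriv_id : deriv_of (fun x => x) (fun=> 1).
Proof. by move=> x; exact: is_derive_id. Qed.

Lemma derivD f f' g g' : deriv_of f f' -> deriv_of g g' ->
  deriv_of (fun x => f x + g x) (fun x => f' x + g' x).
Proof. by move=> Df Dg x; have := Df x; have := Dg x => ? ?; exact: is_deriveD. Qed.

Lemma derivB f f' g g' : deriv_of f f' -> deriv_of g g' ->
  deriv_of (fun x => f x - g x) (fun x => f' x - g' x).
Proof. by move=> Df Dg x; have := Df x; have := Dg x => ? ?; exact: is_deriveB. Qed.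

Lemma derivN f f' : deriv_of f f' -> deriv_of (fun x => - f x) (fun x => - f' x).
Proof. by move=> Df x; have := Df x => ?; exact: is_deriveN. Qed.

Lemma derivM f f' g g' : deriv_of f f' -> deriv_of g g' ->
  deriv_of (fun x => f x * g x) (fun x => f' x * g x + f x * g' x).
Proof.
move=> Df Dg x; have := Df x; have := Dg x => ? ?.
by apply: is_derive_eq; rewrite /GRing.scale /= addrC [g x * _]mulrC.
Qed.

Lemma derivX f f' n : deriv_of f f' ->
  deriv_of (fun x => f x ^+ n) (fun x => n%:R * f x ^+ n.-1 * f' x).
Proof.
move=> Df x; have := Df x => ?.
have E : f ^+ n = (fun x => f x ^+ n) by apply/funext => y; rewrite exprfctE.
by rewrite -E; exact: is_deriveX.
Qed.

Lemma deriv_comp f f' g g' : deriv_of f f' -> deriv_of g g' ->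
  deriv_of (fun x => f (g x)) (fun x => f' (g x) * g' x).
Proof.
by move=> Df Dg x; have := Df (g x); have := Dg x => ? ?; exact: is_derive1_comp.
Qed.

Lemma deriv_cos f f' : deriv_of f f' ->
  deriv_of (fun x => cos (f x)) (fun x => - sin (f x) * f' x).
Proof. by move=> Df; apply: (@deriv_comp cos (fun x => - sin x)) => // x; exact: is_derive_cos. Qed.

Lemma deriv_sin f f' : deriv_of f f' ->
  deriv_of (fun x => sin (f x)) (fun x => cos (f x) * f' x).
Proof. by move=> Df; apply: (@deriv_comp sin cos) => // x; exact: is_derive_sin. Qed.

Lemma deriv_continuous f f' : deriv_of f f' -> continuous f.
Proof.
move=> Df x; have [d _] := Df x.
exact/differentiable_continuous/derivable1_diffP.
Qed.

Lemma deriv0_const f x y : deriv_of f (fun=> 0) -> f x = f y.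
Proof. by move=> Df; exact: is_derive_0_is_cst. Qed.

Lemma deriv_unique f g h x y : deriv_of f h -> deriv_of g h ->
  f x - f y = g x - g y.
Proof.
move=> Df Dg.
have Dfg : deriv_of (fun x => f x - g x) (fun=> 0).
  by apply: (deriv_ext (derivB Df Dg)) => // z; rewrite subrr.
have /= := deriv0_const x y Dfg; lra.
Qed.

Lemma deriv_nondecreasing f f' a b : deriv_of f f' ->
  (forall x, a <= x <= b -> 0 <= f' x) -> a <= b -> f a <= f b.
Proof.
move=> Df f0; rewrite le_eqVlt => /predU1P[->//|ab].
have [x _||c /[!in_itv]/= /andP[ac cb] E] := @MVT R f f' a b ab.
- exact: Df.
- by apply: continuous_subspaceT; exact: deriv_continuous Df.
by rewrite -subr_ge0 E mulr_ge0// ?subr_ge0 ?(ltW ab)// f0// !ltW.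
Qed.

Definition locint f := forall a b, mu.-integrable `[a, b] (EFin \o f).

Lemma continuous_locint f : continuous f -> locint f.
Proof.
move=> cf a b; apply: continuous_compact_integrable; first exact: segment_compact.
exact: continuous_subspaceT.
Qed.

(** Oriented, hence defined on the whole line, and built on the Lebesgue integral: it serves for
    continuous integrands here and for locally integrable ones in the theory of weak derivatives. *)
Definition prim f x : R :=
  if 0 <= x then \int[mu]_(t in `[0, x]) f t else - \int[mu]_(t in `[x, 0]) f t.

Lemma Rintegral_chasles f a b c : locint f -> a <= b -> b <= c ->
  \int[mu]_(t in `[a, c]) f t =
  \int[mu]_(t in `[a, b]) f t + \int[mu]_(t in `[b, c]) f t.
Proof.
move=> lf ab bc.
have := @Rintegral_itvB R f (BLeft a) (BRight c) b.
rewrite !bnd_simp => /(_ (lf a c) ab bc) H.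
rewrite -(@Rintegral_itv_obnd_cbnd R b (BRight c)); first by rewrite -H addrC subrK.
by apply: integrableS (lf b c) => //; apply: subset_itvr; rewrite bnd_simp.
Qed.

Lemma Rintegral_point f a : \int[mu]_(t in `[a, a]) f t = 0.
Proof. by rewrite set_itv1 Rintegral_set1. Qed.

Lemma primB f a b : locint f -> a <= b ->
  prim f b - prim f a = \int[mu]_(t in `[a, b]) f t.
Proof.
move=> lf ab; rewrite /prim; case: (leP 0 b) => b0; case: (leP 0 a) => a0.
- by rewrite (@Rintegral_chasles f 0 a b)//; ring.
- by rewrite opprK (@Rintegral_chasles f a 0 b) ?(ltW a0)//; ring.
- by have := le_lt_trans ab b0; rewrite ltNge a0.
- by rewrite opprK (@Rintegral_chasles f a b 0) ?(ltW b0)//; ring.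
Qed.

Lemma prim0 f : prim f 0 = 0.
Proof. by rewrite /prim lexx Rintegral_point. Qed.

Lemma deriv_prim f : continuous f -> deriv_of (prim f) f.
Proof.
move=> cf x; have lf := continuous_locint cf.
have H := @continuous_FTC1_closed R f (x - 1) x (x + 1).
have xx : x < x + 1 by rewrite ltrDl.
have [|d E] := H xx (lf _ _) _ (cf x).
  by rewrite ltrBlDr.
set F := fun y => _ in d E.
have : is_derive x (1 : R) (fun y => F y + prim f (x - 1)) (f x).
  apply: (@is_derive_eq _ _ _ _ _ _ _ (f x + 0)); last by rewrite addr0.
  apply: (@is_deriveD _ _ _ F (cst (prim f (x - 1)))).
  by apply: DeriveDef; [exact: d|rewrite -derive1E; exact: E].
(* The fundamental theorem is used with base point [x - 1], strictly to the left of [x]; near [x]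
   that primitive differs from [prim f] by the constant [prim f (x - 1)]. *)
apply: near_eq_is_derive => //.
near=> y; rewrite /F -(@primB f (x - 1) y) //; first by ring.
near: y; have : x - 1 < x by rewrite ltrBlDr.
by move=> /lt_nbhsr; apply: filterS => z /ltW.
Unshelve. all: by end_near. Qed.

Lemma primE f F x : deriv_of F f -> continuous f -> prim f x = F x - F 0.
Proof.
move=> DF cf; have := deriv_unique x 0 (deriv_prim cf) DF.
by rewrite prim0 subr0.
Qed.

Lemma cts_ext f g : continuous f -> f =1 g -> continuous g.
Proof. by move=> cf /funext <-. Qed.

Lemma ctsD f g : continuous f -> continuous g -> continuous (fun x => f x + g x).
Proof. by move=> cf cg x; apply: cvgD; [exact: cf|exact: cg]. Qed.

Lemma ctsB f g : continuous f -> continuous g -> continuous (fun x => f x - g x).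
Proof. by move=> cf cg x; apply: cvgB; [exact: cf|exact: cg]. Qed.

Lemma ctsN f : continuous f -> continuous (fun x => - f x).
Proof. by move=> cf x; apply: cvgN; exact: cf. Qed.

Lemma ctsM f g : continuous f -> continuous g -> continuous (fun x => f x * g x).
Proof. by move=> cf cg x; apply: cvgM; [exact: cf|exact: cg]. Qed.

Lemma ctsX f n : continuous f -> continuous (fun x => f x ^+ n).
Proof.
move=> cf; elim: n => [|n IH]; first by move=> x; exact: cvg_cst.
by under eq_fun do rewrite exprS; exact: ctsM.
Qed.

Lemma cts_cst (c : R) : continuous (fun _ : R => c).
Proof. by move=> x; exact: cvg_cst. Qed.

Lemma cts_id : continuous (fun x : R => x).
Proof. by move=> x; exact: cvg_id. Qed.

Lemma cts_comp f g : continuous f -> continuous g -> continuous (fun x => f (g x)).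
Proof. by move=> cf cg x; apply: continuous_comp; [exact: cg|exact: cf]. Qed.

Lemma cts_cos f : continuous f -> continuous (fun x => cos (f x)).
Proof. by move=> cf; apply: cts_comp => //; exact: continuous_cos. Qed.

Lemma cts_sin f : continuous f -> continuous (fun x => sin (f x)).
Proof. by move=> cf; apply: cts_comp => //; exact: continuous_sin. Qed.

Lemma cts_norm f : continuous f -> continuous (fun x => `|f x|).
Proof. by move=> cf x; apply: cvg_norm; exact: cf. Qed.

End RealCalculus.

Ltac cts_step :=
  lazymatch goal with |- forall x, continuous_at x ?F =>
  lazymatch F with
  | fun x => (@?f x) - (@?g x) => apply: (@ctsB _ f g)
  | fun x => (@?f x) + (@?g x) => apply: (@ctsD _ f g)
  | fun x => - (@?f x) => apply: (@ctsN _ f)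
  | fun x => (@?f x) * (@?g x) => apply: (@ctsM _ f g)
  | fun x => (@?f x) ^+ ?n => apply: (@ctsX _ f n)
  | fun x => cos (@?f x) => apply: (@cts_cos _ f)
  | fun x => sin (@?f x) => apply: (@cts_sin _ f)
  | fun x => `|@?f x| => apply: (@cts_norm _ f)
  | _ => first [ match goal with H : forall x, continuous_at x F |- _ => exact: H end
             | match goal with H : deriv_of F _ |- _ => exact: (deriv_continuous H) end
             | assumption | exact: cts_id | exact: cts_cst | eapply deriv_continuous; eassumption ]
  end end.
Ltac cts := repeat cts_step.

Ltac deriv_step :=
  lazymatch goal with
  | |- deriv_of (fun x => (@?f x) - (@?g x)) _ => apply: (@derivB _ f _ g)
  | |- deriv_of (fun x => (@?f x) + (@?g x)) _ => apply: (@derivD _ f _ g)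
  | |- deriv_of (fun x => - (@?f x)) _ => apply: (@derivN _ f)
  | |- deriv_of (fun x => (@?f x) * (@?g x)) _ => apply: (@derivM _ f _ g)
  | |- deriv_of (fun x => (@?f x) ^+ ?n) _ => apply: (@derivX _ f _ n)
  | |- deriv_of (fun x => cos (@?f x)) _ => apply: (@deriv_cos _ f)
  | |- deriv_of (fun x => sin (@?f x)) _ => apply: (@deriv_sin _ f)
  | |- deriv_of ?F _ => first [ match goal with H : deriv_of F _ |- _ => exact: H end | eassumption | exact: deriv_id | exact: deriv_cst ]
  end.
Ltac deriv := eapply deriv_extr; [ repeat deriv_step | move=> ? /=].

(** * Integration over one period through antiderivatives *)

Section Integral.
Context {R : realType}.
Implicit Types (f g h : R -> R) (a b x y : R).

Lemma deriv_shift f f' c : deriv_of f f' ->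
  deriv_of (fun x => f (x + c)) (fun x => f' (x + c)).
Proof.
move=> Df; eapply deriv_extr; first apply: (deriv_comp Df).
- by apply: derivD; [exact: deriv_id|exact: (deriv_cst c)].
- by move=> x /=; ring.
Qed.

Lemma deriv_opparg f f' : deriv_of f f' ->
  deriv_of (fun x => f (- x)) (fun x => - f' (- x)).
Proof.
move=> Df; eapply deriv_extr; first apply: (deriv_comp Df).
- by apply: derivN; exact: deriv_id.
- by move=> x /=; ring.
Qed.

Lemma cts_shift f c : continuous f -> continuous (fun x => f (x + c)).
Proof. by move=> cf; apply: (@cts_comp _ f (fun x => x + c)); cts. Qed.

Lemma cts_opparg f : continuous f -> continuous (fun x => f (- x)).
Proof. by move=> cf; apply: (@cts_comp _ f (fun x => - x)); cts. Qed.

(** As a value of an antiderivative, it turns linearity, integration by parts and invariance under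
    translation or reflection into comparisons of two functions with the same derivative. *)
Definition I f : R := prim f (2 * pi).

Lemma I_deriv F f : deriv_of F f -> continuous f -> I f = F (2 * pi) - F 0.
Proof. exact: primE. Qed.

Lemma prim_lin f g c d x : continuous f -> continuous g ->
  prim (fun x => c * f x + d * g x) x = c * prim f x + d * prim g x.
Proof.
move=> cf cg; have Df := deriv_prim cf; have Dg := deriv_prim cg.
rewrite (@primE _ _ (fun x => c * prim f x + d * prim g x)).
- by rewrite !prim0; ring.
- by deriv; ring.
- by cts.
Qed.

Lemma ID f g : continuous f -> continuous g ->
  I (fun x => f x + g x) = I f + I g.
Proof.
move=> cf cg; rewrite -[I f]mul1r -[I g]mul1r -[RHS]prim_lin//.
by congr (prim _ _); apply/funext => x; rewrite !mul1r.
Qed.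

Lemma IZ c f : continuous f -> I (fun x => c * f x) = c * I f.
Proof.
move=> cf; rewrite -[RHS]addr0 -(mul0r (I f)) -[RHS]prim_lin//.
by congr (prim _ _); apply/funext => x; ring.
Qed.

Lemma IN f : continuous f -> I (fun x => - f x) = - I f.
Proof.
by move=> cf; rewrite -mulN1r -IZ//; congr I; apply/funext => x; ring.
Qed.

Lemma IB f g : continuous f -> continuous g ->
  I (fun x => f x - g x) = I f - I g.
Proof. by move=> cf cg; rewrite ID ?IN//; cts. Qed.

Lemma pi2_gt0 : 0 < 2 * pi :> R.
Proof. by rewrite mulr_gt0// pi_gt0. Qed.

Lemma I_cst c : I (fun=> c) = c * (2 * pi).
Proof.
rewrite (@I_deriv (fun x => c * x)); first by ring.
  by deriv; ring.
by cts.
Qed.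

Lemma prim_ge0 f x : continuous f -> 0 <= x ->
  (forall y, 0 <= y <= x -> 0 <= f y) -> 0 <= prim f x.
Proof.
move=> cf x0 f0; rewrite -(prim0 f).
exact: (deriv_nondecreasing (deriv_prim cf)).
Qed.

Lemma prim_le f g x : continuous f -> continuous g -> 0 <= x ->
  (forall y, 0 <= y <= x -> f y <= g y) -> prim f x <= prim g x.
Proof.
move=> cf cg x0 fg; have := @prim_ge0 (fun x => 1 * g x + (- 1) * f x) x.
rewrite prim_lin// mul1r mulN1r subr_ge0; apply => //; first by cts.
by move=> y yx; rewrite mul1r mulN1r subr_ge0; exact: fg.
Qed.

Lemma I_ge0 f : continuous f -> (forall x, 0 <= f x) -> 0 <= I f.
Proof. by move=> cf f0; apply: prim_ge0 => //; exact: ltW pi2_gt0. Qed.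

Lemma I_le f g : continuous f -> continuous g -> (forall x, f x <= g x) ->
  I f <= I g.
Proof. by move=> cf cg f0; apply: prim_le => //; exact: ltW pi2_gt0. Qed.

(** The primitive is nondecreasing and vanishes at both ends of the period, so it is constant there
    and its derivative [f] vanishes inside. The two end points follow because the zero set is
    closed. *)
Lemma I_eq0 f : continuous f -> (forall x, 0 <= f x) -> I f = 0 ->
  forall x, 0 <= x <= 2 * pi -> f x = 0.
Proof.
move=> cf f0 If0.
have Df := deriv_prim cf.
have P0 x : 0 <= x <= 2 * pi -> prim f x = 0.
  move=> /andP[x0 x1]; apply/eqP; rewrite eq_le; apply/andP; split.
    by rewrite -If0; apply: (deriv_nondecreasing Df).
  by apply: prim_ge0.
have Q0 x : 0 < x < 2 * pi -> f x = 0.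
  move=> /andP[x0 x1].
  have [_ <-] := Df x; apply: derive_val.
  apply: (@near_eq_is_derive _ _ _ (cst 0)) => //.
  near=> y; rewrite P0//; apply/andP; split; near: y.
    by apply: filterS (lt_nbhsr x0) => z /ltW.
  exact: lt_le_nbhsl.
have cl : closed [set x | f x = 0].
  by apply: (@closed_comp _ _ f [set 0]) => [x _|]; [exact: cf|exact: closed_eq].
move=> x /andP[x0 x1].
have [/andP[? ?]|] := boolP (0 < x < 2 * pi); first by apply: Q0; apply/andP.
move=> /nandP H; apply: cl => U [e /= e0 eU].
pose d := Num.min (e / 2) pi.
have d0 : 0 < d by rewrite lt_min divr_gt0//= pi_gt0.
have de : d < e by rewrite /d gt_min; apply/orP; left; lra.
have dpi : d <= pi by rewrite /d ge_min lexx orbT.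
have p0 := @pi_gt0 R.
case: H => H.
  have E : x = 0 by move: H; rewrite -leNgt => H; apply/eqP; rewrite eq_le H.
  rewrite E in eU.
  exists d; split; first by apply: Q0; apply/andP; split => //; lra.
  apply: eU; rewrite /= sub0r normrN gtr0_norm//.
have E : x = 2 * pi by move: H; rewrite -leNgt => H; apply/eqP; rewrite eq_le x1.
rewrite E in eU.
exists (2 * pi - d); split; first by apply: Q0; apply/andP; split => //; lra.
by apply: eU; rewrite /= opprB addrC subrK gtr0_norm.
Unshelve. all: by end_near. Qed.

Definition per (T : Type) (f : R -> T) := forall x, f (x + 2 * pi) = f x.

Lemma I_deriv_per F f : deriv_of F f -> continuous f -> per F -> I f = 0.
Proof.
by move=> DF cf pF; rewrite (I_deriv DF)// -[2 * pi]add0r pF subrr.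
Qed.

(** By periodicity [prim f (x + 2 * pi)] and [prim f x] have the same derivative, so their
    difference is the constant [I f]. *)
Lemma I_shift f c : continuous f -> per f -> I (fun x => f (x + c)) = I f.
Proof.
move=> cf pf; have Df := deriv_prim cf.
rewrite (@I_deriv (fun x => prim f (x + c))); last by exact: cts_shift.
  have D1 : deriv_of (fun x => prim f (x + 2 * pi)) f.
    by apply: deriv_ext (deriv_shift (2 * pi) Df) _ _ => // x; rewrite pf.
  have := deriv_unique c 0 D1 Df.
  rewrite !add0r prim0 subr0 -/(I f) [c + _]addrC; lra.
exact: deriv_shift.
Qed.

Lemma I_opp f : continuous f -> per f -> I (fun x => f (- x)) = I f.
Proof.
move=> cf pf; have Df := deriv_prim cf.
rewrite (@I_deriv (fun x => - prim f (- x))); last by exact: cts_opparg.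
  have D1 : deriv_of (fun x => prim f (x + 2 * pi)) f.
    by apply: deriv_ext (deriv_shift (2 * pi) Df) _ _ => // x; rewrite pf.
  have := deriv_unique (- (2 * pi)) 0 D1 Df.
  by rewrite !add0r addNr oppr0 prim0 -/(I f); lra.
by apply: deriv_ext (derivN (deriv_opparg Df)) _ _ => // x; rewrite opprK.
Qed.

End Integral.

(** * Complex-valued functions *)

Section ComplexCalculus.
Context {R : realType}.
Implicit Types (f g h : R -> R[i]) (p q : R -> R) (z w : R[i]).
Notation Re := complex.Re.
Notation Im := complex.Im.
Notation normc := Normc.normc.

Lemma cReD z w : Re (z + w) = Re z + Re w. Proof. by case: z; case: w. Qed.
Lemma cImD z w : Im (z + w) = Im z + Im w. Proof. by case: z; case: w. Qed.
Lemma cReN z : Re (- z) = - Re z. Proof. by case: z. Qed.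
Lemma cImN z : Im (- z) = - Im z. Proof. by case: z. Qed.
Lemma cReM z w : Re (z * w) = Re z * Re w - Im z * Im w.
Proof. by case: z; case: w. Qed.
Lemma cImM z w : Im (z * w) = Re z * Im w + Im z * Re w.
Proof. by case: z; case: w. Qed.
Lemma cRec z : Re (conjc z) = Re z. Proof. by case: z. Qed.
Lemma cImc z : Im (conjc z) = - Im z. Proof. by case: z. Qed.
Definition cE := (cReD, cImD, cReN, cImN, cReM, cImM, cRec, cImc).

Lemma cJM z w : conjc (z * w) = conjc z * conjc w. Proof. exact: rmorphM. Qed.
Lemma cJB z w : conjc (z - w) = conjc z - conjc w. Proof. exact: rmorphB. Qed.

Lemma CM (a b : R) : (a * b)%:C = a%:C * b%:C. Proof. exact: rmorphM. Qed.
Lemma CD (a b : R) : (a + b)%:C = a%:C + b%:C. Proof. exact: rmorphD. Qed.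
Lemma CN (a : R) : (- a)%:C = - a%:C. Proof. exact: rmorphN. Qed.
Lemma CB (a b : R) : (a - b)%:C = a%:C - b%:C. Proof. exact: rmorphB. Qed.
Lemma Cn n : (n%:R : R)%:C = n%:R. Proof. exact: rmorph_nat. Qed.

Lemma complex_eq z w : Re z = Re w -> Im z = Im w -> z = w.
Proof. by case: z => a b; case: w => c d /= -> ->. Qed.

Lemma normc2 z : normc z ^+ 2 = Re z ^+ 2 + Im z ^+ 2.
Proof. by case: z => a b; rewrite /normc/= sqr_sqrtr// addr_ge0// sqr_ge0. Qed.

Lemma normc_ge0 z : 0 <= normc z.
Proof. by case: z => a b; rewrite /normc/= sqrtr_ge0. Qed.

Lemma mulcJ z : z * conjc z = (normc z ^+ 2)%:C.
Proof. by rewrite normc2; apply: complex_eq; rewrite !cE /=; ring. Qed.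

Lemma normcJ z : normc (conjc z) = normc z.
Proof. by apply/eqP; rewrite -(@eqrXn2 _ 2)// ?normc_ge0// !normc2 !cE sqrrN. Qed.

Lemma normcR (a : R) : normc a%:C = `|a|.
Proof. by rewrite /normc/= expr0n addr0 sqrtr_sqr. Qed.

Lemma normr_Re z : `|Re z| <= normc z.
Proof.
by rewrite -(@ler_pXn2r _ 2)// ?nnegrE ?normc_ge0// normc2 real_normK ?num_real// lerDl sqr_ge0.
Qed.

Lemma normr_Im z : `|Im z| <= normc z.
Proof.
by rewrite -(@ler_pXn2r _ 2)// ?nnegrE ?normc_ge0// normc2 real_normK ?num_real// lerDr sqr_ge0.
Qed.

Definition cderiv f g :=
  deriv_of (fun x => Re (f x)) (fun x => Re (g x)) /\
  deriv_of (fun x => Im (f x)) (fun x => Im (g x)).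

Definition ccts f := continuous (fun x => Re (f x)) /\ continuous (fun x => Im (f x)).

Lemma cderiv_extr f g g1 : cderiv f g -> g =1 g1 -> cderiv f g1.
Proof. by move=> D /funext <-. Qed.

Lemma cderivD f f' g g' : cderiv f f' -> cderiv g g' ->
  cderiv (fun x => f x + g x) (fun x => f' x + g' x).
Proof.
by move=> [f1 f2] [g1 g2]; split; eapply deriv_ext;
  [exact: derivD f1 g1|move=> x|move=> x|exact: derivD f2 g2|move=> x|move=> x]; rewrite !cE.
Qed.

Lemma cderivN f f' : cderiv f f' -> cderiv (fun x => - f x) (fun x => - f' x).
Proof.
by move=> [f1 f2]; split; eapply deriv_ext;
  [exact: derivN f1|move=> x|move=> x|exact: derivN f2|move=> x|move=> x]; rewrite !cE.
Qed.

Lemma cderivB f f' g g' : cderiv f f' -> cderiv g g' ->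
  cderiv (fun x => f x - g x) (fun x => f' x - g' x).
Proof. by move=> Df Dg; apply: cderivD => //; exact: cderivN. Qed.

Lemma cderivJ f f' : cderiv f f' ->
  cderiv (fun x => conjc (f x)) (fun x => conjc (f' x)).
Proof.
by move=> [f1 f2]; split; eapply deriv_ext;
  [exact: f1|move=> x|move=> x|exact: derivN f2|move=> x|move=> x]; rewrite !cE.
Qed.

Lemma cderivM f f' g g' : cderiv f f' -> cderiv g g' ->
  cderiv (fun x => f x * g x) (fun x => f' x * g x + f x * g' x).
Proof.
move=> [f1 f2] [g1 g2]; split; eapply deriv_ext.
- exact: derivB (derivM f1 g1) (derivM f2 g2).
- by move=> x; rewrite !cE.
- by move=> x; rewrite !cE /=; ring.
- exact: derivD (derivM f1 g2) (derivM f2 g1).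
- by move=> x; rewrite !cE.
- by move=> x; rewrite !cE /=; ring.
Qed.

Lemma cderiv_cst z : cderiv (fun=> z) (fun=> 0).
Proof. by split; exact: deriv_cst. Qed.

Lemma cderivZ z f f' : cderiv f f' -> cderiv (fun x => z * f x) (fun x => z * f' x).
Proof.
by move=> Df; apply: (cderiv_extr (cderivM (cderiv_cst z) Df)) => x; rewrite mul0r add0r.
Qed.

Lemma cderivR p p' : deriv_of p p' -> cderiv (fun x => (p x)%:C) (fun x => (p' x)%:C).
Proof. by move=> Dp; split => //; exact: deriv_cst. Qed.

Lemma cderiv_ccts f g : cderiv f g -> ccts f.
Proof. by move=> [? ?]; split; apply: deriv_continuous; eassumption. Qed.

Lemma cctsD f g : ccts f -> ccts g -> ccts (fun x => f x + g x).
Proof.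
move=> [f1 f2] [g1 g2]; split.
  by apply: (cts_ext (ctsD f1 g1)) => x; rewrite cReD.
by apply: (cts_ext (ctsD f2 g2)) => x; rewrite cImD.
Qed.

Lemma cctsN f : ccts f -> ccts (fun x => - f x).
Proof.
move=> [f1 f2]; split.
  by apply: (cts_ext (ctsN f1)) => x; rewrite cReN.
by apply: (cts_ext (ctsN f2)) => x; rewrite cImN.
Qed.

Lemma cctsB f g : ccts f -> ccts g -> ccts (fun x => f x - g x).
Proof. by move=> cf cg; apply: cctsD => //; exact: cctsN. Qed.

Lemma cctsJ f : ccts f -> ccts (fun x => conjc (f x)).
Proof.
move=> [f1 f2]; split.
  by apply: (cts_ext f1) => x; rewrite cRec.
by apply: (cts_ext (ctsN f2)) => x; rewrite cImc.
Qed.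

Lemma cctsM f g : ccts f -> ccts g -> ccts (fun x => f x * g x).
Proof.
move=> [f1 f2] [g1 g2]; split.
  by apply: (cts_ext (ctsB (ctsM f1 g1) (ctsM f2 g2))) => x; rewrite cReM.
by apply: (cts_ext (ctsD (ctsM f1 g2) (ctsM f2 g1))) => x; rewrite cImM.
Qed.

Lemma ccts_cst z : ccts (fun=> z).
Proof. by split; exact: cts_cst. Qed.

Lemma cctsR p : continuous p -> ccts (fun x => (p x)%:C).
Proof. by move=> cp; split => //; exact: cts_cst. Qed.

Definition cI f : R[i] := (I (fun x => Re (f x))) +i* (I (fun x => Im (f x))).

Definition nrm2 f : R := I (fun x => Re (f x) ^+ 2 + Im (f x) ^+ 2).
Definition nrm f : R := Num.sqrt (nrm2 f).

End ComplexCalculus.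

Ltac ccts_step :=
  lazymatch goal with
  | |- ccts (fun x => (@?f x)%:C) => apply: (@cctsR _ f); cts
  | |- ccts (fun x => (@?f x) - (@?g x)) => apply: (@cctsB _ f g)
  | |- ccts (fun x => (@?f x) + (@?g x)) => apply: (@cctsD _ f g)
  | |- ccts (fun x => - (@?f x)) => apply: (@cctsN _ f)
  | |- ccts (fun x => (@?f x) * (@?g x)) => apply: (@cctsM _ f g)
  | |- ccts (fun x => conjc (@?f x)) => apply: (@cctsJ _ f)
  | |- ccts ?F => first [ match goal with H : ccts F |- _ => exact: H end
      | match goal with H : cderiv F _ |- _ => exact: (cderiv_ccts H) end
      | assumption | exact: ccts_cst | eapply cderiv_ccts; eassumption ]
  end.
Ltac ccts := repeat ccts_step.
Ltac cderiv_step :=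
  lazymatch goal with
  | |- cderiv (fun x => (@?f x)%:C) _ => apply: (@cderivR _ f); repeat deriv_step
  | |- cderiv (fun x => (@?f x) - (@?g x)) _ => apply: (@cderivB _ f _ g)
  | |- cderiv (fun x => (@?f x) + (@?g x)) _ => apply: (@cderivD _ f _ g)
  | |- cderiv (fun x => - (@?f x)) _ => apply: (@cderivN _ f)
  | |- cderiv (fun x => (@?f x) * (@?g x)) _ => apply: (@cderivM _ f _ g)
  | |- cderiv (fun x => conjc (@?f x)) _ => apply: (@cderivJ _ f)
  | |- cderiv ?F _ => first [ match goal with H : cderiv F _ |- _ => exact: H end | eassumption | exact: cderiv_cst ]
  end.
Ltac cderiv := eapply cderiv_extr; [ repeat cderiv_step | move=> ? /=].

(** * Pairings and norms of complex-valued functions over a period *)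

Section ComplexIntegral.
Context {R : realType}.
Implicit Types (f g h : R -> R[i]) (p q : R -> R) (z w : R[i]).
Notation Re := complex.Re.
Notation Im := complex.Im.
Notation normc := Normc.normc.

Lemma Re_cI f : Re (cI f) = I (fun x => Re (f x)). Proof. by []. Qed.
Lemma cID f g : ccts f -> ccts g -> cI (fun x => f x + g x) = cI f + cI g.
Proof.
move=> [? ?] [? ?]; apply: complex_eq; rewrite !cE /= -ID//.
  by congr I; apply/funext => x; rewrite cReD.
by congr I; apply/funext => x; rewrite cImD.
Qed.

Lemma cIZ z f : ccts f -> cI (fun x => z * f x) = z * cI f.
Proof.
move=> [c1 c2]; apply: complex_eq; rewrite !cE /= -!IZ//.
  by rewrite -IB; try (by cts); congr I; apply/funext => x; rewrite cReM.
by rewrite -ID; try (by cts); congr I; apply/funext => x; rewrite cImM.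
Qed.

Lemma cIN f : ccts f -> cI (fun x => - f x) = - cI f.
Proof. by move=> cf; rewrite -mulN1r -cIZ//; congr cI; apply/funext => x; rewrite mulN1r. Qed.

Lemma cIB f g : ccts f -> ccts g -> cI (fun x => f x - g x) = cI f - cI g.
Proof. by move=> cf cg; rewrite cID ?cIN//; exact: cctsN. Qed.

Lemma cIR p : cI (fun x => (p x)%:C) = (I p)%:C.
Proof. by apply: complex_eq => //=; rewrite I_cst mul0r. Qed.

Lemma cI0 : cI (fun=> 0) = 0 :> R[i].
Proof. by rewrite (cIR (fun=> 0)) I_cst mul0r. Qed.

Lemma cIJ f : ccts f -> cI (fun x => conjc (f x)) = conjc (cI f).
Proof.
move=> [? ?]; apply: complex_eq; rewrite !cE /= -?IN//.
  by congr I; apply/funext => x; rewrite cRec.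
by congr I; apply/funext => x; rewrite cImc.
Qed.

Lemma cI_deriv_per f g : cderiv f g -> ccts g -> per f -> cI g = 0.
Proof.
move=> [d1 d2] [c1 c2] pf; apply: complex_eq.
  by apply: (I_deriv_per d1) => // x; rewrite pf.
by apply: (I_deriv_per d2) => // x; rewrite pf.
Qed.

Lemma cI_parts f f' g g' : cderiv f f' -> cderiv g g' -> ccts f' -> ccts g' ->
  per f -> per g -> cI (fun x => f' x * g x) = - cI (fun x => f x * g' x).
Proof.
move=> Df Dg cf' cg' pf pg.
have cf := cderiv_ccts Df; have cg := cderiv_ccts Dg.
apply/eqP; rewrite -subr_eq0 opprK -cID; try by ccts.
apply/eqP; apply: (cI_deriv_per (cderivM Df Dg)); first by ccts.
by move=> x; rewrite pf pg.
Qed.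

Lemma nrm2_ge0 f : ccts f -> 0 <= nrm2 f.
Proof. by move=> [? ?]; apply: I_ge0 => [|x]; [cts|rewrite addr_ge0// sqr_ge0]. Qed.

Lemma nrm_ge0 f : 0 <= nrm f.
Proof. exact: sqrtr_ge0. Qed.

Lemma nrmK f : ccts f -> nrm f ^+ 2 = nrm2 f.
Proof. by move=> cf; rewrite sqr_sqrtr// nrm2_ge0. Qed.

Lemma cI_mulJ f : cI (fun x => f x * conjc (f x)) = (nrm2 f)%:C.
Proof.
rewrite /nrm2 -cIR; congr cI; apply/funext => x; rewrite mulcJ normc2//.
Qed.

(** The discriminant argument behind Cauchy-Schwarz: the polynomial in [s] is the squared norm of
    [f - s z conj(g)], where [z] is the pairing of [f] and [g] and [b = |z| ^ 2]. Its value at the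
    minimum [s = 1 / c] is the claim; for [c = 0] the choice [s = (a + 1) / b] gives [- a - 2],
    which is negative. *)
Lemma quadratic_bound (a b c : R) : 0 <= a -> 0 <= c ->
  (forall s, 0 <= a - 2 * s * b + s ^+ 2 * (b * c)) -> b <= a * c.
Proof.
move=> a0 c0 H; have [c1|] := ltP 0 c.
  have := H c^-1; rewrite (_ : _ + _ = a - b * c^-1); last by field; rewrite gt_eqF.
  by rewrite subr_ge0 ler_pdivrMr.
move=> c1; have {c0 c1}c_eq0 : c = 0 by apply/eqP; rewrite eq_le c0 c1.
rewrite c_eq0 mulr0; have [//|b0] := leP b 0.
have := H ((a + 1) / b); rewrite c_eq0 !mulr0 addr0 (_ : _ - _ = - a - 2); first by lra.
by field; rewrite gt_eqF.
Qed.

Lemma cauchy_schwarz2 f g : ccts f -> ccts g ->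
  normc (cI (fun x => f x * g x)) ^+ 2 <= nrm2 f * nrm2 g.
Proof.
move=> cf cg; set z := cI _; apply: quadratic_bound; try exact: nrm2_ge0.
move=> s.
have := @nrm2_ge0 (fun x => f x - s%:C * z * conjc (g x)) _.
have -> : nrm2 (fun x => f x - s%:C * z * conjc (g x)) =
   nrm2 f - 2 * s * normc z ^+ 2 + s ^+ 2 * (normc z ^+ 2 * nrm2 g).
  have : (nrm2 (fun x => f x - s%:C * z * conjc (g x)))%:C =
   (nrm2 f - 2 * s * normc z ^+ 2 + s ^+ 2 * (normc z ^+ 2 * nrm2 g))%:C.
    rewrite -cI_mulJ.
    have -> : (fun x => (f x - s%:C * z * conjc (g x)) *
         conjc (f x - s%:C * z * conjc (g x))) =
      (fun x => f x * conjc (f x) - (s%:C * conjc z) * (f x * g x)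
        - (s%:C * z) * conjc (f x * g x) + (s%:C ^+ 2 * (z * conjc z)) * (g x * conjc (g x))).
      apply/funext => x; have : conjc s%:C = s%:C by rewrite conjc_real.
      move: s%:C => t tJ; rewrite cJB !cJM conjcK tJ.
      by ring.
    rewrite cID ?cIB ?cIZ ?cIJ ?cI_mulJ -/z; try by ccts.
    have E : (normc z)%:C * (normc z)%:C = z * conjc z by rewrite -CM -expr2 mulcJ.
    by rewrite CD CB !CM Cn E; ring.
  by move=> [].
by apply; ccts.
Qed.

Lemma cauchy_schwarz f g : ccts f -> ccts g ->
  normc (cI (fun x => f x * g x)) <= nrm f * nrm g.
Proof.
move=> cf cg; rewrite -(@ler_pXn2r _ 2)// ?nnegrE ?mulr_ge0 ?nrm_ge0 ?normc_ge0//.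
by rewrite exprMn !nrmK//; exact: cauchy_schwarz2.
Qed.

Lemma nrm2J f : nrm2 (fun x => conjc (f x)) = nrm2 f.
Proof. by congr I; apply/funext => x; rewrite !cE sqrrN. Qed.

Lemma nrmJ f : nrm (fun x => conjc (f x)) = nrm f.
Proof. by rewrite /nrm nrm2J. Qed.

Lemma nrm2Z z f : ccts f -> nrm2 (fun x => z * f x) = normc z ^+ 2 * nrm2 f.
Proof.
move=> [cf cg]; rewrite /nrm2 -IZ; last by cts.
by congr I; apply/funext => x; rewrite normc2 !cE; ring.
Qed.

Lemma nrmZ z f : ccts f -> nrm (fun x => z * f x) = normc z * nrm f.
Proof.
by move=> cf; rewrite /nrm nrm2Z// sqrtrM ?sqr_ge0// sqrtr_sqr ger0_norm// normc_ge0.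
Qed.

Lemma ler_nrm f g : ccts f -> ccts g -> (forall x, normc (f x) <= normc (g x)) ->
  nrm f <= nrm g.
Proof.
move=> [f1 f2] [g1 g2] H; apply: ler_wsqrtr; apply: I_le; try by cts.
move=> x /=; rewrite -!normc2; have := normc_ge0 (f x); have := H x; have := normc_ge0 (g x).
by move=> *; rewrite ler_pXn2r// nnegrE.
Qed.

Lemma nrm_cst z : nrm (fun=> z) = normc z * Num.sqrt (2 * pi).
Proof.
rewrite /nrm /nrm2 I_cst -normc2 sqrtrM ?sqr_ge0// sqrtr_sqr ger0_norm ?normc_ge0//.
Qed.

Lemma nrm2D f g : ccts f -> ccts g ->
  nrm2 (fun x => f x + g x) =
  nrm2 f + nrm2 g + 2 * Re (cI (fun x => f x * conjc (g x))).
Proof.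
move=> cf cg; have [C _] := cctsM cf (cctsJ cg).
case: cf cg => [? ?] [? ?]; rewrite Re_cI /nrm2 -IZ// -!ID; try by cts.
by congr I; apply/funext => x; rewrite !cE; ring.
Qed.

Lemma nrmD f g : ccts f -> ccts g -> nrm (fun x => f x + g x) <= nrm f + nrm g.
Proof.
move=> cf cg; rewrite -(@ler_pXn2r _ 2)// ?nnegrE ?addr_ge0 ?nrm_ge0//.
rewrite nrmK; last by ccts.
rewrite nrm2D// -!nrmK//.
have := cauchy_schwarz cf (cctsJ cg); rewrite nrmJ.
have := normr_Re (cI (fun x => f x * conjc (g x))).
set r := Re _; have := ler_norm r; nra.
Qed.

Lemma nrm_eq0 f : ccts f -> nrm f = 0 -> forall x, 0 <= x <= 2 * pi -> f x = 0.
Proof.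
move=> cf H x xb; have H2 : nrm2 f = 0 by rewrite -nrmK// H expr0n.
case: cf => c1 c2.
have : Re (f x) ^+ 2 + Im (f x) ^+ 2 = 0.
  apply: (I_eq0 _ _ H2) => //; first by cts.
  by move=> y; rewrite addr_ge0// sqr_ge0.
move=> /eqP; rewrite paddr_eq0 ?sqr_ge0// !sqrf_eq0 => /andP[/eqP a /eqP b].
exact: complex_eq.
Qed.

End ComplexIntegral.

(** * A Poincare inequality *)

Section Poincare.
Context {R : realType}.
Implicit Types (f g h : R -> R).

Lemma deriv_ge0_nonneg f f' : deriv_of f f' -> f 0 = 0 ->
  (forall x, 0 <= x -> 0 <= f' x) -> forall x, 0 <= x -> 0 <= f x.
Proof.
move=> Df f0 f'0 x x0; rewrite -f0.
by apply: (deriv_nondecreasing Df) => // y /andP[+ _]; exact: f'0.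
Qed.

(** Four integrations from 0, starting with [cos <= 1]. *)
Lemma cos_taylor4 (x : R) : 0 <= x -> cos x <= 1 - x ^+ 2 / 2 + x ^+ 4 / 24.
Proof.
move=> x0.
have h1 (y : R) : 0 <= y -> 0 <= y - sin y.
  apply: (@deriv_ge0_nonneg (fun y => y - sin y) (fun y => 1 - cos y)); first by deriv; ring.
    by rewrite sin0 subr0.
  by move=> z _; rewrite subr_ge0 cos_le1.
have h2 (y : R) : 0 <= y -> 0 <= cos y - 1 + y ^+ 2 / 2.
  apply: (@deriv_ge0_nonneg (fun y => cos y - 1 + y ^+ 2 / 2) (fun y => y - sin y)) => //; first by deriv; field.
  by rewrite cos0; ring.
have h3 (y : R) : 0 <= y -> 0 <= sin y - y + y ^+ 3 / 6.
  apply: (@deriv_ge0_nonneg (fun y => sin y - y + y ^+ 3 / 6) (fun y => cos y - 1 + y ^+ 2 / 2)) => //; first by deriv; field.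
  by rewrite sin0; ring.
have h4 (y : R) : 0 <= y -> 0 <= 1 - y ^+ 2 / 2 + y ^+ 4 / 24 - cos y.
  apply: (@deriv_ge0_nonneg (fun y => 1 - y ^+ 2 / 2 + y ^+ 4 / 24 - cos y) (fun y => sin y - y + y ^+ 3 / 6)) => //; first by deriv; field.
  by rewrite cos0; ring.
by rewrite -subr_ge0; exact: h4.
Qed.

(** At 1.605 the Taylor bound is already negative, whereas cosine would be positive there if [pi]
    exceeded 3.21. This precision is just enough for the constant 9/25 in the Poincare
    inequality. *)
Lemma pi_le : pi <= 321 / 100 :> R.
Proof.
rewrite leNgt; apply/negP => H.
have p0 := @pi_gt0 R.
have H1 : - (pi / 2) < (321 / 200 : R) < pi / 2 by apply/andP; split; lra.
have := cos_gt0_pihalf H1.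
by have := @cos_taylor4 (321 / 200) ltac:(lra); lra.
Qed.

(** On the period this is the sum of [cos (n t) / n ^ 2] over [n >= 2]: the quadratic polynomial is
    the full series from [n = 1], and [cos (t - pi) = - cos t] removes the first term. Up to the
    factor [- pi] it inverts the second derivative on the modes beyond the first. *)
Let beta (t : R) : R := (t - pi) ^+ 2 / 4 - pi ^+ 2 / 12 + cos (t - pi).
Let beta' (t : R) : R := (t - pi) / 2 - sin (t - pi).
Let beta'' (t : R) : R := 1 / 2 - cos (t - pi).

Let Dbeta : deriv_of beta beta'.
Proof. by rewrite /beta /beta'; deriv; field. Qed.

Let Dbeta' : deriv_of beta' beta''.
Proof. by rewrite /beta' /beta''; deriv; field. Qed.

Let cbeta : continuous beta. Proof. exact: deriv_continuous Dbeta. Qed.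

Let pi2pi : 2 * pi - pi = pi :> R. Proof. by ring. Qed.

(** By Parseval the value is [pi] times the sum of [1 / n ^ 4] over [n >= 2]. The proof uses an
    explicit antiderivative [B] in the variable [s = t - pi]. *)
Let Ibeta2 : I (fun t => beta t ^+ 2) = pi * (pi ^+ 4 / 90 - 1).
Proof.
pose B (s : R) := s ^+ 5 / 80 + (s ^+ 2 * sin s + 2 * s * cos s - 2 * sin s) / 2 +
  (s + sin s * cos s) / 2 - pi ^+ 2 / 6 * (s ^+ 3 / 12 + sin s) + (pi ^+ 2 / 12) ^+ 2 * s.
have DB : deriv_of B (fun s => (s ^+ 2 / 4 - pi ^+ 2 / 12 + cos s) ^+ 2).
  rewrite /B; eapply deriv_extr; first by repeat deriv_step.
  move=> s /=; apply/eqP; rewrite -subr_eq0; apply/eqP.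
  transitivity ((1 - (cos s ^+ 2 + sin s ^+ 2)) / 2); first by field.
  by rewrite cos2Dsin2 subrr mul0r.
rewrite (I_deriv (deriv_shift (- pi) DB)); last by rewrite /beta; cts.
rewrite /B pi2pi add0r sinN cosN sinpi cospi; by field.
Qed.

(** Two integrations by parts against [beta]: its second derivative [1 / 2 + cos t] pairs to zero
    with [h], and the jump [pi] of [beta'] across the period leaves [- pi * h 0]. Cauchy-Schwarz
    then bounds this value. *)
Lemma kernel_bound h h' h'' : deriv_of h h' -> deriv_of h' h'' -> continuous h'' ->
  per h -> per h' -> I h = 0 -> I (fun t => h t * cos t) = 0 ->
  (pi * h 0) ^+ 2 <= pi * (pi ^+ 4 / 90 - 1) * I (fun t => h'' t ^+ 2).
Proof.
move=> D1 D2 c2 p0 p1 I0 I1.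
have c0 := deriv_continuous D1.
have E : I (fun t => beta t * h'' t) = - (pi * h 0).
  have D : deriv_of (fun t => beta t * h' t - beta' t * h t)
                    (fun t => beta t * h'' t - (1 / 2 * h t + h t * cos t)).
    deriv; rewrite /beta'' cosB cospi sinpi; ring.
  have := I_deriv D ltac:(cts); rewrite IB; try by cts.
  rewrite ID ?IZ ?I0 ?I1; try by cts.
  rewrite mulr0 addr0 subr0 => ->.
  have := p0 0; have := p1 0; rewrite add0r => -> ->.
  rewrite /beta /beta' pi2pi add0r sinN cosN sinpi cospi; by field.
have := @cauchy_schwarz2 R (fun t => (beta t)%:C) (fun t => (h'' t)%:C)
   ltac:(ccts) ltac:(ccts).
have -> : (fun x => (beta x)%:C * (h'' x)%:C) = (fun x => (beta x * h'' x)%:C).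
  by apply/funext => x; rewrite CM.
rewrite cIR E normcR real_normK ?num_real// sqrrN => /le_trans; apply.
rewrite -Ibeta2 le_eqVlt; apply/orP; left; apply/eqP; congr (_ * _);
  by congr I; apply/funext => x /=; rewrite expr0n addr0.
Qed.

Lemma per_cos : per (@cos R). Proof. by move=> x; rewrite mulr_natl cosD2pi. Qed.
Lemma per_sin : per (@sin R). Proof. by move=> x; rewrite mulr_natl sinD2pi. Qed.

(** The pointwise bound, applied to all translates of [f] and integrated over the period, gives the
    constant [2 * (pi ^ 4 / 90 - 1)], which is below 9/25. The sharp constant is 1/16, but a
    first-order constant below 1 is all that the energy estimates call for. *)
Lemma poincare2 f f' f'' : deriv_of f f' -> deriv_of f' f'' -> continuous f'' ->
  per f -> per f' -> per f'' ->
  I f = 0 -> I (fun t => f t * cos t) = 0 -> I (fun t => f t * sin t) = 0 ->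
  I (fun t => f t ^+ 2) <= 9 / 25 * I (fun t => f'' t ^+ 2).
Proof.
move=> D1 D2 c2 p0 p1 p2 I0 I1 I2.
have c0 := deriv_continuous D1.
have K x : (pi * f x) ^+ 2 <= pi * (pi ^+ 4 / 90 - 1) * I (fun t => f'' t ^+ 2).
  have := @kernel_bound (fun t => f (t + x)) (fun t => f' (t + x)) (fun t => f'' (t + x))
    (deriv_shift x D1) (deriv_shift x D2) (@cts_shift R f'' x c2).
  rewrite add0r; move=> /(_ _ _ _ _)/le_trans; apply.
  - by move=> t; rewrite addrAC p0.
  - by move=> t; rewrite addrAC p1.
  - by rewrite I_shift.
  (* The cosine coefficient of a translate is a combination of the cosine and sine coefficients of
     [f], which both vanish. *)
  - have -> : (fun t => f (t + x) * cos t) =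
      (fun t => (fun t => cos x * (f t * cos t) + sin x * (f t * sin t)) (t + x)).
      apply/funext => t; have -> : cos t = cos (t + x - x) by rewrite addrK.
      by rewrite cosB /=; ring.
    rewrite (@I_shift _ (fun t => cos x * (f t * cos t) + sin x * (f t * sin t))).
    + by rewrite ID ?IZ ?I1 ?I2 ?mulr0 ?addr0//; cts.
    + by cts.
    + by move=> t; rewrite p0 per_cos per_sin.
  - rewrite (@I_shift _ (fun t => f'' t ^+ 2)) //; first by cts.
    by move=> t; rewrite p2.
have := @I_le R (fun t => pi ^+ 2 * f t ^+ 2)
  (fun=> pi * (pi ^+ 4 / 90 - 1) * I (fun t => f'' t ^+ 2)) ltac:(cts) ltac:(cts).
rewrite IZ ?I_cst; last by cts.
have J0 : 0 <= I (fun t => f'' t ^+ 2) by apply: I_ge0 => [|t]; [cts|exact: sqr_ge0].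
move: K J0; set b := I (fun t => f'' t ^+ 2); set a := I (fun t => f t ^+ 2) => K b0 H.
have {}H : pi ^+ 2 * a <= pi * (pi ^+ 4 / 90 - 1) * b * (2 * pi).
  by apply: H => x; rewrite -exprMn; exact: K.
have p := @pi_gt0 R; have p1' := pi_le.
have {H} : a <= 2 * (pi ^+ 4 / 90 - 1) * b.
  rewrite -(@ler_pM2l _ (pi ^+ 2)) ?exprn_gt0// (le_trans H)//.
  by rewrite le_eqVlt; apply/orP; left; apply/eqP; ring.
move=> /le_trans; apply; apply: ler_wpM2r => //.
have : pi ^+ 4 <= (321 / 100 : R) ^+ 4 by rewrite ler_pXn2r// nnegrE; lra.
lra.
Qed.

(** Interpolation: if [S] is the mean-free primitive of [f], then [I (f ^ 2) = - I (S f')], and the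
    inequality with two derivatives applies to [S], whose second derivative is [f']. Hence the
    constant 3/5, the square root of 9/25. *)
Lemma poincare f f' : deriv_of f f' -> continuous f' -> per f -> per f' ->
  I f = 0 -> I (fun t => f t * cos t) = 0 -> I (fun t => f t * sin t) = 0 ->
  I (fun t => f t ^+ 2) <= 3 / 5 * I (fun t => f' t ^+ 2).
Proof.
move=> D1 c1 p0 p1 I0 I1 I2.
have c0 := deriv_continuous D1.
pose m := I (prim f) / (2 * pi).
pose S x := prim f x - m.
have DS : deriv_of S f by rewrite /S; have := deriv_prim c0 => ?; deriv; ring.
have pS : per S.
  have D2 : deriv_of (fun x => S (x + 2 * pi)) f.
    by apply: (deriv_extr (deriv_shift _ DS)) => x; rewrite p0.
  move=> x; have := deriv_unique x 0 D2 DS.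
  by rewrite /S add0r prim0 -/(I f) I0; lra.
have IS0 : I S = 0.
  rewrite /S IB; last by cts.
    by rewrite I_cst /m mulfVK ?subrr// gt_eqF// pi2_gt0.
  by apply: deriv_continuous; exact: deriv_prim.
have D1' := @is_derive_cos R : deriv_of cos (fun x => - sin x).
have D2' := @is_derive_sin R : deriv_of sin cos.
have cS := deriv_continuous DS.
have IS1 : I (fun t => S t * cos t) = 0.
  have D : deriv_of (fun t => S t * sin t) (fun t => f t * sin t + S t * cos t).
    by deriv; ring.
  have := I_deriv_per D ltac:(cts); rewrite ID; try by cts.
  by rewrite I2 add0r; apply => x; rewrite pS per_sin.
have IS2 : I (fun t => S t * sin t) = 0.
  have D : deriv_of (fun t => S t * cos t) (fun t => f t * cos t - S t * sin t).
    by deriv; ring.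
  have := I_deriv_per D ltac:(cts); rewrite IB; try by cts.
  rewrite I1 add0r => H; apply/eqP; rewrite -oppr_eq0; apply/eqP/H.
  by move=> x; rewrite pS per_cos.
have P := poincare2 DS D1 c1 pS p0 p1 IS0 IS1 IS2.
have E : I (fun t => f t ^+ 2) = - I (fun t => S t * f' t).
  have D : deriv_of (fun t => S t * f t) (fun t => f t ^+ 2 + S t * f' t).
    by deriv; rewrite expr2.
  have := I_deriv_per D ltac:(cts); rewrite ID; try by cts.
  by move=> H; apply/eqP; rewrite -addr_eq0 H// => x; rewrite pS p0.
rewrite E -IN; last by cts.
(* Young's inequality, with weights balanced so that each term contributes 3/10. *)
have := @I_le R (fun t => - (S t * f' t)) (fun t => 5 / 6 * S t ^+ 2 + 3 / 10 * f' t ^+ 2)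
  ltac:(cts) ltac:(cts).
rewrite (ID (f := fun t => 5 / 6 * S t ^+ 2)) ?IZ; try by cts.
move=> H; apply: le_trans (H _) _; last by lra.
move=> x; rewrite -subr_ge0 (_ : _ - _ = 5 / 6 * (S x + 3 / 5 * f' x) ^+ 2); last by field.
by rewrite mulr_ge0// sqr_ge0.
Qed.

Lemma cpoincare (f f' : R -> R[i]) : cderiv f f' -> ccts f' -> per f -> per f' ->
  cI f = 0 -> cI (fun t => f t * (cos t)%:C) = 0 -> cI (fun t => f t * (sin t)%:C) = 0 ->
  nrm2 f <= 3 / 5 * nrm2 f'.
Proof.
move=> Df cf' pf pf' [I1 I2] [I3 I4] [I5 I6].
have [? ?] := cderiv_ccts Df; case: Df cf' => D1 D2 [c1 c2].
rewrite /nrm2 !ID; try by cts.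
rewrite mulrDr; apply: lerD.
  apply: (poincare D1) => //; do ?by [move=> x; rewrite pf|move=> x; rewrite pf'].
    by rewrite -I3; congr I; apply/funext => t; rewrite !cE /= mulr0 subr0.
  by rewrite -I5; congr I; apply/funext => t; rewrite !cE /= mulr0 subr0.
apply: (poincare D2) => //; do ?by [move=> x; rewrite pf|move=> x; rewrite pf'].
  by rewrite -I4; congr I; apply/funext => t; rewrite !cE /= mulr0 add0r.
by rewrite -I6; congr I; apply/funext => t; rewrite !cE /= mulr0 add0r.
Qed.

End Poincare.

(** * The system for the first Fourier coefficients *)

Section ReducedProblem.
Context {R : realType}.
Notation Re := complex.Re.
Notation Im := complex.Im.
Notation normc := (@Normc.normc R).

Lemma normc_eq0 (z : R[i]) : normc z <= 0 -> z = 0.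
Proof.
by move=> h; apply: Normc.eq0_normc; apply/eqP; rewrite eq_le h normc_ge0.
Qed.

(** For [L >= 1/16] the first two inequalities make [X] and [Y] small against [n + m]. The energy
    inequality then bounds [n ^ 2 + m ^ 2] by a small multiple of itself. *)
Lemma large_eigenvalue (n m X Y d L : R) :
  0 <= n -> 0 <= m -> 0 <= X -> 0 <= Y -> 0 <= d -> d <= 1 / 1000 -> 1 / 16 <= L ->
  L * X <= d * (Y + m) -> L * Y <= d * (X + n) ->
  n ^+ 2 / 2 + m ^+ 2 / 2 <= d * X * n + d * Y * m + L * Y * X ->
  [/\ n = 0, m = 0, X <= 0 & Y <= 0].
Proof.
move=> n0 m0 X0 Y0 d0 d1 L1 LX LY H.
have LX' : 1 / 16 * X <= L * X by apply: ler_wpM2r.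
have LY' : 1 / 16 * Y <= L * Y by apply: ler_wpM2r.
have dX : d * (Y + m) <= 1 / 1000 * (Y + m) by apply: ler_wpM2r => //; rewrite addr_ge0.
have dY : d * (X + n) <= 1 / 1000 * (X + n) by apply: ler_wpM2r => //; rewrite addr_ge0.
have Xs : X <= n + m by lra.
have Ys : Y <= n + m by lra.
have H1 : L * Y * X <= 1 / 1000 * (X + n) * X by apply: ler_wpM2r => //; lra.
have H2 : d * X * n <= 1 / 1000 * X * n.
  by apply: ler_wpM2r => //; apply: ler_wpM2r.
have H3 : d * Y * m <= 1 / 1000 * Y * m.
  by apply: ler_wpM2r => //; apply: ler_wpM2r.
have K : X * n + Y * m + (X + n) * X <= 5 * (n + m) ^+ 2.
  by clear -n0 m0 X0 Y0 Xs Ys; nra.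
have nm : (n + m) ^+ 2 <= 2 * (n ^+ 2 + m ^+ 2).
  by rewrite -subr_ge0 (_ : _ - _ = (n - m) ^+ 2) ?sqr_ge0//; ring.
have n2 : n ^+ 2 + m ^+ 2 <= 0 by clear -H H1 H2 H3 K nm; lra.
have nz : n = 0.
  by apply/eqP; rewrite -sqrf_eq0 eq_le sqr_ge0 andbT (le_trans _ n2)// lerDl sqr_ge0.
have mz : m = 0.
  by apply/eqP; rewrite -sqrf_eq0 eq_le sqr_ge0 andbT (le_trans _ n2)// lerDr sqr_ge0.
by split=> //; move: Xs Ys; rewrite nz mz addr0.
Qed.

(** For [L < 1/16] the coupling [L * n * m] is absorbed after dividing by [n] and by [m]. It brings
    in [Y], which may be much larger than [X]; but it does so only in the product [L * Y], which is
    controlled by [X] and [n]. By symmetry the lemma also bounds [m] by [Y]. *)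
Lemma small_eigenvalue (n m X Y d L : R) :
  0 <= n -> 0 <= m -> 0 <= X -> 0 <= Y -> 0 <= d -> d <= 1 / 1000 ->
  0 <= L -> L < 1 / 16 -> L * Y <= d * (X + n) ->
  n ^+ 2 / 2 <= d * X * n + L * (n * m) ->
  m ^+ 2 / 2 <= d * Y * m + L * (n * m) -> n <= 3 * d * X.
Proof.
move=> n0 m0 X0 Y0 d0 d1 L0 L1 LY Pn Pm.
have hn : n <= 2 * (d * X + L * m).
  have [->|nn] := eqVneq n 0.
    by rewrite mulr_ge0// addr_ge0// mulr_ge0.
  have np : 0 < n by rewrite lt_neqAle eq_sym nn.
  by rewrite -(ler_pM2r np); lra.
have hm : m <= 2 * (d * Y + L * n).
  have [->|nn] := eqVneq m 0.
    by rewrite mulr_ge0// addr_ge0// mulr_ge0.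
  have np : 0 < m by rewrite lt_neqAle eq_sym nn.
  by rewrite -(ler_pM2r np); lra.
have h1 : L * m <= L * (2 * (d * Y + L * n)) by apply: ler_wpM2l.
have h2 : L * L * n <= 1 / 256 * n by apply: ler_wpM2r => //; clear -L0 L1; nra.
have h3 : d * (L * Y) <= 1 / 1000 * (L * Y) by apply: ler_wpM2r => //; rewrite mulr_ge0.
have h5 : d * n <= 1 / 1000 * n by apply: ler_wpM2r.
have h6 : 0 <= d * X by rewrite mulr_ge0.
by lra.
Qed.

(** Both [w + p] and [w + q] have the strict sign of [w], so the nonzero [s] would have to be of
    both signs. *)
Lemma sign_contradiction (s w p q : R) : s != 0 -> 0 < `|w| ->
  `|p| <= 2 / 100 * `|w| -> `|q| <= 2 / 100 * `|w| ->
  s * (w + p) <= 0 -> 0 <= s * (w + q) -> False.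
Proof.
move=> s0 w0; rewrite !ler_norml => /andP[p1 p2] /andP[q1 q2] h1 h2.
have h : s ^+ 2 * ((w + p) * (w + q)) <= 0.
  have E : s ^+ 2 * ((w + p) * (w + q)) = (s * (w + p)) * (s * (w + q)) by ring.
  by rewrite E; exact: mulr_le0_ge0.
have s2 : 0 < s ^+ 2 by rewrite lt_neqAle sqr_ge0 eq_sym sqrf_eq0 s0.
have : 0 < (w + p) * (w + q).
  have [wp|wn] := ltP 0 w.
    by rewrite gtr0_norm// in p1 q1; rewrite mulr_gt0//; lra.
  by rewrite ler0_norm// in w0 p2 q2; rewrite nmulr_lgt0; lra.
by move=> /(mulr_gt0 s2); rewrite ltNge h.
Qed.

(** The whole argument in terms of numbers: [x], [y] are the first Fourier coefficients of [f] and
    [g], [n] and [m] the norms of the derivatives of what remains, [s] and [t] the pairings of [g]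
    with [f'] and of the remainders. [E1] and [E2] are the sharp relations with relative errors;
    [E5] and [E6] are crude ones, which bound [lam x] and [lam y]. *)
Lemma reduced_problem (lam x y e1 e2 e3 e4 e5 e6 t s : R[i]) (n m l2 b d : R) :
  0 <= n -> 0 <= m -> 0 <= l2 -> 0 <= b -> 0 <= d -> d <= 1 / 1000 ->
  lam * (x + e1) = l2%:C * (y + e2) ->
  normc e1 <= d * (normc x + n) -> normc e2 <= d * (normc y + m) ->
  lam * (y + e4) = - (b%:C * x) + e3 ->
  normc e3 <= d * b * (normc x + n) -> normc e4 <= d * (normc y + m) ->
  lam * x = e5 -> normc e5 <= d * (normc y + m) ->
  lam * y = e6 -> normc e6 <= d * (normc x + n) ->
  n ^+ 2 / 2 <= d * normc x * n - Re (lam * t) ->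
  m ^+ 2 / 2 <= d * normc y * m + Re (lam * conjc t) ->
  normc t <= n * m ->
  s = t - pi^-1%:C * (y * conjc x) ->
  Im (lam * s) = 0 -> Im (lam * conjc s) = 0 ->
  Re lam != 0 ->
  [/\ x = 0, y = 0, n = 0 & m = 0].
Proof.
move=> n0 m0 l0 b0 d0 d1 E1 B1 B2 E2 B3 B4 E5 B5 E6 B6 P1 P2 Bt Es S1 S2 sig.
have X0 := normc_ge0 x; have Y0 := normc_ge0 y; have L0 := normc_ge0 lam.
have p0 := @pi_gt0 R; have p2 := @pi_ge2 R; have p4 := @pi_le R.
(* The difference of the two reality conditions is [Re lam * Im s = 0], their sum
   [Im lam * Re s = 0]. *)
have si : Im s = 0.
  move: S1 S2; rewrite !cE => S1 S2; apply/eqP.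
  have := mulf_eq0 (Re lam) (Im s); rewrite (negbTE sig) /= => <-.
  by apply/eqP; lra.
have taus : Im lam * Re s = 0.
  by move: S1 S2; rewrite !cE si; lra.
have LX : normc lam * normc x <= d * (normc y + m) by rewrite -Normc.normcM E5.
have LY : normc lam * normc y <= d * (normc x + n) by rewrite -Normc.normcM E6.
have YX : normc (y * conjc x) = normc x * normc y by rewrite Normc.normcM normcJ mulrC.
have tI : pi * Im t = Im (y * conjc x).
  move: si; rewrite Es cImD cImN (cImM _%:C) /= mul0r addr0 => /eqP; rewrite subr_eq0 => /eqP ->.
  by rewrite mulrA divff ?mul1r// gt_eqF.
have {}tI : `|Im t| <= normc x * normc y / 2.
  have H := normr_Im (y * conjc x); rewrite YX -tI normrM gtr0_norm// in H.
  have := normr_ge0 (Im t); nra.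
have tauL := normr_Im lam.
have [Lbig|Lsmall] := leP (1 / 16) (normc lam).
  (* Adding the two energy estimates cancels [Re t]. Only [2 * Im lam * Im t] is left, and [Im t] is
     bounded by the product of the first coefficients because [s] is real; so [lam] appears only
     multiplied by [x] or [y], and may be arbitrarily large. *)
  have H : n ^+ 2 / 2 + m ^+ 2 / 2 <=
      d * normc x * n + d * normc y * m + 2 * (`|Im lam| * `|Im t|).
    move: P1 P2; rewrite !cE => P1 P2.
    have := ler_norm (Im lam * Im t); rewrite normrM; clear -P1 P2; lra.
  have H2 : 2 * (`|Im lam| * `|Im t|) <= normc lam * normc y * normc x.
    apply: (@le_trans _ _ (2 * (normc lam * (normc x * normc y / 2)))); last by clear; lra.
    by rewrite ler_pM2l//; apply: ler_pM.
  have [|nz mz xz yz] := @large_eigenvalue n m (normc x) (normc y) d (normc lam) n0 m0 X0 Y0 d0 d1 Lbig LX LY.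
    by apply: (le_trans H); rewrite lerD2l.
  by split=> //; exact: normc_eq0.
have Pn : n ^+ 2 / 2 <= d * normc x * n + normc lam * (n * m).
  apply: (le_trans P1); rewrite lerD2l.
  rewrite (le_trans (ler_norm _))// normrN (le_trans (normr_Re _))// Normc.normcM.
  exact: ler_wpM2l.
have Pm : m ^+ 2 / 2 <= d * normc y * m + normc lam * (n * m).
  apply: (le_trans P2); rewrite lerD2l.
  rewrite (le_trans (ler_norm _))// (le_trans (normr_Re _))// Normc.normcM normcJ.
  exact: ler_wpM2l.
have nb := small_eigenvalue n0 m0 X0 Y0 d0 d1 L0 Lsmall LY Pn Pm.
rewrite [n * m]mulrC in Pn Pm.
have mb := small_eigenvalue m0 n0 Y0 X0 d0 d1 L0 Lsmall LX Pm Pn.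
rewrite [m * n]mulrC in Pn Pm.
clear Pn Pm P1 P2 LX LY.
have nb' : n <= 3 / 1000 * normc x by apply: (le_trans nb); apply: ler_wpM2r => //; clear -d1; lra.
have mb' : m <= 3 / 1000 * normc y by apply: (le_trans mb); apply: ler_wpM2r => //; clear -d1; lra.
have dx : d * (normc x + n) <= 1 / 100 * normc x.
  have : d * (normc x + n) <= 1 / 1000 * (normc x + n) by apply: ler_wpM2r => //; rewrite addr_ge0.
  by clear -nb' X0; lra.
have dy : d * (normc y + m) <= 1 / 100 * normc y.
  have : d * (normc y + m) <= 1 / 1000 * (normc y + m) by apply: ler_wpM2r => //; rewrite addr_ge0.
  by clear -mb' Y0; lra.
have {}B1 := le_trans B1 dx; have {}B2 := le_trans B2 dy; have {}B4 := le_trans B4 dy.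
have {}B3 : normc e3 <= b * (1 / 100 * normc x).
  apply: (le_trans B3); rewrite [d * b]mulrC -[b * d * _]mulrA; exact: ler_wpM2l.
have lam0 : lam != 0 by apply: contraNneq sig => ->.
(* If [x] vanishes, so does the right-hand side of the second relation, error included; then [y]
   equals its own small relative error and vanishes too. The case [y = 0] uses the first relation in
   the same way. *)
have [xz|xn] := eqVneq x 0.
  move: nb B3 E2; rewrite xz Normc.normc0 !mulr0 => nb /normc_eq0 -> /eqP.
  rewrite oppr0 addr0 mulf_eq0 (negbTE lam0) /= addr_eq0 => /eqP yE.
  have : normc y = normc e4 by rewrite yE normcN.
  move=> yE'; have yz : normc y <= 0 by clear -B4 yE' Y0; lra.
  split=> //; [exact: normc_eq0| |]; apply/eqP; rewrite eq_le ?n0 ?m0 andbT.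
    by [].
  by rewrite (le_trans mb)// mulr_ge0_le0// mulr_ge0.
have [yz|yn] := eqVneq y 0.
  move: mb B2 E1; rewrite yz Normc.normc0 !mulr0 => mb /normc_eq0 -> /eqP.
  rewrite addr0 mulr0 mulf_eq0 (negbTE lam0) /= addr_eq0 => /eqP xE.
  have : normc x = normc e1 by rewrite xE normcN.
  move=> xE'; have xz : normc x <= 0 by clear -B1 xE' X0; lra.
  by move: xn; rewrite (normc_eq0 xz) eqxx.
have Xp : 0 < normc x.
  by rewrite lt_neqAle X0 andbT; apply: contraNneq xn => /esym/Normc.eq0_normc ->.
have Yp : 0 < normc y.
  by rewrite lt_neqAle Y0 andbT; apply: contraNneq yn => /esym/Normc.eq0_normc ->.
have XYp : 0 < normc x * normc y by rewrite mulr_gt0.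
have tb : normc t <= 1 / 100 * (normc x * normc y).
  apply: (le_trans Bt); apply: (le_trans (ler_pM n0 m0 nb' mb')).
  by clear -XYp; lra.
pose w := Re (y * conjc x).
(* The product [y * conjc x] is nearly real: its imaginary part is [pi * Im t], and [t] is at most
   [n * m]. *)
have wE : normc x * normc y <= 2 * `|w|.
  have h1 : pi * Im t = Im (y * conjc x).
    move: si; rewrite Es cImD cImN (cImM _%:C) /= mul0r addr0 => /eqP; rewrite subr_eq0 => /eqP ->.
    by rewrite mulrA divff ?mul1r// gt_eqF.
  have h2 := normc2 (y * conjc x).
  have h3 : `|Im (y * conjc x)| <= 4 / 100 * (normc x * normc y).
    rewrite -h1 normrM gtr0_norm//; apply: (le_trans (ler_pM (ltW p0) _ p4 (normr_Im t))) => //.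
    by clear -tb XYp; lra.
  have h4 : (normc x * normc y) ^+ 2 = `|w| ^+ 2 + `|Im (y * conjc x)| ^+ 2.
    by rewrite -YX !real_normK ?num_real.
  have := normr_ge0 (Im (y * conjc x)); have := normr_ge0 w.
  move: (normc x * normc y) (`|w|) (`|Im _|) h3 h4 XYp => A B C; clear => *; nra.
have wp : 0 < `|w| by clear -wE XYp; lra.
(* The main part of [Re s] is [- w / pi], so it cannot vanish; this forces [lam] to be real. *)
have sr : Re s != 0.
  apply/eqP => h.
  have : pi * Re t = w.
    move: h; rewrite Es cReD cReN (cReM _%:C) /= mul0r subr0 => /eqP; rewrite subr_eq0 => /eqP ->.
    by rewrite mulrA divff ?mul1r// gt_eqF.
  move=> h1; have : `|w| <= 4 / 100 * (normc x * normc y).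
    rewrite -h1 normrM gtr0_norm//; apply: (le_trans (ler_pM (ltW p0) _ p4 (normr_Re t))) => //.
    by clear -tb XYp; lra.
  by clear -wE XYp; lra.
have tau0 : Im lam = 0 by move/eqP: taus; rewrite mulf_eq0 (negbTE sr) orbF => /eqP.
(* For real [lam], pairing one relation with [conjc x] and the other with [conjc y] gives [lam]
   times nearly the same number [w], with right-hand sides of opposite signs. *)
have Q2 : Re lam * (w + Re (e4 * conjc x)) = - (b * normc x ^+ 2) + Re (e3 * conjc x).
  have := congr1 (fun z => Re (z * conjc x)) E2; rewrite normc2 /w !cE tau0 /= => E.
  by clear -E; lra.
have Q1 : Re lam * (w + Re (e1 * conjc y)) = l2 * normc y ^+ 2 + l2 * Re (e2 * conjc y).
  have := congr1 (fun z => Re (z * conjc y)) E1; rewrite normc2 /w !cE tau0 /= => E.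
  by clear -E; lra.
have C4 : `|Re (e4 * conjc x)| <= 2 / 100 * `|w|.
  rewrite (le_trans (normr_Re _))// Normc.normcM normcJ (le_trans (ler_wpM2r X0 B4))//.
  by clear -wE XYp; lra.
have C1 : `|Re (e1 * conjc y)| <= 2 / 100 * `|w|.
  rewrite (le_trans (normr_Re _))// Normc.normcM normcJ (le_trans (ler_wpM2r Y0 B1))//.
  by clear -wE XYp; lra.
have C3 : Re (e3 * conjc x) <= b * (1 / 100 * normc x ^+ 2).
  rewrite (le_trans (ler_norm _))// (le_trans (normr_Re _))// Normc.normcM normcJ.
  have := ler_wpM2r X0 B3; clear; lra.
have C2 : - (1 / 100 * normc y ^+ 2) <= Re (e2 * conjc y).
  have := ler_norm (- Re (e2 * conjc y)); rewrite normrN.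
  have := normr_Re (e2 * conjc y); rewrite Normc.normcM normcJ.
  have := ler_wpM2r Y0 B2; clear; lra.
have R2 : Re lam * (w + Re (e4 * conjc x)) <= 0.
  rewrite Q2; have : 0 <= b * normc x ^+ 2 by rewrite mulr_ge0// sqr_ge0.
  by clear -C3; lra.
have R1 : 0 <= Re lam * (w + Re (e1 * conjc y)).
  rewrite Q1 -mulrDr mulr_ge0//; have := sqr_ge0 (normc y); clear -C2; lra.
by case: (sign_contradiction sig wp C4 C1 R2 R1).
Qed.

End ReducedProblem.

(** * The homogeneous periodic problem *)

Section PeriodicDerivatives.
Context {R : realType}.

Lemma deriv_fun_unique (f g h : R -> R) : deriv_of f g -> deriv_of f h -> g =1 h.
Proof. by move=> Dg Dh x; have [_ <-] := Dg x; have [_ <-] := Dh x. Qed.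

Lemma per_deriv (f g : R -> R) : deriv_of f g -> per f -> per g.
Proof.
move=> D p x; apply: (deriv_fun_unique (g := fun x => g (x + 2 * pi)) (h := g) _ D).
by apply: (deriv_ext (deriv_shift (2 * pi) D)).
Qed.

Lemma cper_deriv (f g : R -> R[i]) : cderiv f g -> per f -> per g.
Proof.
move=> [D1 D2] p x; apply: complex_eq.
  by apply: (per_deriv D1) => y; rewrite p.
by apply: (per_deriv D2) => y; rewrite p.
Qed.

Notation rc p := (fun x : R => (p x)%:C).

Lemma cderiv_cos : cderiv (rc (@cos R)) (fun x => - (sin x)%:C).
Proof.
by apply: (cderiv_extr (cderivR (p' := fun x => - sin x) _)) => [x|x]; [exact: is_derive_cos|rewrite CN].
Qed.

Lemma cderiv_sin : cderiv (rc (@sin R)) (rc (@cos R)).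
Proof. by apply: cderivR => x; exact: is_derive_sin. Qed.

Lemma I_cos : I (@cos R) = 0.
Proof.
apply: (@I_deriv_per R sin) => [x||]; [exact: is_derive_sin|exact: continuous_cos|exact: per_sin].
Qed.

Lemma I_sin : I (@sin R) = 0.
Proof.
apply: (@I_deriv_per R (fun x => - cos x)) => [||x]; [by eapply deriv_extr; [repeat deriv_step|move=> z /=; ring]|exact: continuous_sin|].
by rewrite per_cos.
Qed.

Lemma I_sincos : I (fun x : R => sin x * cos x) = 0.
Proof.
apply: (@I_deriv_per R (fun x => sin x ^+ 2 / 2)) => [||x]; first by deriv; field.
  by apply: ctsM; [exact: continuous_sin|exact: continuous_cos].
by rewrite per_sin.
Qed.

Lemma I_cos2 : I (fun x : R => cos x ^+ 2) = pi.
Proof.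
rewrite (@I_deriv R (fun x => (x + sin x * cos x) / 2)).
- by rewrite -(add0r (2 * pi)) per_sin sin0; field.
- eapply deriv_extr; first by repeat deriv_step.
  move=> x /=; apply/eqP; rewrite -subr_eq0; apply/eqP.
  transitivity ((1 - (cos x ^+ 2 + sin x ^+ 2)) / 2); first by field.
  by rewrite cos2Dsin2 subrr mul0r.
- by apply: ctsX; exact: continuous_cos.
Qed.

Lemma I_sin2 : I (fun x : R => sin x ^+ 2) = pi.
Proof.
have := I_cst (1 : R); rewrite (_ : (fun=> 1) = fun x : R => cos x ^+ 2 + sin x ^+ 2).
  rewrite ID ?I_cos2; first by lra.
    by apply: ctsX; exact: continuous_cos.
  by apply: ctsX; exact: continuous_sin.
by apply/funext => x; rewrite cos2Dsin2.
Qed.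

End PeriodicDerivatives.

(** * Arithmetic of the error terms *)

Section CoreArith.
Context {R : realType}.

(** The Poincare constant 3/5 gives [N2 - n ^ 2 >= 2/3 * n ^ 2], and errors of relative size 1/20
    use up less than the gap between 2/3 and 1/2. The factor 6 is a common allowance for all the
    error bounds given to the reduced problem. *)
Lemma energy_arith (N2 NF r rl l d X n : R) :
  n ^+ 2 <= 3 / 5 * N2 -> NF <= 3 / 5 * n ^+ 2 -> - N2 + n ^+ 2 + r + rl + l * NF = 0 ->
  0 <= n -> 0 <= X -> 0 <= d -> d <= 1 / 20 -> 0 <= NF -> l <= d -> `|r| <= d * (X + n) * n ->
  n ^+ 2 / 2 <= 6 * d * X * n + rl.
Proof.
move=> h1 h2 h3 n0 X0 d0 d1 F0 ld hr.
have h4 : l * NF <= 1 / 20 * NF by apply: ler_wpM2r => //; exact: le_trans ld d1.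
have h5 := ler_norm r.
have h6 : d * (n ^+ 2) <= 1 / 20 * n ^+ 2 by apply: ler_wpM2r => //; exact: sqr_ge0.
have h7 : 0 <= d * X * n by rewrite !mulr_ge0.
have h8 := sqr_ge0 n.
clear -h1 h2 h3 h4 h5 h6 h7 h8 hr; lra.
Qed.

Lemma err_arith1 (d A : R) : 0 <= d * A -> 3 * d * A <= 6 * d * A.
Proof. by move=> ?; lra. Qed.

Lemma err_arith2 (d b A : R) : 3 * (d * b) * A + b * (3 * d * A) <= 6 * d * b * A.
Proof. by lra. Qed.

Lemma err_arith3 (d X n : R) : 0 <= d * (X + n) -> 0 <= d * n ->
  3 * d * (X + n) + d * X <= 6 * d * (X + n).
Proof. by move=> ? ?; lra. Qed.

Lemma small_arith (d : R) : d <= 1 / 6000 -> d <= 1 / 20 /\ 6 * d <= 1 / 1000.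
Proof. by move=> ?; split; lra. Qed.

End CoreArith.

(** * Testing the odd and even equations *)

Section Core.
Context {R : realType}.
Notation Re := complex.Re.
Notation Im := complex.Im.
Notation normc := (@Normc.normc R).
(** [f] and [g] stand for the odd and even parts of the mean-free [V]; their parity is expressed by
    the vanishing of the cosine coefficient of [f] and of the sine coefficient of [g]. [Th] is a
    periodic primitive of [Q], for the integration by parts against [Ze]. *)
Context (q : R -> R) (cq : continuous q) (pq : per q) (d : R) (d0 : 0 <= d)
  (qd : forall x, `|q x - 1| <= d).
Context (phi phi1 phi2 phi3 : R -> R)
  (Dphi : deriv_of phi phi1) (Dphi1 : deriv_of phi1 phi2) (Dphi2 : deriv_of phi2 phi3)
  (pphi : per phi) (cphi3 : continuous phi3)
  (Ephi : forall x, phi3 x + q x * phi1 x = 0)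
  (phid : forall x, `|phi x - cos x| <= d).
Context (Q Q1 Q2 Th : R -> R) (DTh : deriv_of Th Q) (DQ : deriv_of Q Q1) (DQ1 : deriv_of Q1 Q2)
  (cQ2 : continuous Q2) (pTh : per Th) (l2 b c0 : R) (l20 : 0 <= l2) (l2b : l2 <= b) (l2d : l2 <= d)
  (Qd : forall x, `|Q x - cos x| <= d) (Thd : forall x, `|Th x - sin x| <= d)
  (QE : forall x, `|Q2 x + q x * Q x - c0 - (b - l2) * cos x| <= d * b).
Context (lam : R[i]) (f f1 f2 f3 g g1 g2 g3 Ze Zo : R -> R[i])
  (Df : cderiv f f1) (Df1 : cderiv f1 f2) (Df2 : cderiv f2 f3) (cf3 : ccts f3) (pf : per f)
  (Dg : cderiv g g1) (Dg1 : cderiv g1 g2) (Dg2 : cderiv g2 g3) (cg3 : ccts g3) (pg : per g)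
  (DZe : cderiv Ze (fun x => l2%:C * f x)) (DZo : cderiv Zo (fun x => l2%:C * g x))
  (pZe : per Ze) (pZo : per Zo)
  (EA : forall x, f3 x + (q x)%:C * f1 x - lam * g x - Ze x = 0)
  (EB : forall x, g3 x + (q x)%:C * g1 x - lam * f x - Zo x = 0)
  (If : cI f = 0) (Ig : cI g = 0)
  (Ifc : cI (fun x => f x * (cos x)%:C) = 0) (Igs : cI (fun x => g x * (sin x)%:C) = 0).

Notation rc p := (fun x : R => (p x)%:C).

Let pf1 : per f1. Proof. exact: cper_deriv Df pf. Qed.
Let pf2 : per f2. Proof. exact: cper_deriv Df1 pf1. Qed.
Let pg1 : per g1. Proof. exact: cper_deriv Dg pg. Qed.
Let pg2 : per g2. Proof. exact: cper_deriv Dg1 pg1. Qed.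
Let cf : ccts f. Proof. exact: cderiv_ccts Df. Qed.
Let cf1 : ccts f1. Proof. exact: cderiv_ccts Df1. Qed.
Let cf2 : ccts f2. Proof. exact: cderiv_ccts Df2. Qed.
Let cg : ccts g. Proof. exact: cderiv_ccts Dg. Qed.
Let cg1 : ccts g1. Proof. exact: cderiv_ccts Dg1. Qed.
Let cg2 : ccts g2. Proof. exact: cderiv_ccts Dg2. Qed.
Let ccos : ccts (rc (@cos R)). Proof. exact: cderiv_ccts cderiv_cos. Qed.
Let csin : ccts (rc (@sin R)). Proof. exact: cderiv_ccts cderiv_sin. Qed.
Let crcos : continuous (@cos R). Proof. exact: continuous_cos. Qed.
Let crsin : continuous (@sin R). Proof. exact: continuous_sin. Qed.
Let cqc : ccts (rc q). Proof. exact: cctsR. Qed.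
Let cZe : ccts Ze. Proof. exact: cderiv_ccts DZe. Qed.
Let cZo : ccts Zo. Proof. exact: cderiv_ccts DZo. Qed.
Let pccos : per (rc (@cos R)). Proof. by move=> x; rewrite per_cos. Qed.
Let pcsin : per (rc (@sin R)). Proof. by move=> x; rewrite per_sin. Qed.

(** Integrating by parts, [x0] is the sine coefficient of [f] and [y0] is minus the cosine
    coefficient of [g]. *)
Let x0 : R[i] := cI (fun x => f1 x * (cos x)%:C).
Let y0 : R[i] := cI (fun x => g1 x * (sin x)%:C).

Let x0f : cI (fun x => f x * (sin x)%:C) = x0.
Proof.
have := cI_parts Df cderiv_cos cf1 ltac:(ccts) pf pccos; rewrite -/x0 => ->.
rewrite (_ : (fun x => f x * - (sin x)%:C) = fun x => - (f x * (sin x)%:C)).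
  by rewrite cIN ?opprK//; ccts.
by apply/funext => x; rewrite mulrN.
Qed.

Let y0g : cI (fun x => g x * (cos x)%:C) = - y0.
Proof.
have := cI_parts Dg cderiv_sin cg1 ltac:(ccts) pg pcsin; rewrite -/y0 => ->.
by rewrite opprK.
Qed.

(** The first mode is removed, with the factor [1 / pi] because [sin ^ 2] and [cos ^ 2] have
    integral [pi]. Thus [F], [G] and their first derivatives are orthogonal to 1, cosine and sine,
    as the Poincare inequality requires. *)
Let F x := f x - (pi^-1)%:C * x0 * (sin x)%:C.
Let F1 x := f1 x - (pi^-1)%:C * x0 * (cos x)%:C.
Let F2 x := f2 x + (pi^-1)%:C * x0 * (sin x)%:C.
Let G x := g x + (pi^-1)%:C * y0 * (cos x)%:C.
Let G1 x := g1 x - (pi^-1)%:C * y0 * (sin x)%:C.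
Let G2 x := g2 x - (pi^-1)%:C * y0 * (cos x)%:C.

Let DF : cderiv F F1.
Proof. exact: (cderivB Df (cderivZ _ cderiv_sin)). Qed.
Let DF1 : cderiv F1 F2.
Proof. by apply: (cderiv_extr (cderivB Df1 (cderivZ _ cderiv_cos))) => x; rewrite mulrN opprK. Qed.
Let DG : cderiv G G1.
Proof. by apply: (cderiv_extr (cderivD Dg (cderivZ _ cderiv_cos))) => x; rewrite mulrN. Qed.
Let DG1 : cderiv G1 G2.
Proof. exact: (cderivB Dg1 (cderivZ _ cderiv_sin)). Qed.
Let cF2 : ccts F2. Proof. by rewrite /F2; ccts. Qed.
Let cG2 : ccts G2. Proof. by rewrite /G2; ccts. Qed.
Let cF : ccts F. Proof. exact: cderiv_ccts DF. Qed.
Let cF1 : ccts F1. Proof. exact: cderiv_ccts DF1. Qed.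
Let cG : ccts G. Proof. exact: cderiv_ccts DG. Qed.
Let cG1 : ccts G1. Proof. exact: cderiv_ccts DG1. Qed.
Let pF : per F. Proof. by move=> x; rewrite /F pf per_sin. Qed.
Let pG : per G. Proof. by move=> x; rewrite /G pg per_cos. Qed.
Let pF1 : per F1. Proof. exact: cper_deriv DF pF. Qed.
Let pG1 : per G1. Proof. exact: cper_deriv DG pG. Qed.
Let pF2 : per F2. Proof. exact: cper_deriv DF1 pF1. Qed.
Let pG2 : per G2. Proof. exact: cper_deriv DG1 pG1. Qed.

Let cIcos : cI (rc (@cos R)) = 0. Proof. by rewrite cIR I_cos. Qed.
Let cIsin : cI (rc (@sin R)) = 0. Proof. by rewrite cIR I_sin. Qed.
Let cIcc : cI (fun x => (cos x)%:C * (cos x)%:C) = (pi : R)%:C.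
Proof. by rewrite -I_cos2 -cIR; congr cI; apply/funext => x; rewrite -CM -expr2. Qed.
Let cIss : cI (fun x => (sin x)%:C * (sin x)%:C) = (pi : R)%:C.
Proof. by rewrite -I_sin2 -cIR; congr cI; apply/funext => x; rewrite -CM -expr2. Qed.
Let cIsc : cI (fun x : R => (sin x)%:C * (cos x)%:C) = 0.
Proof. by rewrite -[RHS](congr1 (fun z => z%:C) I_sincos) -cIR; congr cI; apply/funext => x; rewrite -CM. Qed.
Let cIcs : cI (fun x : R => (cos x)%:C * (sin x)%:C) = 0.
Proof. by rewrite -[RHS]cIsc; congr cI; apply/funext => x; rewrite mulrC. Qed.
Let piV : (pi^-1)%:C * (pi : R)%:C = 1.
Proof. by rewrite -CM mulVf// gt_eqF// pi_gt0. Qed.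

Let IF : cI F = 0.
Proof. by rewrite /F cIB ?cIZ ?cIsin ?If ?mulr0 ?subrr//; ccts. Qed.
Let IG : cI G = 0.
Proof. by rewrite /G cID ?cIZ ?cIcos ?Ig ?mulr0 ?addr0//; ccts. Qed.

Let splitM (u : R -> R[i]) (z : R[i]) (p r : R -> R) : ccts u -> continuous p -> continuous r ->
  cI (fun x => (u x - z * (p x)%:C) * (r x)%:C) =
  cI (fun x => u x * (r x)%:C) - z * cI (fun x => (p x)%:C * (r x)%:C).
Proof.
move=> cu cp cr; rewrite -cIZ; last by ccts.
rewrite -cIB; try by ccts.
by congr cI; apply/funext => x; ring.
Qed.

Let GE x : G x = g x - (- ((pi^-1)%:C * y0)) * (cos x)%:C.
Proof. by rewrite /G mulNr opprK. Qed.

Let IFs : cI (fun x => F x * (sin x)%:C) = 0.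
Proof. by rewrite /F splitM// x0f cIss mulrAC piV mul1r subrr. Qed.
Let IFc : cI (fun x => F x * (cos x)%:C) = 0.
Proof. by rewrite /F splitM// Ifc cIsc mulr0 subrr. Qed.
Let IF1c : cI (fun x => F1 x * (cos x)%:C) = 0.
Proof. by rewrite /F1 splitM// cIcc mulrAC piV mul1r subrr. Qed.
Let IGc : cI (fun x => G x * (cos x)%:C) = 0.
Proof.
rewrite (_ : (fun x => _) = fun x => (g x - (- ((pi^-1)%:C * y0)) * (cos x)%:C) * (cos x)%:C).
  by rewrite splitM// y0g cIcc mulNr mulrAC piV mul1r subrr.
by apply/funext => x; rewrite GE.
Qed.
Let IGs : cI (fun x => G x * (sin x)%:C) = 0.
Proof.
rewrite (_ : (fun x => _) = fun x => (g x - (- ((pi^-1)%:C * y0)) * (cos x)%:C) * (sin x)%:C).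
  by rewrite splitM// Igs cIcs mulr0 subrr.
by apply/funext => x; rewrite GE.
Qed.
Let IG1s : cI (fun x => G1 x * (sin x)%:C) = 0.
Proof. by rewrite /G1 splitM// cIss mulrAC piV mul1r subrr. Qed.

Let byparts0 (u u1 : R -> R[i]) : cderiv u u1 -> ccts u1 -> per u -> cI u1 = 0.
Proof. exact: cI_deriv_per. Qed.

Let IF1s : cI (fun x => F1 x * (sin x)%:C) = 0.
Proof. by rewrite (cI_parts DF cderiv_sin)// ?IFc ?oppr0. Qed.
Let IG1c : cI (fun x => G1 x * (cos x)%:C) = 0.
Proof.
rewrite (cI_parts DG cderiv_cos)//; last by ccts.
rewrite (_ : (fun x => _) = fun x => - (G x * (sin x)%:C)) ?cIN ?IGs ?oppr0//; first by ccts.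
by apply/funext => x; rewrite mulrN.
Qed.

Let n := nrm F1.
Let m := nrm G1.

Let PF : nrm2 F <= 3 / 5 * nrm2 F1. Proof. exact: (cpoincare DF cF1 pF pF1 IF IFc IFs). Qed.
Let PF1 : nrm2 F1 <= 3 / 5 * nrm2 F2.
Proof. exact: (cpoincare DF1 cF2 pF1 pF2 (cI_deriv_per DF cF1 pF) IF1c IF1s). Qed.
Let PG : nrm2 G <= 3 / 5 * nrm2 G1. Proof. exact: (cpoincare DG cG1 pG pG1 IG IGc IGs). Qed.
Let PG1 : nrm2 G1 <= 3 / 5 * nrm2 G2.
Proof. exact: (cpoincare DG1 cG2 pG1 pG2 (cI_deriv_per DG cG1 pG) IG1c IG1s). Qed.

Let nF : nrm F <= n.
Proof. by apply: ler_wsqrtr; apply: (le_trans PF); have := nrm2_ge0 cF1; lra. Qed.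
Let nG : nrm G <= m.
Proof. by apply: ler_wsqrtr; apply: (le_trans PG); have := nrm2_ge0 cG1; lra. Qed.

Let sqrtpi_le : Num.sqrt (pi : R) <= pi.
Proof.
have p2 := @pi_ge2 R.
rewrite -(@ler_pXn2r _ 2)// ?nnegrE ?sqrtr_ge0 ?pi_ge0// sqr_sqrtr ?pi_ge0//.
by rewrite expr2 ler_peMl ?pi_ge0//; lra.
Qed.

Let nrm_trig (p : R -> R) z : continuous p -> I (fun x => p x ^+ 2) = pi ->
  nrm (fun x => (pi^-1)%:C * z * (p x)%:C) <= normc z.
Proof.
move=> cp E; rewrite nrmZ; last by ccts.
have -> : nrm (rc p) = Num.sqrt pi.
  by rewrite /nrm /nrm2 -E; congr (Num.sqrt (I _)); apply/funext => x /=; rewrite expr0n addr0.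
have p0 := @pi_gt0 R.
rewrite Normc.normcM normcR gtr0_norm ?invr_gt0// mulrAC.
by apply: ler_piMl; rewrite ?normc_ge0// mulrC ler_pdivrMr// mul1r.
Qed.

Let nf1 : nrm f1 <= normc x0 + n.
Proof.
have -> : f1 = (fun x => (pi^-1)%:C * x0 * (cos x)%:C + F1 x).
  by apply/funext => x; rewrite /F1 addrC subrK.
by apply: (le_trans (nrmD _ _)); rewrite ?lerD2r; [ccts|ccts|exact: nrm_trig I_cos2].
Qed.
Let nf : nrm f <= normc x0 + n.
Proof.
have -> : f = (fun x => (pi^-1)%:C * x0 * (sin x)%:C + F x).
  by apply/funext => x; rewrite /F addrC subrK.
by apply: (le_trans (nrmD _ _)); [ccts|ccts|apply: lerD => //; exact: nrm_trig I_sin2].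
Qed.
Let ng1 : nrm g1 <= normc y0 + m.
Proof.
have -> : g1 = (fun x => (pi^-1)%:C * y0 * (sin x)%:C + G1 x).
  by apply/funext => x; rewrite /G1 addrC subrK.
by apply: (le_trans (nrmD _ _)); rewrite ?lerD2r; [ccts|ccts|exact: nrm_trig I_sin2].
Qed.
Let ng : nrm g <= normc y0 + m.
Proof.
have -> : g = (fun x => (pi^-1)%:C * (- y0) * (cos x)%:C + G x).
  by apply/funext => x; rewrite /G; ring.
apply: (le_trans (nrmD _ _)); [ccts|ccts|apply: lerD => //].
by rewrite -[normc y0]normcN; exact: nrm_trig I_cos2.
Qed.

(** Cauchy-Schwarz, where the constant function [e] has norm at most [3 * e] because
    [2 * pi <= 9]. *)
Let err (u : R -> R[i]) (r : R -> R) e M : ccts u -> continuous r -> (forall x, `|r x| <= e) ->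
  nrm u <= M -> normc (cI (fun x => u x * (r x)%:C)) <= 3 * e * M.
Proof.
move=> cu cr re uM; have p4 := @pi_le R; have p0 := @pi_gt0 R.
have e0 : 0 <= e by exact: le_trans (normr_ge0 _) (re 0).
apply: (le_trans (cauchy_schwarz cu (cctsR cr))).
have h : nrm (rc r) <= 3 * e.
  apply: (@le_trans _ _ (nrm (fun=> e%:C))).
    by apply: ler_nrm => [||x]; [exact: cctsR|exact: ccts_cst|rewrite !normcR (ger0_norm e0)].
  rewrite nrm_cst normcR ger0_norm// mulrC ler_wpM2r//.
  by rewrite -(@ler_pXn2r _ 2)// ?nnegrE ?sqrtr_ge0// sqr_sqrtr; lra.
by rewrite mulrC ler_pM// nrm_ge0.
Qed.

Let expandA (T : R -> R[i]) : ccts T ->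
  cI (fun x => f3 x * T x) + cI (fun x => (q x)%:C * f1 x * T x)
    - lam * cI (fun x => g x * T x) - cI (fun x => Ze x * T x) = 0.
Proof.
move=> cT.
have c1 : ccts (fun x => f3 x * T x) by ccts.
have c2 : ccts (fun x => (q x)%:C * f1 x * T x) by ccts.
have c3 : ccts (fun x => g x * T x) by ccts.
have c4 : ccts (fun x => Ze x * T x) by ccts.
have c5 := cctsM (ccts_cst lam) c3.
rewrite -(cIZ lam c3) -(cID c1 c2) -(cIB (cctsD c1 c2) c5) -(cIB (cctsB (cctsD c1 c2) c5) c4).
rewrite -[RHS](cI0 (R := R)); congr cI; apply/funext => x.
by rewrite -[RHS](mul0r (T x)) -(EA x); ring.
Qed.

Let expandB (T : R -> R[i]) : ccts T ->
  cI (fun x => g3 x * T x) + cI (fun x => (q x)%:C * g1 x * T x)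
    - lam * cI (fun x => f x * T x) - cI (fun x => Zo x * T x) = 0.
Proof.
move=> cT.
have c1 : ccts (fun x => g3 x * T x) by ccts.
have c2 : ccts (fun x => (q x)%:C * g1 x * T x) by ccts.
have c3 : ccts (fun x => f x * T x) by ccts.
have c4 : ccts (fun x => Zo x * T x) by ccts.
have c5 := cctsM (ccts_cst lam) c3.
rewrite -(cIZ lam c3) -(cID c1 c2) -(cIB (cctsD c1 c2) c5) -(cIB (cctsB (cctsD c1 c2) c5) c4).
rewrite -[RHS](cI0 (R := R)); congr cI; apply/funext => x.
by rewrite -[RHS](mul0r (T x)) -(EB x); ring.
Qed.

Let parts2 (u1 u2 u3 T T1 T2 : R -> R[i]) : cderiv u1 u2 -> cderiv u2 u3 -> ccts u3 ->
  per u1 -> per u2 -> cderiv T T1 -> cderiv T1 T2 -> ccts T2 -> per T -> per T1 ->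
  cI (fun x => u3 x * T x) = cI (fun x => u1 x * T2 x).
Proof.
move=> Du1 Du2 cu3 pu1 pu2 DT DT1 cT2 pT pT1.
have cu2 := cderiv_ccts Du2; have cT1 := cderiv_ccts DT1.
by rewrite (cI_parts Du2 DT)// (cI_parts Du1 DT1) ?opprK.
Qed.

Let addq (u T : R -> R[i]) : ccts u -> ccts T ->
  cI (fun x => (q x)%:C * u x * T x) = cI (fun x => u x * T x) + cI (fun x => u x * (q x - 1)%:C * T x).
Proof.
move=> cu cT; have cq1 : continuous (fun x => q x - 1) by cts.
rewrite -cID; try by ccts.
by congr cI; apply/funext => x; rewrite CB; ring.
Qed.

Let cphi : continuous phi. Proof. exact: deriv_continuous Dphi. Qed.
Let cphi1 : continuous phi1. Proof. exact: deriv_continuous Dphi1. Qed.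
Let pphi1 : per phi1. Proof. exact: per_deriv Dphi pphi. Qed.
Let pphi2 : per phi2. Proof. exact: per_deriv Dphi1 pphi1. Qed.
Let cQ : continuous Q. Proof. exact: deriv_continuous DQ. Qed.
Let cTh : continuous Th. Proof. exact: deriv_continuous DTh. Qed.
Let pQ : per Q. Proof. exact: per_deriv DTh pTh. Qed.
Let pQ1 : per Q1. Proof. exact: per_deriv DQ pQ. Qed.

Let perR (p : R -> R) : per p -> per (rc p).
Proof. by move=> pp x; rewrite pp. Qed.

Let cIsplit (u : R -> R[i]) (p r : R -> R) : ccts u -> continuous p -> continuous r ->
  cI (fun x => u x * (p x)%:C) = cI (fun x => u x * (r x)%:C) + cI (fun x => u x * (p x - r x)%:C).
Proof.
move=> cu cp cr; have cpr : continuous (fun x => p x - r x) by cts.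
rewrite -cID; try by ccts.
by congr cI; apply/funext => x; rewrite CB; ring.
Qed.

Let e1 := cI (fun x => f1 x * (phi x - cos x)%:C).
Let e2 := - cI (fun x => g x * (phi x - cos x)%:C).

(** Tested with [phi'], the third-order part of the odd equation disappears exactly, since
    [phi''' + q phi' = 0]. What is left carries either [lam] or [l2], so no term of size [a ^ 2] can
    spoil the relation. *)
Let H1 : lam * (x0 + e1) = l2%:C * (y0 + e2).
Proof.
have := expandB (cctsR cphi1).
have Dp := cderivR Dphi; have Dp1 := cderivR Dphi1; have Dp2 := cderivR Dphi2.
rewrite (parts2 Dg1 Dg2 cg3 pg1 pg2 Dp1 Dp2 (cctsR cphi3) (perR pphi1) (perR pphi2)).
rewrite (_ : cI _ + cI _ = 0); last first.
  rewrite -cID; [|by ccts|by ccts].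
  rewrite -[RHS](cI0 (R := R)); congr cI; apply/funext => x.
  transitivity (g1 x * (phi3 x + q x * phi1 x)%:C); first by rewrite CD CM; ring.
  by rewrite Ephi mulr0.
rewrite sub0r.
have -> : cI (fun x => f x * (phi1 x)%:C) = - cI (fun x => f1 x * (phi x)%:C).
  by rewrite (cI_parts Df Dp) ?opprK//; [exact: cctsR|exact: perR].
have -> : cI (fun x => Zo x * (phi1 x)%:C) = - (l2%:C * cI (fun x => g x * (phi x)%:C)).
  have := cI_parts DZo Dp ltac:(ccts) (cctsR cphi1) pZo (perR pphi).
  move=> /(congr1 -%R); rewrite opprK => <-; congr (- _).
  rewrite -cIZ; last by ccts.
  by congr cI; apply/funext => x; rewrite mulrA.
rewrite (cIsplit cf1 cphi crcos) -/x0 -/e1 (cIsplit cg cphi crcos) y0g.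
rewrite /e2 => /eqP; rewrite mulrN !opprK addr_eq0 => /eqP ->.
by ring.
Qed.

Let e4 := - cI (fun x => g x * (Q x - cos x)%:C).
Let rem x := Q2 x + q x * Q x - c0 - (b - l2) * cos x.
Let e3 := - (cI (fun x => f1 x * (rem x)%:C) + l2%:C * cI (fun x => f x * (Th x - sin x)%:C)).

(** Tested with [Q], the third-order part of the even equation becomes the integral of
    [f' (Q'' + q Q)]: the constant [c0] drops out as [f'] has mean zero, the cosine contributes
    [(b - l2) x0], and [Ze] adds the missing [l2 x0]. *)
Let H2 : lam * (y0 + e4) = - (b%:C * x0) + e3.
Proof.
have := expandA (cctsR cQ).
have DQc := cderivR DQ; have DQ1c := cderivR DQ1; have DThc := cderivR DTh.
rewrite (parts2 Df1 Df2 cf3 pf1 pf2 DQc DQ1c (cctsR cQ2) (perR pQ) (perR pQ1)).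
have crem : continuous rem by rewrite /rem; cts.
have -> : cI (fun x => f1 x * (Q2 x)%:C) + cI (fun x => (q x)%:C * f1 x * (Q x)%:C) =
    (b - l2)%:C * x0 + cI (fun x => f1 x * (rem x)%:C).
  have -> : (b - l2)%:C * x0 + cI (fun x => f1 x * (rem x)%:C) =
     c0%:C * cI f1 + (b - l2)%:C * x0 + cI (fun x => f1 x * (rem x)%:C).
    by rewrite (cI_deriv_per Df cf1 pf) mulr0 add0r.
  have cc0 := ccts_cst c0%:C; have cb := ccts_cst (b - l2)%:C.
  have cfc : ccts (fun x => f1 x * (cos x)%:C) by ccts.
  have cfr : ccts (fun x => f1 x * (rem x)%:C) by ccts.
  have cq1 : ccts (fun x => f1 x * (Q2 x)%:C) by ccts.
  have cq2 : ccts (fun x => (q x)%:C * f1 x * (Q x)%:C) by ccts.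
  rewrite /x0 -(cIZ _ cf1) -(cIZ _ cfc) -(cID cq1 cq2) -(cID (cctsM cc0 cf1) (cctsM cb cfc)).
  rewrite -(cID (cctsD (cctsM cc0 cf1) (cctsM cb cfc)) cfr).
  by congr cI; apply/funext => x; rewrite /rem !CB CD !CM CB; ring.
have -> : cI (fun x => Ze x * (Q x)%:C) = - (l2%:C * cI (fun x => f x * (Th x)%:C)).
  have := cI_parts DZe DThc ltac:(ccts) (cctsR cQ) pZe (perR pTh).
  move=> /(congr1 -%R); rewrite opprK => <-; congr (- _).
  rewrite -cIZ; last by ccts.
  by congr cI; apply/funext => x; rewrite mulrA.
rewrite (cIsplit cg cQ crcos) y0g (cIsplit cf cTh crsin) x0f CB.
rewrite /e3 /e4 => H; apply/eqP; rewrite -subr_eq0 -H; apply/eqP; ring.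
Qed.

Let e6 := - (cI (fun x => f1 x * ((q x - 1) * cos x)%:C) + l2%:C * x0).

(** Testing with the unperturbed kernel function loses the factor [b] in the error, but shows that
    [lam * y0] is small. [H5] is the analogue for [x0]. *)
Let H6 : lam * y0 = e6.
Proof.
have := expandA ccos.
rewrite (@parts2 f1 f2 f3 _ _ (fun x => - (cos x)%:C) Df1 Df2 cf3 pf1 pf2 cderiv_cos)//; last first.
- by move=> x; rewrite per_sin.
- by ccts.
- by apply: cderivN; exact: cderiv_sin.
have -> : cI (fun x => Ze x * (cos x)%:C) = - (l2%:C * cI (fun x => f x * (sin x)%:C)).
  have := cI_parts DZe cderiv_sin ltac:(ccts) ccos pZe pcsin.
  move=> /(congr1 -%R); rewrite opprK => <-; congr (- _).
  rewrite -cIZ; last by ccts.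
  by congr cI; apply/funext => x; rewrite mulrA.
rewrite addq// -/x0 x0f y0g.
rewrite (_ : cI (fun x => f1 x * - (cos x)%:C) = - x0); last first.
  rewrite -cIN; last by ccts.
  by congr cI; apply/funext => x; rewrite mulrN.
rewrite (_ : cI (fun x => f1 x * (q x - 1)%:C * (cos x)%:C) = cI (fun x => f1 x * ((q x - 1) * cos x)%:C)); last first.
  by congr cI; apply/funext => x; rewrite CM mulrA.
move=> H; apply/eqP; rewrite -subr_eq0 -H /e6; apply/eqP; ring.
Qed.

Let e5 := cI (fun x => g1 x * ((q x - 1) * sin x)%:C) + l2%:C * y0.

Let H5 : lam * x0 = e5.
Proof.
have := expandB csin.
rewrite (@parts2 g1 g2 g3 _ _ (fun x => - (sin x)%:C) Dg1 Dg2 cg3 pg1 pg2 cderiv_sin cderiv_cos)//; last by ccts.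
have -> : cI (fun x => Zo x * (sin x)%:C) = l2%:C * cI (fun x => g x * (cos x)%:C).
  have := cI_parts DZo cderiv_cos ltac:(ccts) ltac:(ccts) pZo pccos.
  rewrite -cIN; last by ccts.
  rewrite (_ : (fun x => - (Zo x * - (sin x)%:C)) = fun x => Zo x * (sin x)%:C).
    move=> <-; rewrite -cIZ; last by ccts.
    by congr cI; apply/funext => x; rewrite mulrA.
  by apply/funext => x; rewrite mulrN opprK.
rewrite addq// -/y0 x0f y0g.
rewrite (_ : cI (fun x => g1 x * - (sin x)%:C) = - y0); last first.
  rewrite -cIN; last by ccts.
  by congr cI; apply/funext => x; rewrite mulrN.
rewrite (_ : cI (fun x => g1 x * (q x - 1)%:C * (sin x)%:C) = cI (fun x => g1 x * ((q x - 1) * sin x)%:C)); last first.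
  by congr cI; apply/funext => x; rewrite CM mulrA.
move=> H; apply/eqP; rewrite eq_sym -subr_eq0 -H /e5; apply/eqP; ring.
Qed.

(** The pairing of [g] with [f'] appears twice: without first modes in the energy identities, and
    with them, as [s], in the reality conditions. [Es] gives the difference. *)
Let t := cI (fun x => G x * conjc (F1 x)).
Let s := cI (fun x => g x * conjc (f1 x)).

Let splitJ (U v : R -> R[i]) z (p : R -> R) : ccts U -> ccts v -> continuous p ->
  cI (fun x => (U x + z * (p x)%:C) * conjc (v x)) =
  cI (fun x => U x * conjc (v x)) + z * conjc (cI (fun x => v x * (p x)%:C)).
Proof.
move=> cU cv cp; rewrite -cIJ; last by ccts.
rewrite -cIZ -?cID; try by ccts.
by congr cI; apply/funext => x; rewrite cJM conjc_real; ring.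
Qed.

Let cIJsym (u v : R -> R[i]) : ccts u -> ccts v ->
  cI (fun x => u x * conjc (v x)) = conjc (cI (fun x => v x * conjc (u x))).
Proof.
move=> cu cv; rewrite -cIJ; last by ccts.
by congr cI; apply/funext => x; rewrite cJM conjcK mulrC.
Qed.

Let partsJ (u u1 v v1 : R -> R[i]) : cderiv u u1 -> cderiv v v1 -> ccts u1 -> ccts v1 ->
  per u -> per v ->
  cI (fun x => u1 x * conjc (v x)) = - cI (fun x => u x * conjc (v1 x)).
Proof.
move=> Du Dv cu1 cv1 pu pv; apply: (cI_parts Du (cderivJ Dv)) => //; first exact: cctsJ.
by move=> x; rewrite pv.
Qed.

Let fE : f = (fun x => F x + (pi^-1)%:C * x0 * (sin x)%:C).
Proof. by apply/funext => x; rewrite /F subrK. Qed.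
Let f1E : f1 = (fun x => F1 x + (pi^-1)%:C * x0 * (cos x)%:C).
Proof. by apply/funext => x; rewrite /F1 subrK. Qed.
Let f2E : f2 = (fun x => F2 x + - ((pi^-1)%:C * x0) * (sin x)%:C).
Proof. by apply/funext => x; rewrite /F2 mulNr addrK. Qed.
Let gE : g = (fun x => G x + - ((pi^-1)%:C * y0) * (cos x)%:C).
Proof. by apply/funext => x; rewrite /G mulNr addrK. Qed.
Let g1E : g1 = (fun x => G1 x + (pi^-1)%:C * y0 * (sin x)%:C).
Proof. by apply/funext => x; rewrite /G1 subrK. Qed.
Let g2E : g2 = (fun x => G2 x + (pi^-1)%:C * y0 * (cos x)%:C).
Proof. by apply/funext => x; rewrite /G2 subrK. Qed.

Let IF2s : cI (fun x => F2 x * (sin x)%:C) = 0.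
Proof. by rewrite (cI_parts DF1 cderiv_sin)// IF1c oppr0. Qed.
Let IG2c : cI (fun x => G2 x * (cos x)%:C) = 0.
Proof.
rewrite (cI_parts DG1 cderiv_cos)//; last by ccts.
rewrite (_ : (fun x => _) = fun x => - (G1 x * (sin x)%:C)) ?cIN ?IG1s ?oppr0//; first by ccts.
by apply/funext => x; rewrite mulrN.
Qed.

Let rho := cI (fun x => f1 x * (q x - 1)%:C * conjc (F1 x)).
Let rho' := cI (fun x => g1 x * (q x - 1)%:C * conjc (G1 x)).

Let errq (u v : R -> R[i]) M : ccts u -> ccts v -> nrm u <= M ->
  normc (cI (fun x => u x * (q x - 1)%:C * conjc (v x))) <= d * M * nrm v.
Proof.
move=> cu cv uM; have cq1 : continuous (fun x => q x - 1) by cts.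
apply: (le_trans (cauchy_schwarz _ _)); [by ccts|by ccts|rewrite nrmJ].
apply: ler_wpM2r; first exact: nrm_ge0.
apply: (@le_trans _ _ (nrm (fun x => d%:C * u x))).
  apply: ler_nrm => [||x]; [by ccts|by ccts|].
  rewrite !Normc.normcM !normcR (ger0_norm d0) mulrC.
  by apply: ler_wpM2r; rewrite ?normc_ge0.
by rewrite nrmZ// normcR ger0_norm// ler_wpM2l.
Qed.

(** Energy identity from the even equation paired with the conjugate of [F1]. Orthogonality replaces
    [f], [f1], [f2] and [g] by their remainders, except in [rho], which has the small factor
    [q - 1]. *)
Let E3 : - (nrm2 F2)%:C + (nrm2 F1)%:C + rho - lam * t + (l2 * nrm2 F)%:C = 0.
Proof.
have := expandA (cctsJ cF1).
rewrite (partsJ Df2 DF1 cf3 cF2 pf2 pF1) f2E splitJ// IF2s conjc0 mulr0 addr0 cI_mulJ.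
rewrite addq; [|by []|by ccts].
have -> : cI (fun x => f1 x * conjc (F1 x)) = (nrm2 F1)%:C.
  by rewrite {1}f1E splitJ// IF1c conjc0 mulr0 addr0 cI_mulJ.
have -> : cI (fun x => g x * conjc (F1 x)) = t.
  by rewrite gE splitJ// IF1c conjc0 mulr0 addr0.
have -> : cI (fun x => Ze x * conjc (F1 x)) = - (l2 * nrm2 F)%:C.
  have := partsJ DZe DF ltac:(ccts) cF1 pZe pF.
  move=> /(congr1 -%R); rewrite opprK => <-; congr (- _).
  rewrite CM -cI_mulJ -[cI _ in RHS]addr0.
  have h : cI (fun x => f x * conjc (F x)) = cI (fun x => F x * conjc (F x)).
    by rewrite {1}fE splitJ// IFs conjc0 mulr0 addr0.
  rewrite addr0 -h -cIZ; last by ccts.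
  by congr cI; apply/funext => x; rewrite mulrA.
by rewrite -/rho => <-; ring.
Qed.

Let E3' : - (nrm2 G2)%:C + (nrm2 G1)%:C + rho' + lam * conjc t + (l2 * nrm2 G)%:C = 0.
Proof.
have := expandB (cctsJ cG1).
rewrite (partsJ Dg2 DG1 cg3 cG2 pg2 pG1) g2E splitJ// IG2c conjc0 mulr0 addr0 cI_mulJ.
rewrite addq; [|by []|by ccts].
have -> : cI (fun x => g1 x * conjc (G1 x)) = (nrm2 G1)%:C.
  by rewrite {1}g1E splitJ// IG1s conjc0 mulr0 addr0 cI_mulJ.
have -> : cI (fun x => f x * conjc (G1 x)) = - conjc t.
  rewrite fE splitJ// IG1s conjc0 mulr0 addr0.
  have := partsJ DF DG cF1 cG1 pF pG; move=> /(congr1 -%R); rewrite opprK => <-.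
  by congr (- _); exact: cIJsym.
have -> : cI (fun x => Zo x * conjc (G1 x)) = - (l2 * nrm2 G)%:C.
  have := partsJ DZo DG ltac:(ccts) cG1 pZo pG.
  move=> /(congr1 -%R); rewrite opprK => <-; congr (- _).
  rewrite CM -cI_mulJ.
  have h : cI (fun x => g x * conjc (G x)) = cI (fun x => G x * conjc (G x)).
    by rewrite {1}gE splitJ// IGc conjc0 mulr0 addr0.
  rewrite -h -cIZ; last by ccts.
  by congr cI; apply/funext => x; rewrite mulrA.
by rewrite -/rho' => <-; ring.
Qed.

Let qreal (u : R -> R[i]) : cI (fun x => (q x)%:C * u x * conjc (u x)) =
  (I (fun x => q x * normc (u x) ^+ 2))%:C.
Proof. by rewrite -cIR; congr cI; apply/funext => x; rewrite -mulrA mulcJ -CM. Qed.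

(** In the pairing with the conjugate of [f1] every term other than [lam * s] is real: norms, and an
    integral with the real weight [q]. *)
Let H7 : Im (lam * s) = 0.
Proof.
have := expandA (cctsJ cf1).
rewrite (partsJ Df2 Df1 cf3 cf2 pf2 pf1) cI_mulJ qreal -/s.
have -> : cI (fun x => Ze x * conjc (f1 x)) = - (l2 * nrm2 f)%:C.
  have := partsJ DZe Df ltac:(ccts) cf1 pZe pf.
  move=> /(congr1 -%R); rewrite opprK => <-; congr (- _).
  rewrite CM -cI_mulJ -cIZ; last by ccts.
  by congr cI; apply/funext => x; rewrite mulrA.
move=> /(congr1 (fun z => Im z)); rewrite !(cImD, cImN) /= !(oppr0, add0r, addr0).
by move/eqP; rewrite oppr_eq0 => /eqP.
Qed.

Let H8 : Im (lam * conjc s) = 0.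
Proof.
have := expandB (cctsJ cg1).
rewrite (partsJ Dg2 Dg1 cg3 cg2 pg2 pg1) cI_mulJ qreal.
have -> : cI (fun x => Zo x * conjc (g1 x)) = - (l2 * nrm2 g)%:C.
  have := partsJ DZo Dg ltac:(ccts) cg1 pZo pg.
  move=> /(congr1 -%R); rewrite opprK => <-; congr (- _).
  rewrite CM -cI_mulJ -cIZ; last by ccts.
  by congr cI; apply/funext => x; rewrite mulrA.
have -> : cI (fun x => f x * conjc (g1 x)) = - conjc s.
  have := partsJ Df Dg cf1 cg1 pf pg; move=> /(congr1 -%R); rewrite opprK => <-.
  by congr (- _); exact: cIJsym.
rewrite mulrN opprK.
move=> /(congr1 (fun z => Im z)); rewrite !(cImD, cImN) /= !(oppr0, add0r, addr0).
by [].
Qed.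

Let Es : s = t - (pi^-1)%:C * (y0 * conjc x0).
Proof.
rewrite /s {1}gE splitJ// -/x0 mulNr mulrA; congr (_ - _).
rewrite cIJsym// {1}f1E splitJ// IGc conjc0 mulr0 addr0.
by rewrite -cIJsym.
Qed.

Let Bt : normc t <= n * m.
Proof.
apply: (le_trans (cauchy_schwarz cG (cctsJ cF1))); rewrite nrmJ mulrC.
by apply: ler_wpM2l; [exact: nrm_ge0|exact: nG].
Qed.

Let P1 : d <= 1 / 20 -> n ^+ 2 / 2 <= 6 * d * normc x0 * n - Re (lam * t).
Proof.
move=> d1.
have : - nrm2 F2 + nrm2 F1 + Re rho - Re (lam * t) + l2 * nrm2 F = 0.
  have := congr1 (fun z => Re z) E3; rewrite !(cReD, cReN); exact.
have h := errq cf1 cF1 nf1; rewrite -/rho -/n in h.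
have := PF; have := PF1; rewrite -!(nrmK cF1) -/n => h1 h2 h3.
exact: (energy_arith h1 h2 h3 (nrm_ge0 _) (normc_ge0 _) d0 d1 (nrm2_ge0 cF) l2d
  (le_trans (normr_Re rho) h)).
Qed.

Let P2 : d <= 1 / 20 -> m ^+ 2 / 2 <= 6 * d * normc y0 * m + Re (lam * conjc t).
Proof.
move=> d1.
have : - nrm2 G2 + nrm2 G1 + Re rho' + Re (lam * conjc t) + l2 * nrm2 G = 0.
  have := congr1 (fun z => Re z) E3'; rewrite !(cReD, cReN); exact.
have h := errq cg1 cG1 ng1; rewrite -/rho' -/m in h.
have := PG; have := PG1; rewrite -!(nrmK cG1) -/m => h1 h2 h3.
exact: (energy_arith h1 h2 h3 (nrm_ge0 _) (normc_ge0 _) d0 d1 (nrm2_ge0 cG) l2d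
  (le_trans (normr_Re rho') h)).
Qed.

(** All the errors have relative size at most [6 * d], so [d <= 1/6000] meets the threshold 1/1000
    of the reduced problem. *)
Lemma core_vanish : d <= 1 / 6000 -> Re lam != 0 ->
  forall x, 0 <= x <= 2 * pi -> f1 x = 0 /\ g1 x = 0.
Proof.
move=> d1 sig.
have n0 : 0 <= n := nrm_ge0 _; have m0 : 0 <= m := nrm_ge0 _.
have X0 := normc_ge0 x0; have Y0 := normc_ge0 y0.
have XN : 0 <= normc x0 + n by rewrite addr_ge0.
have YN : 0 <= normc y0 + m by rewrite addr_ge0.
have dX : 0 <= d * (normc x0 + n) by rewrite mulr_ge0.
have dY : 0 <= d * (normc y0 + m) by rewrite mulr_ge0.
have b0 : 0 <= b := le_trans l20 l2b.
have crem : continuous rem by rewrite /rem; cts.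
have [d20 D1] := small_arith d1.
have B1 : normc e1 <= 6 * d * (normc x0 + n).
  apply: (le_trans (@err _ (fun x => phi x - cos x) d _ cf1 ltac:(cts) phid nf1)).
  exact: err_arith1.
have B2 : normc e2 <= 6 * d * (normc y0 + m).
  rewrite /e2 normcN.
  apply: (le_trans (@err _ (fun x => phi x - cos x) d _ cg ltac:(cts) phid ng)).
  exact: err_arith1.
have B4 : normc e4 <= 6 * d * (normc y0 + m).
  rewrite /e4 normcN.
  apply: (le_trans (@err _ (fun x => Q x - cos x) d _ cg ltac:(cts) Qd ng)).
  exact: err_arith1.
have B3 : normc e3 <= 6 * d * b * (normc x0 + n).
  rewrite /e3 normcN; apply: (le_trans (le_normcD _ _)).
  have h1 := @err _ rem _ _ cf1 crem QE nf1.
  have h2 := @err _ (fun x => Th x - sin x) d _ cf ltac:(cts) Thd nf.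
  rewrite Normc.normcM normcR (ger0_norm l20).
  have h3 := ler_pM l20 (normc_ge0 _) l2b h2.
  exact: le_trans (lerD h1 h3) (err_arith2 _ _ _).
have qe (p : R -> R) : (forall x, `|p x| <= 1) -> forall x, `|(q x - 1) * p x| <= d.
  by move=> p1 x; rewrite normrM -[d]mulr1; apply: ler_pM.
have B6 : normc e6 <= 6 * d * (normc x0 + n).
  rewrite /e6 normcN; apply: (le_trans (le_normcD _ _)).
  have h1 := @err _ (fun x => (q x - 1) * cos x) d _ cf1 ltac:(cts) (qe _ (@cos_max R)) nf1.
  rewrite Normc.normcM normcR (ger0_norm l20).
  have h2 : l2 * normc x0 <= d * normc x0 by exact: ler_wpM2r.
  have h3 : 0 <= d * n by rewrite mulr_ge0.
  exact: le_trans (lerD h1 h2) (err_arith3 dX h3).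
have B5 : normc e5 <= 6 * d * (normc y0 + m).
  rewrite /e5; apply: (le_trans (le_normcD _ _)).
  have h1 := @err _ (fun x => (q x - 1) * sin x) d _ cg1 ltac:(cts) (qe _ (@sin_max R)) ng1.
  rewrite Normc.normcM normcR (ger0_norm l20).
  have h2 : l2 * normc y0 <= d * normc y0 by exact: ler_wpM2r.
  have h3 : 0 <= d * m by rewrite mulr_ge0.
  exact: le_trans (lerD h1 h2) (err_arith3 dY h3).
have D0 : 0 <= 6 * d by rewrite mulr_ge0.
have [xz yz nz mz] := reduced_problem n0 m0 l20 b0 D0 D1 H1 B1 B2 H2 B3 B4 H5 B5 H6 B6
  (P1 d20) (P2 d20) Bt Es H7 H8 sig.
move=> x xb; have := nrm_eq0 cF1 nz xb; have := nrm_eq0 cG1 mz xb.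
by rewrite /F1 /G1 xz yz !mulr0 !mul0r !subr0.
Qed.

End Core.

(** * Reduction to one period *)

Section PeriodicExtension.
Context {R : realType}.

Lemma per_int (T : Type) (f : R -> T) (k : int) x : per f -> f (x + k%:~R * (2 * pi)) = f x.
Proof.
move=> p; have nat_case n y : f (y + n%:R * (2 * pi)) = f y.
  elim: n y => [|n IH] y; first by rewrite mul0r addr0.
  by rewrite -natr1 mulrDl mul1r addrA p IH.
case: k => n; first exact: nat_case.
by rewrite NegzE rmorphN /= mulNr -[LHS](nat_case n.+1) subrK.
Qed.

Lemma per_rep x : exists2 k : int, 0 <= x - k%:~R * (2 * pi :> R) & x - k%:~R * (2 * pi) < 2 * pi.
Proof.
have p0 := @pi2_gt0 R.
exists (Num.floor (x / (2 * pi))).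
  by rewrite subr_ge0 -ler_pdivlMr// real_floor_le// num_real.
have := real_floorD1_gt (num_real (x / (2 * pi))).
by rewrite intrD ltr_pdivrMr// mulrDl mul1r ltrBlDl.
Qed.

Lemma per_zero (f : R -> R[i]) : per f -> (forall x, 0 <= x <= 2 * pi -> f x = 0) ->
  forall x, f x = 0.
Proof.
move=> p f0 x; have [k k0 k1] := per_rep x.
rewrite -(per_int (- k) x p) rmorphN mulNr; apply: f0.
by rewrite k0 ltW.
Qed.

End PeriodicExtension.

(** * Splitting into odd and even parts *)

Section Parity.
Context {R : realType}.
Implicit Types (f g : R -> R[i]).

Lemma cderiv_opparg f f' : cderiv f f' -> cderiv (fun x => f (- x)) (fun x => - f' (- x)).
Proof.
move=> [D1 D2]; split.
  by apply: (deriv_extr (deriv_opparg D1)) => x; rewrite cReN.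
by apply: (deriv_extr (deriv_opparg D2)) => x; rewrite cImN.
Qed.

Lemma ccts_opparg f : ccts f -> ccts (fun x => f (- x)).
Proof. by move=> [c1 c2]; split; [exact: (cts_opparg c1)|exact: (cts_opparg c2)]. Qed.

Lemma per_opparg f : per f -> per (fun x => f (- x)).
Proof. by move=> p x; rewrite -[LHS]p; congr f; ring. Qed.

Lemma cI_opp f : ccts f -> per f -> cI (fun x => f (- x)) = cI f.
Proof.
move=> [c1 c2] p; apply: complex_eq => /=.
  by rewrite (I_opp c1)// => x; rewrite p.
by rewrite (I_opp c2)// => x; rewrite p.
Qed.

(* What the argument needs to know about the coefficient
   [q = (1 + P_a) / k_a ^ 2]: it is close to 1, [phi = P_a / a] is close to cos with
   [L_a(0) phi' = 0], and [Q = cos + O(a)] satisfies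
   [Q'' + q Q = c0 + (b - l2) cos + O(b d)] where [b - l2 = a ^ 2 / 12]. *)
Definition admissible (q : R -> R) (d l2 : R) : Prop :=
  [/\ continuous q, per q, (forall x, q (- x) = q x), (forall x, `|q x - 1| <= d) &
      [/\ 0 <= d, d <= 1 / 6000, 0 <= l2 & l2 <= d]] /\
  (exists phi phi1 phi2 phi3 : R -> R,
    [/\ deriv_of phi phi1, deriv_of phi1 phi2, deriv_of phi2 phi3, continuous phi3 &
      [/\ per phi, (forall x, phi3 x + q x * phi1 x = 0) &
         forall x, `|phi x - cos x| <= d]]) /\
  (exists Q Q1 Q2 Th : R -> R, exists b c0 : R,
    [/\ deriv_of Th Q, deriv_of Q Q1, deriv_of Q1 Q2, continuous Q2 &
      [/\ per Th, l2 <= b, (forall x, `|Q x - cos x| <= d),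
          (forall x, `|Th x - sin x| <= d) &
          (forall x, `|Q2 x + q x * Q x - c0 - (b - l2) * cos x| <= d * b)]]).

(** Since [q] is even, [V''' + q V'] exchanges parities, which couples the two parts of [V] through
    [lam]. The conclusion stops at [V' = 0]: when [l2 = 0], a constant [V] with [Z = - lam V] solves
    the problem. *)
Lemma periodic_kernel (q : R -> R) (d l2 : R) (lam : R[i]) (V V1 V2 V3 Z : R -> R[i]) :
  admissible q d l2 -> complex.Re lam != 0 ->
  cderiv V V1 -> cderiv V1 V2 -> cderiv V2 V3 -> ccts V3 -> per V ->
  cderiv Z (fun x => l2%:C * V x) -> per Z ->
  (forall x, V3 x + (q x)%:C * V1 x - lam * V x - Z x = 0) ->
  forall x, V1 x = 0.
Proof.
case=> -[cq pq eq qd [d0 d1 l20 l2d]].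
case=> -[phi [phi1 [phi2 [phi3 [Dp Dp1 Dp2 cp3 [pp Ep pd]]]]]].
case=> Q [Q1 [Q2 [Th [b [c0 [DTh DQ DQ1 cQ2 [pTh l2b Qd Thd QE]]]]]]].
move=> sig DV DV1 DV2 cV3 pV DZ pZ E.
have cV := cderiv_ccts DV; have cV1 := cderiv_ccts DV1.
have pV1 := cper_deriv DV pV.
pose mu := cI V / (2 * pi)%:C.
have p2 : (2 * pi : R)%:C != 0 by rewrite fmorph_eq0 gt_eqF// pi2_gt0.
(* [Z] is periodic and [Z' = l2 V], so the mean of [V] can be nonzero only if [l2 = 0]. It can
   therefore be moved from [V] into [Z] without disturbing the equation for [Z']. *)
have l2mu : l2%:C * mu = 0.
  by rewrite /mu mulrA -cIZ// (cI_deriv_per DZ) ?mul0r//; ccts.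
pose W x := V x - mu.
pose Y x := Z x + lam * mu.
have DW : cderiv W V1.
  by apply: (cderiv_extr (cderivB DV (cderiv_cst mu))) => x; rewrite subr0.
have DY : cderiv Y (fun x => l2%:C * W x).
  apply: (cderiv_extr (cderivD DZ (cderiv_cst (lam * mu)))) => x.
  by rewrite /W mulrBr l2mu subr0 addr0.
have pW : per W by move=> x; rewrite /W pV.
have pY : per Y by move=> x; rewrite /Y pZ.
have cW := cderiv_ccts DW.
have IW : cI W = 0.
  rewrite /W cIB//; last exact: ccts_cst.
  have -> : cI (fun=> mu) = mu * (2 * pi)%:C.
    clear; apply: complex_eq; rewrite [LHS]I_cst !cE; move: mu => -[a b] /=; ring.
  by rewrite /mu mulfVK// subrr.
have EW x : V3 x + (q x)%:C * V1 x - lam * W x - Y x = 0.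
  by rewrite -(E x) /W /Y; ring.
pose h : R[i] := (2^-1)%:C.
have hh : h + h = 1 by rewrite /h -CD; congr (_%:C); field.
have DWn := cderiv_opparg DW; have DV1n := cderiv_opparg DV1; have DV2n := cderiv_opparg DV2.
have DYn := cderiv_opparg DY.
have cV3n := ccts_opparg cV3; have cWn := ccts_opparg cW.
have pWn := per_opparg pW; have pYn := per_opparg pY.
pose f x := h * (W x - W (- x)); pose f1 x := h * (V1 x + V1 (- x)).
pose f2 x := h * (V2 x - V2 (- x)); pose f3 x := h * (V3 x + V3 (- x)).
pose g x := h * (W x + W (- x)); pose g1 x := h * (V1 x - V1 (- x)).
pose g2 x := h * (V2 x + V2 (- x)); pose g3 x := h * (V3 x - V3 (- x)).
pose Ze x := h * (Y x + Y (- x)); pose Zo x := h * (Y x - Y (- x)).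
have Df : cderiv f f1.
  by apply: (cderiv_extr (cderivZ h (cderivB DW DWn))) => x; rewrite /f1 opprK.
have Df1 : cderiv f1 f2 by exact: (cderivZ h (cderivD DV1 DV1n)).
have Df2 : cderiv f2 f3.
  by apply: (cderiv_extr (cderivZ h (cderivB DV2 DV2n))) => x; rewrite /f3 opprK.
have Dg : cderiv g g1 by exact: (cderivZ h (cderivD DW DWn)).
have Dg1 : cderiv g1 g2.
  by apply: (cderiv_extr (cderivZ h (cderivB DV1 DV1n))) => x; rewrite /g2 opprK.
have Dg2 : cderiv g2 g3 by exact: (cderivZ h (cderivD DV2 DV2n)).
have DZe : cderiv Ze (fun x => l2%:C * f x).
  by apply: (cderiv_extr (cderivZ h (cderivD DY DYn))) => x; rewrite /f; ring.
have DZo : cderiv Zo (fun x => l2%:C * g x).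
  by apply: (cderiv_extr (cderivZ h (cderivB DY DYn))) => x; rewrite /g; ring.
have cf3 : ccts f3 by rewrite /f3; ccts.
have cg3 : ccts g3 by rewrite /g3; ccts.
have pf : per f by move=> x; rewrite /f pW pWn.
have pg : per g by move=> x; rewrite /g pW pWn.
have pZe : per Ze by move=> x; rewrite /Ze pY pYn.
have pZo : per Zo by move=> x; rewrite /Zo pY pYn.
have EA x : f3 x + (q x)%:C * f1 x - lam * g x - Ze x = 0.
  transitivity (h * (V3 x + (q x)%:C * V1 x - lam * W x - Y x) +
     h * (V3 (- x) + (q (- x))%:C * V1 (- x) - lam * W (- x) - Y (- x))).
    by rewrite eq /f3 /f1 /g /Ze; ring.
  by rewrite !EW !mulr0 addr0.
have EB x : g3 x + (q x)%:C * g1 x - lam * f x - Zo x = 0.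
  transitivity (h * (V3 x + (q x)%:C * V1 x - lam * W x - Y x) -
     h * (V3 (- x) + (q (- x))%:C * V1 (- x) - lam * W (- x) - Y (- x))).
    by rewrite eq /g3 /g1 /f /Zo; ring.
  by rewrite !EW !mulr0 subr0.
have If : cI f = 0.
  by rewrite /f cIZ; [rewrite cIB// cI_opp// IW subrr mulr0|exact: cctsB].
have Ig : cI g = 0.
  by rewrite /g cIZ; [rewrite cID// cI_opp// IW addr0 mulr0|exact: cctsD].
have ccos : continuous (@cos R) by exact: continuous_cos.
have csin : continuous (@sin R) by exact: continuous_sin.
have cWc : ccts (fun x => W x * (cos x)%:C) by ccts.
have cWs : ccts (fun x => W x * (sin x)%:C) by ccts.
have Ifc : cI (fun x => f x * (cos x)%:C) = 0.
  have -> : (fun x => f x * (cos x)%:C) = fun x =>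
     h * (W x * (cos x)%:C - (fun x => W x * (cos x)%:C) (- x)).
    by apply/funext => x; rewrite /f cosN; ring.
  have cn := ccts_opparg cWc.
  rewrite cIZ; last by ccts.
  rewrite cIB// (cI_opp cWc) ?subrr ?mulr0//.
  by move=> x; rewrite pW per_cos.
have Igs : cI (fun x => g x * (sin x)%:C) = 0.
  have -> : (fun x => g x * (sin x)%:C) = fun x =>
     h * (W x * (sin x)%:C - (fun x => W x * (sin x)%:C) (- x)).
    by apply/funext => x; rewrite /g sinN CN; ring.
  have cn := ccts_opparg cWs.
  rewrite cIZ; last by ccts.
  rewrite cIB// (cI_opp cWs) ?subrr ?mulr0//.
  by move=> x; rewrite pW per_sin.
have V0 x : 0 <= x <= 2 * pi -> V1 x = 0.
  move=> xb.
  have [f0 g0] := core_vanish cq d0 qd Dp Dp1 Dp2 pp cp3 Ep pd DTh DQ DQ1 cQ2 pTh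
     l20 l2b l2d Qd Thd QE Df Df1 Df2 cf3 pf Dg Dg1 Dg2 cg3 pg DZe DZo pZe pZo
     EA EB If Ig Ifc Igs d1 sig xb.
  have : f1 x + g1 x = V1 x.
    by rewrite /f1 /g1 -[RHS]mul1r -hh; ring.
  by rewrite f0 g0 addr0.
exact: per_zero pV1 V0.
Qed.

End Parity.

(** * The coefficient given by the periodic waves *)

Section Waves.
Context {R : realType}.

Lemma bndD (x y M N : R) : `|x| <= M -> `|y| <= N -> `|x + y| <= M + N.
Proof. by move=> h1 h2; rewrite (le_trans (ler_normD _ _))// lerD. Qed.

Lemma bndM (x y M N : R) : `|x| <= M -> `|y| <= N -> `|x * y| <= M * N.
Proof. by move=> h1 h2; rewrite normrM ler_pM. Qed.

Lemma bndN (x M : R) : `|x| <= M -> `|- x| <= M.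
Proof. by rewrite normrN. Qed.

Lemma cos2 (x : R) : cos (2 * x) = 2 * cos x ^+ 2 - 1.
Proof. by rewrite mulr_natl cos_mulr2n mulr_natl. Qed.

Lemma sin2 (x : R) : sin (2 * x) = 2 * (cos x * sin x).
Proof. by rewrite mulr_natl sin_mulr2n mulr_natl. Qed.

Lemma cos3 (x : R) : cos (3 * x) = 4 * cos x ^+ 3 - 3 * cos x.
Proof.
have -> : 3 * x = 2 * x + x by ring.
rewrite cosD cos2 sin2.
transitivity ((2 * cos x ^+ 2 - 1) * cos x - 2 * cos x * (sin x ^+ 2)); first by ring.
by rewrite sin2cos2; ring.
Qed.

(** With [c = cos z], the polynomials [2 c ^ 2 - 1] and [4 c ^ 3 - 3 c] are [cos (2 z)] and
    [cos (3 z)], so [Q'' + q Q] for the truncated [q] is a polynomial in [a] and [c]. All orders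
    below [a ^ 3] cancel; 11 counts the monomials that are left, each bounded by 1. *)
Lemma truncation_error (a c : R) : `|a| <= 1 -> `|c| <= 1 ->
  `|2 * c ^+ 2 - 1| <= 1 -> `|4 * c ^+ 3 - 3 * c| <= 1 ->
  `| - c - 4 / 6 * a * (2 * c ^+ 2 - 1) - 9 / 64 * a ^+ 2 * (4 * c ^+ 3 - 3 * c)
     + (1 + 5 / 24 * a ^+ 2) * (1 + (a * c + 4^-1 * (3^-1 * (2 * c ^+ 2 - 1) - 1) * a ^+ 2)) *
       (c + a / 6 * (2 * c ^+ 2 - 1) + a ^+ 2 / 64 * (4 * c ^+ 3 - 3 * c))
     - a / 2 - a ^+ 2 / 12 * c| <= 11 * `|a| ^+ 3.
Proof.
move=> a1 c1 c2 c3.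
pose u2 := 4^-1 * (3^-1 * (2 * c ^+ 2 - 1) - 1).
pose v1 := 6^-1 * (2 * c ^+ 2 - 1).
pose v2 := 64^-1 * (4 * c ^+ 3 - 3 * c).
pose s : R := 5 / 24.
have hs : `|s| <= 1 by rewrite ger0_norm /s; lra.
have hu : `|u2| <= 1 by rewrite ler_norml; move: c2; rewrite ler_norml /u2; lra.
have hv1 : `|v1| <= 1 by rewrite ler_norml; move: c2; rewrite ler_norml /v1; lra.
have hv2 : `|v2| <= 1 by rewrite ler_norml; move: c3; rewrite ler_norml /v2; lra.
rewrite [X in `|X|](_ : _ = a * a * a * (u2 * v1 + c * v2 + s * (c * c + v1) +
  a * (u2 * v2 + s * (u2 * c + c * v1 + v2)) + a * a * (s * (u2 * v1 + c * v2)) +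
  a * a * a * (s * (u2 * v2)))); last by rewrite /u2 /v1 /v2 /s; field.
have aE : `|a * a * a| = `|a| ^+ 3 by rewrite !normrM; ring.
rewrite normrM aE mulrC ler_wpM2r ?exprn_ge0//.
eapply le_trans.
  apply: bndD; [apply: bndD; [apply: bndD|]|].
  - apply: bndD; [apply: bndD; apply: bndM; eassumption|].
    by apply: bndM; [exact: hs|apply: bndD; [apply: bndM; eassumption|exact: hv1]].
  - apply: bndM; [exact: a1|apply: bndD; [apply: bndM; eassumption|]].
    apply: bndM; [exact: hs|apply: bndD; [apply: bndD; apply: bndM; eassumption|exact: hv2]].
  - apply: bndM; [apply: bndM; exact: a1|apply: bndM; [exact: hs|]].
    by apply: bndD; apply: bndM; eassumption.
  - apply: bndM; [apply: bndM; [apply: bndM; exact: a1|exact: a1]|].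
    by apply: bndM; [exact: hs|apply: bndM; eassumption].
lra.
Qed.

(** With [r = 5/24 a ^ 2] the exact error is [k2^-1 * (r ^ 2 - (k2 - (1 - r)) * (1 + r))], of fourth
    order in [A]. One power of [A] is spent on absorbing numerical factors, by means of
    [C * A <= 1/100]. *)
Lemma inverse_expansion (C A a k2 : R) : 1 <= C -> 0 <= A -> A <= 1 / (100 * C) ->
  a ^+ 2 = A ^+ 2 -> `|k2 - (1 - 5 / 24 * a ^+ 2)| <= C * A ^+ 4 ->
  [/\ 1 / 2 <= k2, `|k2^-1 - (1 + 5 / 24 * a ^+ 2)| <= C * A ^+ 3,
   `|k2^-1 - 1| <= A & `|k2^-1| <= 2].
Proof.
move=> C1 A0 A1 aA hk.
have C0 : 0 < C by lra.
have CA : C * A <= 1 / 100.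
  by move: A1; rewrite ler_pdivlMr ?mulr_gt0//; lra.
have A100 : A <= 1 / 100.
  have : 1 * A <= C * A by exact: ler_wpM2r.
  by clear -CA; lra.
have AA : A ^+ 2 <= 1 / 100 * A by rewrite expr2 ler_wpM2r.
have CA4 : C * A ^+ 4 <= 1 / 100 * A ^+ 3.
  by rewrite exprS mulrA ler_wpM2r// exprn_ge0.
have A3 : A ^+ 3 <= 1 / 100 * A ^+ 2.
  by rewrite exprS ler_wpM2r// exprn_ge0.
have A30 : 0 <= A ^+ 3 by rewrite exprn_ge0.
have A20 : 0 <= A ^+ 2 by rewrite exprn_ge0.
have k0 : 1 / 2 <= k2 /\ k2 <= 2.
  by move: hk; rewrite aA ler_norml; clear -CA4 A3 AA A100 A20; lra.
case: k0 => k0 k02.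
have kp : 0 < k2 by clear -k0; lra.
have kV : k2^-1 <= 2 by rewrite -[2]invrK lef_pV2 ?posrE//; clear -k0; lra.
have kV0 : 0 <= k2^-1 by rewrite invr_ge0 ltW.
have E1 : `|k2^-1 - (1 + 5 / 24 * a ^+ 2)| <= C * A ^+ 3.
  have -> : k2^-1 - (1 + 5 / 24 * a ^+ 2) =
    k2^-1 * ((5 / 24 * a ^+ 2) ^+ 2 - (k2 - (1 - 5 / 24 * a ^+ 2)) * (1 + 5 / 24 * a ^+ 2)).
    by field; rewrite gt_eqF.
  rewrite normrM (ger0_norm kV0).
  apply: (@le_trans _ _ (2 * (A ^+ 4 + C * A ^+ 4 * 2))).
    apply: ler_pM => //; apply: bndD.
      rewrite aA ger0_norm ?sqr_ge0// exprMn -exprM ler_piMl ?exprn_ge0//.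
      by clear; lra.
    apply: bndN; apply: bndM => //; rewrite aA ger0_norm; clear -A20 A100 AA; lra.
  have -> : A ^+ 4 = A * A ^+ 3 by rewrite -exprS.
  have h1 : A * A ^+ 3 <= 1 / 100 * A ^+ 3 by exact: ler_wpM2r.
  have h2 : C * A * A ^+ 3 <= 1 / 100 * A ^+ 3 by exact: ler_wpM2r.
  have h3 : 1 * A ^+ 3 <= C * A ^+ 3 by exact: ler_wpM2r.
  by clear -h1 h2 h3 A30; lra.
split=> //; last by rewrite ger0_norm.
have -> : k2^-1 - 1 = k2^-1 * (1 - k2) by field; rewrite gt_eqF.
rewrite normrM (ger0_norm kV0).
apply: (@le_trans _ _ (2 * (1 / 2 * A))); last by clear; lra.
apply: ler_pM => //; move: hk; rewrite aA !ler_norml.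
by clear -CA4 A3 AA A100 A20 A0; lra.
Qed.

Lemma deriv_of_derive1 (f : R -> R) : (forall x, derivable f x 1) ->
  deriv_of f (derive1 f).
Proof. by move=> df x; apply: DeriveDef; [exact: df|rewrite derive1E]. Qed.

Lemma waves_admissible (P : R -> R -> R) (k : R -> R) : periodic_waves P k ->
  exists lstar astar : R, [/\ 0 < lstar, 0 < astar &
    forall l a : R, `|l| <= lstar -> `|a| <= astar ->
    [/\ k a ^+ 2 != 0, per (P a),
      exists2 P1, deriv_of (P a) P1 & continuous P1 &
      exists d, admissible (fun x => (k a ^+ 2)^-1 * (1 + P a x)) d (l ^+ 2)]].
Proof.
case=> a0 [C0 [a00 H]].
pose C := Num.max C0 1.
have C1 : 1 <= C by rewrite le_max lexx orbT.
have C0C : C0 <= C by rewrite le_max lexx.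
have Cp : 0 < C by lra.
(* The smallness parameter will be [d = K * (|a| + l ^ 2)]. The factor 1000 in [K] leaves room for
   every remainder below, and [e] bounds both terms so that [d <= 2 * K * e = 1/6000]. *)
have [K KE] : exists K, K = 1000 * C by exists (1000 * C).
have K0 : 0 < K by rewrite KE; clear -C1; lra.
have [e e0 eK] : exists2 e, 0 < e & K * e = 1 / 12000.
  exists (K^-1 * (1 / 12000)).
    have : 0 < K^-1 by rewrite invr_gt0.
    by clear; lra.
  by rewrite mulVKf // gt_eqF.
have e1 : e <= 1 / 12000.
  by rewrite -eK ler_pMl// KE; clear -C1; lra.
exists e, (Num.min a0 e); split=> //; first by rewrite lt_min a00.
move=> l a hl; rewrite le_min => /andP[aa0 ae].
have [[pP evP] [dP [kp [ode [_ [hP [hk _]]]]]]] := H a aa0.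
set A := `|a| in ae.
have A0 : 0 <= A by exact: normr_ge0.
have aA : a ^+ 2 = A ^+ 2 by rewrite /A real_normK ?num_real.
have hk' : `|k a ^+ 2 - (1 - 5 / 24 * a ^+ 2)| <= C * A ^+ 4.
  have -> : A ^+ 4 = a ^+ 4 by rewrite (exprM A 2 2) -aA -exprM.
  by apply: (le_trans hk); apply: ler_wpM2r => //; rewrite (exprM a 2 2) sqr_ge0.
have hP' z : `|P a z - (a * cos z + 4^-1 * (3^-1 * cos (2 * z) - 1) * a ^+ 2)| <= C * A ^+ 3.
  by apply: (le_trans (hP z)); apply: ler_wpM2r => //; rewrite exprn_ge0.
have CA : C * A <= 1 / 1000.
  have : C * A <= C * e by rewrite ler_pM2l.
  move: eK; rewrite KE; clear; lra.
have A1 : A <= 1 / (100 * C).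
  have C100 : 0 < 100 * C by clear -C1; lra.
  by rewrite ler_pdivlMr//; clear -CA; lra.
have [k1 kE k3 k2V] := inverse_expansion C1 A0 A1 aA hk'.
set kap := (k a ^+ 2)^-1 in kE k3 k2V *.
have kn : k a ^+ 2 != 0 by rewrite gt_eqF//; clear -k1; lra.
have Asm : A <= 1 / 12000 by exact: le_trans ae e1.
have A2 : A ^+ 2 <= 1 / 12000 * A by rewrite expr2 ler_wpM2r.
have CA2 : C * A ^+ 2 <= 1 / 1000 * A by rewrite expr2 mulrA ler_wpM2r.
have A20 : 0 <= A ^+ 2 by exact: sqr_ge0.
have A30 : 0 <= A ^+ 3 by exact: exprn_ge0.
have CA3 : C * A ^+ 3 <= 1 / 1000 * A ^+ 2 by rewrite exprS mulrA ler_wpM2r.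
have cosb z : `|cos z| <= 1 :> R := cos_max z.
have sinb z : `|sin z| <= 1 :> R := sin_max z.
have c2b z : `|2 * cos z ^+ 2 - 1| <= 1 :> R by rewrite -cos2; exact: cos_max.
have c3b z : `|4 * cos z ^+ 3 - 3 * cos z| <= 1 :> R by rewrite -cos3; exact: cos_max.
have w2 z : `|4^-1 * (3^-1 * cos (2 * z) - 1) * a ^+ 2| <= 1 / 2 * A ^+ 2.
  rewrite normrM aA [`|A ^+ 2|]ger0_norm// ler_wpM2r// ler_norml.
  by have := cosb (2 * z); rewrite ler_norml; clear; lra.
have Pcos z : `|P a z - a * cos z| <= A ^+ 2.
  have -> : P a z - a * cos z = (P a z - (a * cos z + 4^-1 * (3^-1 * cos (2 * z) - 1) * a ^+ 2))
    + 4^-1 * (3^-1 * cos (2 * z) - 1) * a ^+ 2 by ring.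
  apply: (le_trans (bndD (hP' z) (w2 z))).
  by clear -CA3 A20; lra.
have Pb z : `|P a z| <= 2 * A.
  have -> : P a z = (P a z - a * cos z) + a * cos z by ring.
  apply: (le_trans (bndD (Pcos z) (bndM (lexx `|a|) (cosb z)))).
  by rewrite -/A; clear -A2 A0; lra.
have DP : deriv_of (P a) (derive1 (P a)).
  by apply: deriv_of_derive1 => x; case: (dP x).
have DP1 : deriv_of (derive1 (P a)) (fun z => - kap * (P a z + 2^-1 * P a z ^+ 2)).
  have D1 : deriv_of (derive1 (P a)) (derive1 (derive1 (P a))).
    by apply: deriv_of_derive1 => x; case: (dP x).
  apply: (deriv_extr D1) => z.
  have := ode z; rewrite /kap => E; apply: (mulfI kn).
  by rewrite [LHS]E; field; rewrite gt_eqF.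
have cP := deriv_continuous DP; have cP1 := deriv_continuous DP1.
pose q x := kap * (1 + P a x).
have cq : continuous q by rewrite /q; cts.
have qb z : `|q z - 1| <= 5 * A.
  have -> : q z - 1 = (kap - 1) + kap * P a z by rewrite /q; ring.
  apply: (le_trans (bndD k3 (bndM k2V (Pb z)))).
  by clear; lra.
pose d := K * (A + l ^+ 2).
have l20 : 0 <= l ^+ 2 by exact: sqr_ge0.
have Al : 0 <= A + l ^+ 2 by rewrite addr_ge0.
have d0 : 0 <= d by rewrite mulr_ge0// ltW.
have l2e : l ^+ 2 <= e.
  rewrite -(real_normK (num_real l)) expr2.
  have h1 : `|l| <= 1 by clear -hl e1; lra.
  by apply: (le_trans _ hl); rewrite ler_piMr// normr_ge0.
have d1 : d <= 1 / 6000.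
  have : d <= K * (e + e) by rewrite ler_pM2l// lerD.
  by rewrite mulrDr eK; clear; lra.
have dA : 1000 * A <= d.
  have h : 1000 * (A + l ^+ 2) <= d by apply: ler_wpM2r => //; rewrite KE; clear -C1; lra.
  by clear -h l20; lra.
have dl : 1000 * l ^+ 2 <= d.
  have h : 1000 * (A + l ^+ 2) <= d by apply: ler_wpM2r => //; rewrite KE; clear -C1; lra.
  by clear -h A0; lra.
have dCA : 1000 * C * A <= d.
  by rewrite /d -KE mulrDr lerDl mulr_ge0// ltW.
have lela (x : R) : x <= 5 * A -> x <= d by clear -dA A0; lra.
split=> //; first by exists (derive1 (P a)).
exists d; split.
  split=> //.
  - by move=> x; rewrite /q pP.
  - by move=> x; rewrite evP.
  - by move=> x; exact: lela (qb x).
  - by split=> //; clear -dl l20; lra.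
split.
  have [az|an] := eqVneq a 0.
    have AE : A = 0 by rewrite /A az normr0.
    have P0 z : P a z = 0.
      by apply/eqP; rewrite -normr_eq0 eq_le normr_ge0 andbT (le_trans (Pb z))// AE mulr0.
    have kap1 : kap = 1.
      by apply/eqP; rewrite -subr_eq0 -normr_eq0 eq_le normr_ge0 andbT (le_trans k3)// AE.
    exists cos, (fun x => - sin x), (fun x => - cos x), (fun x => sin x); split.
    - by move=> x; exact: is_derive_cos.
    - by deriv; ring.
    - by deriv; ring.
    - exact: continuous_sin.
    - split; first exact: per_cos.
        by move=> x; rewrite /= P0 kap1; ring.
      by move=> x; rewrite subrr normr0.
  (* The second derivative is taken from the wave equation; differentiating that equation once more
     yields [phi''' + q phi' = 0]. *)
  exists (fun x => a^-1 * P a x), (fun x => a^-1 * derive1 (P a) x),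
    (fun x => a^-1 * (- kap * (P a x + 2^-1 * P a x ^+ 2))),
    (fun x => a^-1 * (- kap * (derive1 (P a) x + P a x * derive1 (P a) x))).
  split.
  - by deriv; ring.
  - by deriv; ring.
  - by deriv; field.
  - by cts.
  - split; first by move=> x; rewrite pP.
      by move=> x; ring.
    move=> x; apply: lela.
    have -> : a^-1 * P a x - cos x = a^-1 * (P a x - a * cos x) by field.
    rewrite normrM normfV -/A mulrC.
    have Ap : 0 < A by rewrite normr_gt0.
    rewrite ler_pdivrMr// (le_trans (Pcos x))// expr2.
    have := mulr_ge0 A0 A0; clear; lra.
(* [Q] solves [Q'' + q Q = c0 + (a ^ 2 / 12) cos] order by order. At order [a], [cos ^ 2] leaves the
   constant 1/2 and [cos (2 x) / 2], cancelled by the coefficient 1/6. At order [a ^ 2],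
   [cos (3 x) / 8] is cancelled by 1/64, and the resonant cosine has coefficient
   [1/12 + 1/24 + 5/24 - 1/4 = 1/12]. *)
exists (fun x => cos x + a / 6 * cos (2 * x) + a ^+ 2 / 64 * cos (3 * x)),
  (fun x => - sin x - a / 3 * sin (2 * x) - 3 * a ^+ 2 / 64 * sin (3 * x)),
  (fun x => - cos x - 2 * a / 3 * cos (2 * x) - 9 * a ^+ 2 / 64 * cos (3 * x)),
  (fun x => sin x + a / 12 * sin (2 * x) + a ^+ 2 / 192 * sin (3 * x)),
  (a ^+ 2 / 12 + l ^+ 2), (a / 2).
have aA' : `|a| <= A by [].
have a2A : `|a ^+ 2| <= A by rewrite aA ger0_norm// (le_trans A2)//; clear -A0; lra.
have Qb x : `|cos x + a / 6 * cos (2 * x) + a ^+ 2 / 64 * cos (3 * x) - cos x| <= A.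
  have -> : cos x + a / 6 * cos (2 * x) + a ^+ 2 / 64 * cos (3 * x) - cos x =
    a * (6^-1 * cos (2 * x)) + a ^+ 2 * (64^-1 * cos (3 * x)) by ring.
  apply: (le_trans (bndD (bndM aA' (bndM (lexx _) (cosb _))) (bndM a2A (bndM (lexx _) (cosb _))))).
  by rewrite !gtr0_norm ?invr_gt0//; clear -A0; lra.
have Q2b x : `|cos x + a / 6 * cos (2 * x) + a ^+ 2 / 64 * cos (3 * x)| <= 2.
  rewrite -[X in `|X|](subrK (cos x)).
  by apply: (le_trans (bndD (Qb x) (cosb x))); clear -Asm; lra.
split.
- by deriv; field.
- by deriv; field.
- by deriv; field.
- by cts.
- split.
  + move=> x.
    have e2 : 2 * (x + 2 * pi) = 2 * x + 2%:~R * (2 * pi) by ring.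
    have e3 : 3 * (x + 2 * pi) = 3 * x + 3%:~R * (2 * pi) by ring.
    by rewrite e2 e3 !per_sin (per_int _ _ per_sin) (per_int _ _ per_sin).
  + by rewrite lerDr mulr_ge0// sqr_ge0.
  + by move=> x; apply: lela; apply: (le_trans (Qb x)); clear -A0; lra.
  + move=> x; apply: lela.
    have -> : sin x + a / 12 * sin (2 * x) + a ^+ 2 / 192 * sin (3 * x) - sin x =
      a * (12^-1 * sin (2 * x)) + a ^+ 2 * (192^-1 * sin (3 * x)) by ring.
    apply: (le_trans (bndD (bndM aA' (bndM (lexx _) (sinb _))) (bndM a2A (bndM (lexx _) (sinb _))))).
    by rewrite !gtr0_norm ?invr_gt0//; clear -A0; lra.
  + move=> x /=; set Qx := cos x + a / 6 * cos (2 * x) + a ^+ 2 / 64 * cos (3 * x).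
    set w := a * cos x + 4^-1 * (3^-1 * cos (2 * x) - 1) * a ^+ 2.
    have T := @truncation_error a (cos x) _ (cosb x) (c2b x) (c3b x).
    rewrite -cos2 -cos3 -/w in T.
    have -> : - cos x - 2 * a / 3 * cos (2 * x) - 9 * a ^+ 2 / 64 * cos (3 * x) +
        kap * (1 + P a x) * Qx - a / 2 - (a ^+ 2 / 12 + l ^+ 2 - l ^+ 2) * cos x =
      (- cos x - 4 / 6 * a * cos (2 * x) - 9 / 64 * a ^+ 2 * cos (3 * x)
       + (1 + 5 / 24 * a ^+ 2) * (1 + w) * Qx - a / 2 - a ^+ 2 / 12 * cos x)
      + (kap - (1 + 5 / 24 * a ^+ 2)) * ((1 + P a x) * Qx)
      + (1 + 5 / 24 * a ^+ 2) * ((P a x - w) * Qx) by field.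
    have s1 : `|1 + 5 / 24 * a ^+ 2| <= 2.
      by rewrite aA ler_norml; clear -A20 A2 Asm; lra.
    have P2 : `|1 + P a x| <= 2.
      apply: (le_trans (bndD (lexx _) (Pb x))); rewrite normr1; clear -Asm; lra.
    have a1 : `|a| <= 1 by rewrite -/A; clear -Asm; lra.
    apply: (le_trans (bndD (bndD (T a1) (bndM kE (bndM P2 (Q2b x))))
                           (bndM s1 (bndM (hP' x) (Q2b x))))).
    (* The three errors add up to at most [19 * C * |a| ^ 3], whereas [d * b] is at least
       [1000 / 12 * C * |a| ^ 3]. *)
    apply: (@le_trans _ _ (d * (A ^+ 2 / 12))); last first.
      by apply: ler_wpM2l => //; rewrite aA lerDl.
    apply: (@le_trans _ _ (1000 * C * A * (A ^+ 2 / 12))); last first.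
      by apply: ler_wpM2r => //; rewrite divr_ge0.
    have h1 : A ^+ 3 <= C * A ^+ 3 by rewrite ler_peMl.
    have -> : 1000 * C * A * (A ^+ 2 / 12) = 1000 / 12 * (C * A ^+ 3) by field.
    by rewrite -/A; clear -h1 A30; lra.
Qed.

End Waves.

(** * Linear systems of ordinary differential equations *)

Section LinearODE.
Context {R : realType}.

(** Nested intervals: [u n - 2 c / 2 ^ n] increases, [u n + 2 c / 2 ^ n] decreases, and the supremum
    of the former lies between them. The explicit rate later gives convergence uniform on bounded
    sets. *)
Lemma geometric_limit (u : nat -> R) (c : R) :
  (forall n, `|u n.+1 - u n| <= c * 2^-1 ^+ n) ->
  exists l, forall n, `|l - u n| <= 2 * c * 2^-1 ^+ n.
Proof.
move=> hu.
have c0 : 0 <= c by have := hu 0; rewrite expr0 mulr1; exact: le_trans.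
pose v n := u n - 2 * c * 2^-1 ^+ n; pose w n := u n + 2 * c * 2^-1 ^+ n.
have vS n : v n <= v n.+1.
  by have := hu n; rewrite /v exprS ler_norml => /andP[h1 h2]; lra.
have wS n : w n.+1 <= w n.
  by have := hu n; rewrite /w exprS ler_norml => /andP[h1 h2]; lra.
have vmono n m : v n <= v (n + m)%N.
  by elim: m => [|m IH]; rewrite ?addn0// addnS (le_trans IH).
have wmono n m : w (n + m)%N <= w n.
  by elim: m => [|m IH]; rewrite ?addn0// addnS (le_trans _ IH).
have vw n m : v n <= w m.
  apply: (le_trans (vmono n m)); rewrite addnC; apply: (le_trans _ (wmono m n)).
  have : 0 <= c * (2^-1 : R) ^+ (m + n) by rewrite mulr_ge0// exprn_ge0// invr_ge0.
  by rewrite /v /w; lra.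
have vub n : ubound (range v) (w n) by move=> _ [m _ <-].
have vsup : has_sup (range v) by split; [exists (v 0), 0|exists (w 0)].
exists (sup (range v)) => n; rewrite ler_norml; apply/andP; split.
  have : v n <= sup (range v) by apply: ub_le_sup; [exists (w 0)|exists n].
  by rewrite /v; lra.
have : sup (range v) <= w n by apply: ge_sup => //; exists (v 0), 0.
by rewrite /w; lra.
Qed.

Lemma geometric_null (a c : R) : (forall n, `|a| <= c * 2^-1 ^+ n) -> a = 0.
Proof.
move=> h; apply/eqP; rewrite -normr_le0; apply/ler_addgt0Pl => e e0; rewrite addr0.
have : (fun n => c * (2^-1 : R) ^+ n) @ \oo --> c * 0.
  apply: cvgMr; apply: cvg_expr; rewrite ger0_norm ?invr_ge0//; lra.
rewrite mulr0 => /cvgrPdist_lt /(_ e e0) [n _ /(_ n (leqnn n))] /=.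
rewrite sub0r normrN => /ltW; apply: le_trans.
by apply: (le_trans (h n)); exact: ler_norm.
Qed.

(** Integrating the exponential weight gains the factor [1 / kap]; negative arguments are reduced to
    positive ones by reflection. *)
Lemma prim_exp_bound (f : R -> R) (c kap x : R) : continuous f -> 0 < kap ->
  (forall s, `|f s| <= c * expR (kap * `|s|)) ->
  `|prim f x| <= c / kap * expR (kap * `|x|).
Proof.
move=> cf k0 hf.
have c0 : 0 <= c.
  by have := hf 0; rewrite normr0 mulr0 expR0 mulr1; exact: le_trans.
suff H (g : R -> R) y : continuous g -> 0 <= y ->
    (forall s, `|g s| <= c * expR (kap * `|s|)) ->
    `|prim g y| <= c / kap * expR (kap * y).
  have [x0|x0] := leP 0 x; first by rewrite [in leRHS]ger0_norm//; exact: H.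
  have -> : prim f x = - prim (fun s => f (- s)) (- x).
    have D := deriv_prim (cts_opparg cf).
    have D2 : deriv_of (fun x => - prim (fun s => f (- s)) (- x)) f.
      by apply: (deriv_extr (derivN (deriv_opparg D))) => s /=; rewrite !opprK.
    by rewrite (primE x D2)// oppr0 prim0 oppr0 subr0.
  rewrite normrN [in leRHS]ltr0_norm//; apply: H; first exact: cts_opparg.
    by rewrite oppr_ge0 ltW.
  by move=> s; rewrite -[`|s|]normrN.
move=> cg y0 hg.
pose E s := c / kap * expR (kap * s).
have DE : deriv_of E (fun s => c * expR (kap * s)).
  have D : deriv_of (fun s => expR (kap * s)) (fun s => expR (kap * s) * kap).
    apply: (@deriv_comp _ expR expR (fun s => kap * s) (fun=> kap)).
      by move=> s; exact: is_derive_expR.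
    by deriv; ring.
  by rewrite /E; deriv; field; rewrite gt_eqF.
have cE : continuous (fun s => c * expR (kap * s)).
  by apply: ctsM; [exact: cts_cst|apply: (@cts_comp _ expR (fun s => kap * s)); [exact: continuous_expR|cts]].
have hE : prim (fun s => c * expR (kap * s)) y <= c / kap * expR (kap * y).
  rewrite (primE y DE)// /E mulr0 expR0 mulr1 gerBl divr_ge0// ltW//.
have b s : 0 <= s <= y -> - (c * expR (kap * s)) <= g s /\ g s <= c * expR (kap * s).
  move=> /andP[s0 _]; by have := hg s; rewrite [`|s|]ger0_norm// ler_norml => /andP[].
rewrite ler_norml; apply/andP; split.
  rewrite lerNl; apply: (le_trans _ hE).
  have -> : - prim g y = prim (fun s => - g s) y.
    rewrite -mulN1r -[RHS](_ : prim (fun s => -1 * g s + 0 * g s) y = _); last first.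
      by congr prim; apply/funext => s; ring.
    by rewrite prim_lin// mul0r addr0.
  apply: prim_le => //; first exact: ctsN.
  by move=> s /b[h _]; rewrite lerNl.
by apply: (le_trans _ hE); apply: prim_le => // s /b[].
Qed.

Context (N : nat) (M : 'I_N -> 'I_N -> R -> R) (kap0 : R)
  (cM : forall i j, continuous (M i j)) (Mb : forall i j x, `|M i j x| <= kap0).

(** Exponential weight in the manner of Bielecki: as [N * |kap0| / kap <= 1/2], integrating the
    linear right-hand side halves the weighted sup norm, and Picard iteration converges on the whole
    line at once. The added 1 keeps [kap >= 1] even for a zero matrix. *)
Notation kap := (2 * (N%:R * `|kap0|) + 1).

Let kap_gt0 : 0 < kap.
Proof. by have := mulr_ge0 (ler0n R N) (normr_ge0 kap0); lra. Qed.

Let kap_ge1 : 1 <= kap.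
Proof. by have := mulr_ge0 (ler0n R N) (normr_ge0 kap0); lra. Qed.

Let expk_ge1 (x : R) : 1 <= expR (kap * `|x|).
Proof. by rewrite -expR0 ler_expR mulr_ge0// ltW. Qed.

Let abs_le_expk (x : R) : `|x| <= expR (kap * `|x|).
Proof.
apply: (@le_trans _ _ (kap * `|x|)); first by rewrite ler_peMl.
by apply: (le_trans _ (expR_ge1Dx _)); rewrite lerDr.
Qed.

Definition lin (y : 'I_N -> R -> R) (i : 'I_N) (x : R) := \sum_j M i j x * y j x.

Lemma cts_sum (T : Type) (r : seq T) (F : T -> R -> R) :
  (forall i, continuous (F i)) -> continuous (fun x => \sum_(i <- r) F i x).
Proof.
move=> cF; elim: r => [|i r IH].
  by apply: (@cts_ext _ (fun=> 0)) => [|x]; [exact: cts_cst|rewrite big_nil].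
by apply: (cts_ext (ctsD (cF i) IH)) => x; rewrite big_cons.
Qed.

Lemma deriv_sum (T : Type) (r : seq T) (F G : T -> R -> R) :
  (forall i, deriv_of (F i) (G i)) ->
  deriv_of (fun x => \sum_(i <- r) F i x) (fun x => \sum_(i <- r) G i x).
Proof.
move=> cF; elim: r => [|i r IH].
  by apply: (@deriv_ext _ (fun=> 0) _ (fun=> 0)) => [|x|x]; [exact: deriv_cst|rewrite big_nil|rewrite big_nil].
by apply: (deriv_ext (derivD (cF i) IH)) => x; rewrite big_cons.
Qed.

Let cts_lin (y : 'I_N -> R -> R) (i : 'I_N) : (forall j, continuous (y j)) -> continuous (lin y i).
Proof. by move=> cy; apply: cts_sum => j; apply: ctsM. Qed.

Let lin_bound (y : 'I_N -> R -> R) (i : 'I_N) (c x : R) : (forall j, `|y j x| <= c) -> `|lin y i x| <= N%:R * `|kap0| * c.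
Proof.
move=> yc; apply: (le_trans (ler_norm_sum _ _ _)).
apply: (@le_trans _ _ (\sum_(j < N) `|kap0| * c)).
  apply: ler_sum => j _; rewrite normrM ler_pM//.
  by apply: (le_trans (Mb i j x)); exact: ler_norm.
by rewrite sumr_const card_ord -mulrA mulr_natl.
Qed.

Let prim_lin_bound (y : 'I_N -> R -> R) (i : 'I_N) (c : R) : (forall j, continuous (y j)) -> 0 <= c ->
  (forall j x, `|y j x| <= c * expR (kap * `|x|)) ->
  forall x, `|prim (lin y i) x| <= 2^-1 * c * expR (kap * `|x|).
Proof.
move=> cy c0 yc x.
have h s : `|lin y i s| <= N%:R * `|kap0| * c * expR (kap * `|s|).
  by rewrite -mulrA; apply: lin_bound.
apply: (le_trans (prim_exp_bound x (@cts_lin y i cy) kap_gt0 h)).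
apply: ler_wpM2r; first exact: expR_ge0.
rewrite ler_pdivrMr//.
have := mulr_ge0 (mulr_ge0 (ler0n R N) (normr_ge0 kap0)) c0; lra.
Qed.

Definition solves (b y : 'I_N -> R -> R) :=
  forall i, deriv_of (y i) (fun x => lin y i x + b i x).

Lemma ode_unique (y : 'I_N -> R -> R) c : solves (fun _ _ => 0) y ->
  (forall i, y i 0 = 0) -> (forall i x, `|y i x| <= c * expR (kap * `|x|)) ->
  forall i x, y i x = 0.
Proof.
move=> sy y0 yc i x.
have c0 : 0 <= c.
  by have := yc i 0; rewrite normr0 mulr0 expR0 mulr1; exact: le_trans.
have cy j : continuous (y j) by exact: deriv_continuous (sy j).
have H n j s : `|y j s| <= (c * 2^-1 ^+ n) * expR (kap * `|s|).
  elim: n j s => [|n IH] j s; first by rewrite expr0 mulr1.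
  have -> : y j s = prim (lin y j) s.
    rewrite (@primE _ _ (y j)) ?y0 ?subr0//; last exact: cts_lin.
    by apply: (deriv_extr (sy j)) => z; rewrite addr0.
  rewrite exprS mulrCA; apply: prim_lin_bound => //.
  by rewrite mulr_ge0// exprn_ge0// invr_ge0.
apply: (@geometric_null _ (c * expR (kap * `|x|))) => n.
by rewrite mulrAC; exact: H.
Qed.

(** Picard iteration from 0, with increments of weighted norm at most [(e0 + beta) / 2 ^ n]. The
    resulting bound places the solution in the class where uniqueness holds. *)
Lemma ode_exists (b : 'I_N -> R -> R) (eta : 'I_N -> R) (beta e0 : R) :
  (forall i, continuous (b i)) -> (forall i x, `|b i x| <= beta) -> 0 <= beta ->
  (forall i, `|eta i| <= e0) -> 0 <= e0 ->
  exists2 y : 'I_N -> R -> R, solves b y & (forall i, y i 0 = eta i) /\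
    (forall i x, `|y i x| <= 2 * (e0 + beta) * expR (kap * `|x|)).
Proof.
move=> cb bb beta0 he e00.
pose step (y : 'I_N -> R -> R) i x := eta i + (prim (lin y i) x + prim (b i) x).
pose Y n := iter n step (fun _ _ => 0).
have Dp i := deriv_prim (cb i).
have cY n i : continuous (Y n i).
  elim: n i => [|n IH] i; first exact: cts_cst.
  have := deriv_prim (@cts_lin (Y n) i IH); have := Dp i => ? ?.
  by rewrite /Y /= /step; cts.
have D0 : 0 <= e0 + beta by rewrite addr_ge0.
have half0 n : 0 <= (2^-1 : R) ^+ n by rewrite exprn_ge0// invr_ge0.
have dY n i x : `|Y n.+1 i x - Y n i x| <= (e0 + beta) * 2^-1 ^+ n * expR (kap * `|x|).
  elim: n i x => [|n IH] i x.
    rewrite expr0 mulr1 /Y /= /step subr0.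
    have -> : prim (lin (fun _ _ => 0) i) x = 0.
      have E : lin (fun _ _ => 0) i = fun=> 0.
        by apply/funext => z; rewrite /lin big1// => j _; rewrite mulr0.
      by rewrite E (@primE _ _ (fun=> 0)) ?subrr//; [exact: deriv_cst|exact: cts_cst].
    rewrite add0r mulrDl; apply: (le_trans (ler_normD _ _)); apply: lerD.
      by apply: (le_trans (he i)); rewrite ler_peMr.
    have h s : `|b i s| <= beta * expR (kap * `|s|).
      by apply: (le_trans (bb i s)); rewrite ler_peMr.
    apply: (le_trans (prim_exp_bound x (cb i) kap_gt0 h)).
    by apply: ler_wpM2r; rewrite ?expR_ge0// ler_pdivrMr// ler_peMr.
  have -> : Y n.+2 i x - Y n.+1 i x = prim (lin (fun j s => Y n.+1 j s - Y n j s) i) x.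
    transitivity (prim (lin (Y n.+1) i) x - prim (lin (Y n) i) x).
      by rewrite {1}/Y /= -/(Y n.+1) {3}/Y /= -/(Y n) /step; ring.
    have E : lin (fun j s => Y n.+1 j s - Y n j s) i =
        fun z => 1 * lin (Y n.+1) i z + (-1) * lin (Y n) i z.
      apply/funext => z; rewrite mul1r mulN1r /lin -sumrB.
      by apply: eq_bigr => j _; rewrite mulrBr.
    by rewrite E prim_lin ?mul1r ?mulN1r//; exact: cts_lin.
  rewrite exprS mulrCA; apply: prim_lin_bound => //; last by rewrite mulr_ge0.
  by move=> j; apply: ctsB.
have lim i x : exists l, forall n, `|l - Y n i x| <= 2 * ((e0 + beta) * expR (kap * `|x|)) * 2^-1 ^+ n.
  by apply: geometric_limit => n; rewrite mulrAC; exact: dY.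
have [y hy] : exists y : 'I_N -> R -> R, forall i x n,
    `|y i x - Y n i x| <= 2 * ((e0 + beta) * expR (kap * `|x|)) * 2^-1 ^+ n.
  have /choice[y hy] : forall ix : 'I_N * R, exists l, forall n,
     `|l - Y n ix.1 ix.2| <= 2 * ((e0 + beta) * expR (kap * `|ix.2|)) * 2^-1 ^+ n.
    by move=> [i x]; exact: lim.
  by exists (fun i x => y (i, x)) => i x n; exact: (hy (i, x)).
(* The weight makes convergence uniform only on bounded sets: [B] bounds it within distance 1 of
   [x], and the difference is split into three parts as usual. *)
have cy i : continuous (y i).
  move=> x; apply/cvgrPdist_lt => e ep.
  pose B := 2 * ((e0 + beta) * expR (kap * (`|x| + 1))) + 1.
  have Bp : 0 < B.
    by have := mulr_ge0 D0 (expR_ge0 (kap * (`|x| + 1))); rewrite /B; lra.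
  have [n hn] : exists n, B * 2^-1 ^+ n < e / 3.
    have e3 : 0 < e / 3 by lra.
    have : (fun n => B * (2^-1 : R) ^+ n) @ \oo --> B * 0.
      apply: cvgMr; apply: cvg_expr; rewrite ger0_norm ?invr_ge0//; lra.
    rewrite mulr0 => /cvgrPdist_lt /(_ _ e3) [n _ /(_ n (leqnn n))] /=.
    by rewrite sub0r normrN => h; exists n; apply: (le_lt_trans (ler_norm _) h).
  have near1 : \forall z \near x, `|x - z| < 1.
    by exists 1 => //=; exact: ltr01.
  have e3 : 0 < e / 3 by lra.
  have nearY : \forall z \near x, `|Y n i x - Y n i z| < e / 3.
    by have /cvgrPdist_lt := cY n i x; apply.
  have hB z : `|z| <= `|x| + 1 -> `|y i z - Y n i z| < e / 3.
    move=> hz; apply: le_lt_trans hn; apply: (le_trans (hy i z n)).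
    apply: ler_wpM2r => //; rewrite /B.
    have : expR (kap * `|z|) <= expR (kap * (`|x| + 1)) by rewrite ler_expR ler_pM2l.
    by move=> /(ler_wpM2l D0); lra.
  near=> z.
  have z1 : `|z| <= `|x| + 1.
    have -> : z = x - (x - z) by ring.
    apply: (le_trans (ler_normB _ _)); rewrite lerD2l ltW//; near: z; exact: near1.
  have -> : y i x - y i z = (y i x - Y n i x) + (Y n i x - Y n i z) - (y i z - Y n i z) by ring.
  apply: (le_lt_trans (ler_normB _ _)); apply: (le_lt_trans (lerD (ler_normD _ _) (lexx _))).
  have h1 := hB _ z1.
  have h2 : `|y i x - Y n i x| < e / 3 by apply: hB; rewrite lerDl.
  have h3 : `|Y n i x - Y n i z| < e / 3 by near: z; exact: nearY.
  by move: h1 h2 h3; clear; lra.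
(* The defect of the limit in the integral equation is bounded by a multiple of [1 / 2 ^ n] for
   every [n]. *)
have yE i x : y i x = eta i + (prim (lin y i) x + prim (b i) x).
  apply/eqP; rewrite -subr_eq0; apply/eqP.
  pose Cx := 2 * ((e0 + beta) * expR (kap * `|x|)).
  apply: (@geometric_null _ (2 * Cx)) => n.
  have -> : y i x - (eta i + (prim (lin y i) x + prim (b i) x)) =
     (y i x - Y n.+1 i x) + prim (lin (fun j s => Y n j s - y j s) i) x.
    have E : lin (fun j s => Y n j s - y j s) i =
        fun z => 1 * lin (Y n) i z + (-1) * lin y i z.
      apply/funext => z; rewrite mul1r mulN1r /lin -sumrB.
      by apply: eq_bigr => j _; rewrite mulrBr.
    rewrite E prim_lin ?mul1r ?mulN1r; [|exact: cts_lin|exact: cts_lin].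
    by rewrite {1}/Y /= -/(Y n) /step; ring.
  apply: (le_trans (ler_normD _ _)).
  have h1 : `|y i x - Y n.+1 i x| <= Cx * 2^-1 ^+ n.
    apply: (le_trans (hy i x n.+1)); rewrite -/Cx; apply: ler_wpM2l.
      by rewrite /Cx mulr_ge0// mulr_ge0// expR_ge0.
    by rewrite exprS ler_piMl//; lra.
  have h2 : `|prim (lin (fun j s => Y n j s - y j s) i) x| <= 2^-1 * (2 * (e0 + beta) * 2^-1 ^+ n) * expR (kap * `|x|).
    apply: prim_lin_bound.
    - by move=> j; apply: ctsB.
    - by rewrite mulr_ge0// mulr_ge0.
    - by move=> j s; rewrite distrC; apply: (le_trans (hy j s n)); rewrite le_eqVlt; apply/orP; left; apply/eqP; ring.
  apply: (le_trans (lerD h1 h2)).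
  have := mulr_ge0 (mulr_ge0 D0 (expR_ge0 (kap * `|x|))) (half0 n).
  by rewrite /Cx; lra.
exists y.
  move=> i; have D1 := deriv_prim (@cts_lin y i cy); have D2 := Dp i.
  have -> : y i = fun x => eta i + (prim (lin y i) x + prim (b i) x).
    by apply/funext => x; exact: yE.
  by deriv; rewrite add0r.
split=> [i|i x]; first by rewrite yE !prim0 !addr0.
by have := hy i x 0; rewrite expr0 mulr1 subr0 mulrA.
Unshelve. all: by end_near. Qed.

End LinearODE.

(** * The Fredholm alternative for periodic linear systems *)

Section PeriodicSystem.
Context {R : realType}.

Lemma per_bounded (f : R -> R) : continuous f -> per f -> exists B, forall x, `|f x| <= B.
Proof.
move=> cf pf.
have [c _ hc] := @EVT_max R (fun x => `|f x|) 0 (2 * pi) (ltW pi2_gt0)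
  (continuous_subspaceT (cts_norm cf)).
exists `|f c| => x; have [k k0 k1] := per_rep x.
rewrite -(per_int (- k) x pf) rmorphN mulNr; apply: hc.
by rewrite in_itv/= k0 ltW.
Qed.

Context (N : nat) (M : 'I_N -> 'I_N -> R -> R) (kap0 : R)
  (cM : forall i j, continuous (M i j)) (Mb : forall i j x, `|M i j x| <= kap0)
  (pM : forall i j, per (M i j)).

Notation kap := (2 * (N%:R * `|kap0|) + 1).

Let kap_gt0 : 0 < kap.
Proof. by have := mulr_ge0 (ler0n R N) (normr_ge0 kap0); lra. Qed.

(** The class in which initial values determine solutions. It contains the solutions built by
    iteration and all continuous periodic functions. *)
Definition growth (y : 'I_N -> R -> R) := exists c, forall i x, `|y i x| <= c * expR (kap * `|x|).

Lemma solves_sub b b' (y y' : 'I_N -> R -> R) : solves M b y -> solves M b' y' ->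
  solves M (fun i x => b i x - b' i x) (fun i x => y i x - y' i x).
Proof.
move=> s s' i; apply: (deriv_extr (derivB (s i) (s' i))) => x.
have -> : lin M (fun i x => y i x - y' i x) i x = lin M y i x - lin M y' i x.
  by rewrite /lin -sumrB; apply: eq_bigr => j _; rewrite mulrBr.
ring.
Qed.

Lemma growth_sub y y' : growth y -> growth y' -> growth (fun i x => y i x - y' i x).
Proof.
move=> [c hc] [c' hc']; exists (c + c') => i x.
by rewrite mulrDl; apply: (le_trans (ler_normB _ _)); apply: lerD.
Qed.

Lemma growth_per y : (forall i, continuous (y i)) -> (forall i, per (y i)) -> growth y.
Proof.
move=> cy py.
have /choice[B hB] : forall i, exists B, forall x, `|y i x| <= B.
  by move=> i; exact: per_bounded.
exists (\sum_i `|B i|) => i x.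
apply: (@le_trans _ _ (\sum_i `|B i|)).
  rewrite (bigD1 i)//=; apply: (le_trans (hB i x)); apply: (le_trans (ler_norm _)).
  by rewrite lerDl sumr_ge0.
by rewrite ler_peMr ?sumr_ge0// -expR0 ler_expR mulr_ge0// ltW.
Qed.

Lemma solves_eq b (y y' : 'I_N -> R -> R) : solves M b y -> solves M b y' ->
  growth y -> growth y' -> (forall i, y i 0 = y' i 0) -> forall i x, y i x = y' i x.
Proof.
move=> s s' g g' e i x; apply/eqP; rewrite -subr_eq0; apply/eqP.
have [c hc] := growth_sub g g'.
apply: (@ode_unique R N M kap0 cM Mb (fun i x => y i x - y' i x) c) => //.
  by move=> j; apply: (deriv_extr (solves_sub s s' j)) => z; rewrite subrr.
by move=> j; rewrite e subrr.
Qed.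

(** The translate by a period solves the same system with the same initial values; translation costs
    only the factor [expR (kap * (2 * pi))] in the growth bound. *)
Lemma solves_per b (y : 'I_N -> R -> R) : (forall i, per (b i)) -> solves M b y -> growth y ->
  (forall i, y i (2 * pi) = y i 0) -> forall i, per (y i).
Proof.
move=> pb s g e i x.
have s' : solves M b (fun i x => y i (x + 2 * pi)).
  move=> j; apply: (deriv_extr (deriv_shift (2 * pi) (s j))) => z.
  by rewrite pb /lin; congr (_ + _); apply: eq_bigr => l _; rewrite pM.
have g' : growth (fun i x => y i (x + 2 * pi)).
  case: g => c hc; exists (`|c| * expR (kap * (2 * pi))) => j z.
  apply: (le_trans (hc j _)); rewrite -mulrA -expRD.
  have c0 : 0 <= c by have := hc j 0; rewrite normr0 mulr0 expR0 mulr1; exact: le_trans.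
  apply: (ler_pM c0 (expR_ge0 _) (ler_norm c)).
  have h : `|z + 2 * pi| <= `|z| + 2 * pi.
    by apply: (le_trans (ler_normD _ _)); rewrite lerD2l gtr0_norm// pi2_gt0.
  by rewrite ler_expR -mulrDr ler_pM2l// [leRHS]addrC.
by apply: (solves_eq s' s g' g) => j; rewrite add0r.
Qed.

(** With [A] the monodromy matrix minus the identity, acting on row vectors of initial values,
    periodicity is a linear equation for the initial value. The hypothesis makes [A] injective,
    hence invertible, and the entries of its inverse give the bound. *)
Theorem periodic_linear_system :
  (forall y, solves M (fun _ _ => 0) y -> (forall i, per (y i)) -> forall i x, y i x = 0) ->
  exists C, forall b beta, (forall i, continuous (b i)) -> (forall i, per (b i)) ->
    (forall i x, `|b i x| <= beta) -> 0 <= beta ->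
    (exists2 y, solves M b y & forall i, per (y i)) /\
    (forall y, solves M b y -> (forall i, per (y i)) ->
      forall i x, `|y i x| <= C * beta).
Proof.
move=> H0.
have H1 : forall i0 : 'I_N, exists h : 'I_N -> R -> R, [/\ solves M (fun _ _ => 0) h,
    forall i, h i 0 = (i0 == i)%:R & forall i x, `|h i x| <= 2 * expR (kap * `|x|)].
  move=> i0.
  have [| | | | |h sh [h0 hb]] := @ode_exists R N M kap0 cM Mb (fun _ _ => 0)
      (fun i => (i0 == i)%:R) 0 1.
  - by move=> i; exact: cts_cst.
  - by move=> i x; rewrite normr0.
  - by [].
  - by move=> i; case: eqP => _; rewrite ?normr0 ?normr1.
  - by [].
  by exists h; split=> // i x; have := hb i x; rewrite addr0 mulr1.
have {H1}/choice[h hh] := H1.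
have ch i j : continuous (h i j) by have [s _ _] := hh i; exact: deriv_continuous (s j).
pose A : 'M[R]_N := \matrix_(i, j) (h i j (2 * pi)) - 1%:M.
pose hom (eta : 'rV[R]_N) (j : 'I_N) (x : R) := \sum_i eta 0 i * h i j x.
have homs eta : solves M (fun _ _ => 0) (hom eta).
  move=> j.
  have D : deriv_of (hom eta j) (fun x => \sum_i eta 0 i * (lin M (h i) j x + 0)).
    apply: deriv_sum => i; have [s _ _] := hh i; have := s j => ?.
    by deriv; ring.
  apply: (deriv_extr D) => x; rewrite addr0 /lin /hom.
  under eq_bigr do rewrite addr0 mulr_sumr.
  rewrite exchange_big/=; apply: eq_bigr => l _; rewrite mulr_sumr.
  by apply: eq_bigr => i _; rewrite mulrCA.
have homb eta j x : `|hom eta j x| <= (\sum_i `|eta 0 i|) * (2 * expR (kap * `|x|)).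
  apply: (le_trans (ler_norm_sum _ _ _)); rewrite mulr_suml; apply: ler_sum => i _.
  by rewrite normrM ler_wpM2l//; have [_ _] := hh i; exact.
have homg eta : growth (hom eta).
  by exists ((\sum_i `|eta 0 i|) * 2) => j x; rewrite -mulrA.
have hom0 eta j : hom eta j 0 = eta 0 j.
  rewrite /hom (bigD1 j)//= big1 ?addr0.
    by have [_ -> _] := hh j; rewrite eqxx mulr1.
  by move=> i ij; have [_ -> _] := hh i; rewrite (negbTE ij) mulr0.
have homT eta j : hom eta j (2 * pi) = (eta *m A) 0 j + eta 0 j.
  rewrite /A mulmxBr mulmx1 !mxE subrK /hom.
  by apply: eq_bigr => i _; rewrite mxE.
(* A row killed by [A] is the initial value of a periodic homogeneous solution, which vanishes
   identically. *)
have Au : A \in unitmx.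
  rewrite -row_free_unit -kermx_eq0; apply/eqP/row_matrixP => i; rewrite row0.
  have kA : row i (kermx A) *m A = 0 by rewrite -row_mul mulmx_ker row0.
  have per_hom j : per (hom (row i (kermx A)) j).
    apply: (@solves_per (fun _ _ => 0) _ (fun _ _ => erefl) (homs _) (homg _)).
    by move=> l; rewrite homT hom0 kA mxE add0r.
  apply/rowP => j; rewrite [RHS]mxE -hom0.
  by apply: H0 => //; exact: homs.
have part b beta : (forall i, continuous (b i)) -> (forall i x, `|b i x| <= beta) -> 0 <= beta ->
    exists2 p : 'I_N -> R -> R, solves M b p & (forall i, p i 0 = 0) /\
      (forall i x, `|p i x| <= 2 * beta * expR (kap * `|x|)).
  move=> cb bb b0.
  have [| |p sp [p0 pb]] := @ode_exists R N M kap0 cM Mb b (fun=> 0) beta 0 cb bb b0.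
  - by move=> i; rewrite normr0.
  - by [].
  by exists p => //; split=> // i x; have := pb i x; rewrite add0r.
have add_solves b p eta : solves M b p -> solves M b (fun i x => p i x + hom eta i x).
  move=> sp i; apply: (deriv_extr (derivD (sp i) (homs eta i))) => x.
  rewrite addr0 /lin addrAC -big_split/=; congr (_ + _).
  by apply: eq_bigr => j _; rewrite mulrDr.
have add_growth p eta : growth p -> growth (fun i x => p i x + hom eta i x).
  move=> [c hc]; have [c' hc'] := homg eta; exists (c + c') => i x.
  by rewrite mulrDl; apply: (le_trans (ler_normD _ _)); apply: lerD.
(* [T] bounds the solutions over one period per unit of data and [S] bounds the inverse of [A]: the
   particular solution contributes [T], the homogeneous correction [T * S * T]. *)
pose S := \sum_i \sum_j `|invmx A j i|.
pose T := 2 * expR (kap * (2 * pi)).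
have T0 : 0 <= T by rewrite mulr_ge0// expR_ge0.
exists (T + T * S * T) => b beta cb pb bb b0.
have [p sp [p0 pbd]] := part b beta cb bb b0.
have gp : growth p by exists (2 * beta).
pose pT : 'rV[R]_N := \row_j p j (2 * pi).
pose eta := - pT *m invmx A.
split.
  exists (fun i x => p i x + hom eta i x); first exact: add_solves.
  apply: (solves_per pb (add_solves _ _ _ sp) (add_growth _ _ gp)) => j.
  rewrite homT hom0 p0 /eta mulmxKV// !mxE; ring.
move=> y sy py j x.
have gy : growth y.
  by apply: growth_per => // i; exact: deriv_continuous (sy i).
pose eta1 : 'rV[R]_N := \row_j y j 0.
have yE i z : y i z = p i z + hom eta1 i z.
  apply: (solves_eq sy (add_solves _ _ _ sp) gy (add_growth _ _ gp)) => l.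
  by rewrite p0 hom0 mxE add0r.
have etaE : eta1 = eta.
  rewrite /eta; apply: (canRL (mulmxK Au)); apply/rowP => l.
  have := py l 0; rewrite add0r !yE homT hom0 p0 add0r.
  by rewrite !mxE; lra.
have pb2 i z : 0 <= z <= 2 * pi -> `|p i z| <= beta * T.
  move=> /andP[z0 z1]; apply: (le_trans (pbd i z)); rewrite mulrAC mulrC.
  by rewrite ler_wpM2l// ler_wpM2l// ler_expR ler_pM2l// ger0_norm.
have etab : \sum_i `|eta 0 i| <= beta * T * S.
  rewrite /S mulr_sumr; apply: ler_sum => i _; rewrite mxE.
  apply: (le_trans (ler_norm_sum _ _ _)); rewrite mulr_sumr; apply: ler_sum => l _.
  rewrite normrM ler_wpM2r// !mxE normrN; apply: pb2.
  by rewrite lexx ltW// pi2_gt0.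
have H i z : 0 <= z <= 2 * pi -> `|y i z| <= (T + T * S * T) * beta.
  move=> zb; rewrite yE etaE; apply: (le_trans (ler_normD _ _)).
  have -> : (T + T * S * T) * beta = beta * T + beta * T * S * T by ring.
  apply: lerD; first exact: pb2.
  apply: (le_trans (homb _ _ _)).
  have e0 : 0 <= 2 * expR (kap * `|z|) by rewrite mulr_ge0// expR_ge0.
  have s0 : 0 <= \sum_i `|eta 0 i| by rewrite sumr_ge0.
  apply: (ler_pM s0 e0 etab).
  move: zb => /andP[z0 z1].
  by rewrite ler_wpM2l// ler_expR ler_pM2l// ger0_norm.
have [k k0 k1] := per_rep x.
rewrite -(per_int (- k) x (py j)) rmorphN mulNr; apply: H.
by rewrite k0 ltW.
Qed.

End PeriodicSystem.

(** * The integrated resolvent equation as a real periodic system *)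

Section ResolventODE.
Context {R : realType}.
Notation Re := complex.Re.
Notation Im := complex.Im.
Notation normc := (@Normc.normc R).

Lemma sum8 (F : nat -> R) :
  \sum_(j < 8) F j = F 0 + F 1 + F 2 + F 3 + F 4 + F 5 + F 6 + F 7.
Proof. by rewrite !big_ord_recr big_ord0 /= add0r. Qed.

Lemma normc_le (z : R[i]) : normc z <= `|Re z| + `|Im z|.
Proof.
rewrite -(@ler_pXn2r _ 2)// ?nnegrE ?normc_ge0 ?addr_ge0// normc2.
rewrite -(real_normK (num_real (Re z))) -(real_normK (num_real (Im z))).
by have := mulr_ge0 (normr_ge0 (Re z)) (normr_ge0 (Im z)); lra.
Qed.

(** The integral of [(z ^ 2)' = - 2 z ^ 2] over a period is zero. *)
Lemma decay_per (z : R -> R) : deriv_of z (fun x => - z x) -> per z -> forall x, z x = 0.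
Proof.
move=> D p; have cz := deriv_continuous D.
have D2 : deriv_of (fun x => z x ^+ 2) (fun x => - 2 * z x ^+ 2).
  by deriv; rewrite expr1; ring.
have I2 : I (fun x => z x ^+ 2) = 0.
  have := I_deriv_per D2 ltac:(cts); rewrite IZ; last by cts.
  move=> H; have : - 2 * I (fun x => z x ^+ 2) = 0 by apply: H => x; rewrite p.
  by lra.
have H x : 0 <= x <= 2 * pi -> z x = 0.
  move=> xb; apply/eqP; rewrite -sqrf_eq0; apply/eqP.
  by apply: (I_eq0 _ _ I2 xb); [cts|move=> y; exact: sqr_ge0].
by move=> x; have [k k0 k1] := per_rep x; rewrite -(per_int (- k) x p) rmorphN mulNr H// k0 ltW.
Qed.

(** The unknowns are the real and imaginary parts of [V], [V'], [V''] and [Z], in this order; [s]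
    and [t] are those of [lam], and [e] is 1 for [l = 0] and 0 otherwise. The entries involving [q]
    are kept apart in [ode_coef]. *)
Definition ode_rows (s t l2 e : R) : seq (seq R) :=
  [:: [:: 0; 0; 1; 0; 0; 0; 0; 0]; [:: 0; 0; 0; 1; 0; 0; 0; 0];
      [:: 0; 0; 0; 0; 1; 0; 0; 0]; [:: 0; 0; 0; 0; 0; 1; 0; 0];
      [:: s; - t; 0; 0; 0; 0; 1; 0]; [:: t; s; 0; 0; 0; 0; 0; 1];
      [:: l2; 0; 0; 0; 0; 0; - e; 0]; [:: 0; l2; 0; 0; 0; 0; 0; - e]].

Definition ode_coef (i j : nat) : R :=
  if ((i == 4) && (j == 2)) || ((i == 5) && (j == 3)) then -1 else 0.

Definition ode_mx (q : R -> R) (s t l2 e : R) (i j : 'I_8) (x : R) : R :=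
  nth 0 (nth [::] (ode_rows s t l2 e) i) j + ode_coef i j * q x.

(* [V' = u] and [Z = l ^ 2 W] with [W' = V]; when [l = 0] the equation for [Z] is replaced
   by [Z' = - Z], so that the periodic problem stays uniquely solvable. *)
Definition ode_sol (q : R -> R) (lam : R[i]) (l : R) (G V V1 V2 V3 Z : R -> R[i]) :=
  [/\ cderiv V V1, cderiv V1 V2, cderiv V2 V3, ccts V3 &
   [/\ per V, cderiv Z (fun x => (l ^+ 2)%:C * V x - ((l == 0)%:R : R)%:C * Z x), per Z &
      forall x, V3 x + (q x)%:C * V1 x - lam * V x - Z x = G x]].

Lemma ode_sol_Z0 (q : R -> R) (l : R) (lam : R[i]) (G V V1 V2 V3 Z : R -> R[i]) :
  ode_sol q lam l G V V1 V2 V3 Z -> l = 0 -> forall x, Z x = 0.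
Proof.
move=> [_ _ _ _ [_ [DZ1 DZ2] pZ _]] l0 x; apply: complex_eq.
  apply: (@decay_per (fun x => Re (Z x))) => [|y]; last by rewrite pZ.
  by apply: (deriv_extr DZ1) => y; rewrite l0 eqxx !cE /=; ring.
apply: (@decay_per (fun x => Im (Z x))) => [|y]; last by rewrite pZ.
by apply: (deriv_extr DZ2) => y; rewrite l0 eqxx !cE /=; ring.
Qed.

Lemma ode_sol_primZ (q : R -> R) (l : R) (lam : R[i]) (G V V1 V2 V3 Z : R -> R[i]) :
  ode_sol q lam l G V V1 V2 V3 Z -> cderiv Z (fun x => (l ^+ 2)%:C * V x).
Proof.
move=> S; have [_ _ _ _ [_ DZ _ _]] := S.
apply: (cderiv_extr DZ) => x; have [l0|l0] := eqVneq l 0.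
  by rewrite (ode_sol_Z0 S l0) mulr0 subr0.
by rewrite mul0r subr0.
Qed.

(** The kernel result leaves only constants. For [l = 0] the modified equation gives [Z = 0], and
    then [lam V = 0]; otherwise [lam V + Z] vanishes identically, and its derivative is
    [l ^ 2 V]. *)
Lemma ode_sol_trivial (q : R -> R) (d l : R) (lam : R[i]) (V V1 V2 V3 Z : R -> R[i]) :
  admissible q d (l ^+ 2) -> Re lam != 0 -> ode_sol q lam l (fun=> 0) V V1 V2 V3 Z ->
  forall x, [/\ V x = 0, V1 x = 0, V2 x = 0 & Z x = 0].
Proof.
move=> adm sig S; have Z0 := ode_sol_Z0 S; have DZ' := ode_sol_primZ S.
have [D0 D1 D2 c3 [pV DZ pZ E]] := S.
have lam0 : lam != 0 by apply: contraNneq sig => ->.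
have V10 := periodic_kernel adm sig D0 D1 D2 c3 pV DZ' pZ E.
have deriv0 (f g : R -> R[i]) : cderiv f g -> (forall x, f x = 0) -> forall x, g x = 0.
  move=> [F1 F2] f0 x; apply: complex_eq.
    apply: (deriv_fun_unique F1 (h := fun=> 0)).
    by apply: (deriv_ext (deriv_cst 0)) => y //; rewrite f0.
  apply: (deriv_fun_unique F2 (h := fun=> 0)).
  by apply: (deriv_ext (deriv_cst 0)) => y //; rewrite f0.
have V20 := deriv0 _ _ D1 V10; have V30 := deriv0 _ _ D2 V20.
have ZE x : Z x = - lam * V x.
  have := E x; rewrite V30 V10 mulr0 addr0 sub0r => /eqP.
  by rewrite subr_eq0 => /eqP <-; rewrite mulNr.
have V00 x : V x = 0.
  have [l0|l0] := eqVneq l 0.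
    have := ZE x; rewrite Z0// => /esym/eqP; rewrite mulf_eq0 oppr_eq0 (negbTE lam0).
    by move/eqP.
  have D3 : cderiv (fun x => lam * V x + Z x) (fun x => lam * V1 x + (l ^+ 2)%:C * V x).
    by apply: cderivD => //; exact: cderivZ.
  have Z1 y : lam * V y + Z y = 0 by rewrite ZE; ring.
  have := deriv0 _ _ D3 Z1 x; rewrite V10 mulr0 add0r => /eqP.
  rewrite mulf_eq0 => /orP[/eqP h|/eqP//].
  by have /eqP := congr1 (fun z => Re z) h; rewrite sqrf_eq0 (negbTE l0).
by move=> x; split => //; rewrite ZE V00 mulr0.
Qed.

(** The homogeneous system of size 8 has no periodic solution but 0, so the Fredholm alternative
    yields existence and a bound by the supremum of [G]. The constant doubles when the real and
    imaginary parts of [V1] are recombined. *)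
Lemma resolvent_ode (q : R -> R) (d l : R) (lam : R[i]) :
  admissible q d (l ^+ 2) -> Re lam != 0 ->
  exists C, forall (G : R -> R[i]) beta, ccts G -> per G -> (forall x, normc (G x) <= beta) ->
    (exists V V1 V2 V3 Z, ode_sol q lam l G V V1 V2 V3 Z) /\
    (forall V V1 V2 V3 Z, ode_sol q lam l G V V1 V2 V3 Z -> forall x, normc (V1 x) <= C * beta).
Proof.
move=> adm sig.
have [cq pq] : continuous q /\ per q by case: adm => -[].
have [Bq hBq] := per_bounded cq pq.
pose s := Re lam; pose t := Im lam; pose e : R := (l == 0)%:R.
pose M := ode_mx q s t (l ^+ 2) e.
have cM i j : continuous (M i j) by rewrite /M /ode_mx; cts.
have pM i j : per (M i j) by move=> x; rewrite /M /ode_mx pq.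
pose a (i j : 'I_8) := nth 0 (nth [::] (ode_rows s t (l ^+ 2) e) i) j.
pose K := \sum_i \sum_j (`|a i j| + `|ode_coef i j| * Bq).
have Bq0 : 0 <= Bq by exact: le_trans (normr_ge0 _) (hBq 0).
have MK i j x : `|M i j x| <= K.
  apply: (@le_trans _ _ (`|a i j| + `|ode_coef i j| * Bq)).
    by apply: (le_trans (ler_normD _ _)); rewrite lerD2l normrM ler_wpM2l.
  have nn i' j' : 0 <= `|a i' j'| + `|ode_coef i' j'| * Bq by rewrite addr_ge0// mulr_ge0.
  rewrite /K (bigD1 i)//= (bigD1 j)//= -addrA lerDl addr_ge0 ?sumr_ge0//.
  by move=> i' _; rewrite sumr_ge0.
pose o n : 'I_8 := inord n.
have yo (y : 'I_8 -> R -> R) (j : 'I_8) : y j = y (o j) by rewrite /o inord_val.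
have linE (y : 'I_8 -> R -> R) n x : (n < 8)%N -> lin M y (o n) x =
   let m j := nth 0 (nth [::] (ode_rows s t (l ^+ 2) e) n) j + ode_coef n j * q x in
   m 0 * y (o 0) x + m 1 * y (o 1) x + m 2 * y (o 2) x + m 3 * y (o 3) x
   + m 4 * y (o 4) x + m 5 * y (o 5) x + m 6 * y (o 6) x + m 7 * y (o 7) x.
  move=> n8; rewrite /lin /=.
  rewrite -(sum8 (fun j => (nth 0 (nth [::] (ode_rows s t (l ^+ 2) e) n) j
     + ode_coef n j * q x) * y (o j) x)).
  by apply: eq_bigr => j _; rewrite /M /ode_mx inordK// [in LHS](yo y).
pose gb (G : R -> R[i]) (i : 'I_8) (x : R) : R :=
  if i == o 4 then Re (G x) else if i == o 5 then Im (G x) else 0.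
have oE n m : (n < 8)%N -> (m < 8)%N -> (o n == o m) = (n == m).
  by move=> n8 m8; rewrite -val_eqE /= !inordK.
have to_c G y : ccts G -> solves M (gb G) y -> (forall i, per (y i)) ->
  ode_sol q lam l G (fun x => y (o 0) x +i* y (o 1) x) (fun x => y (o 2) x +i* y (o 3) x)
   (fun x => y (o 4) x +i* y (o 5) x)
   (fun x => G x - (q x)%:C * (y (o 2) x +i* y (o 3) x) + lam * (y (o 0) x +i* y (o 1) x)
             + (y (o 6) x +i* y (o 7) x))
   (fun x => y (o 6) x +i* y (o 7) x).
  move=> cG sy py.
  have S n : (n < 8)%N -> deriv_of (y (o n)) (fun x => lin M y (o n) x + gb G (o n) x) by move=> _; exact: sy.
  have cy n : continuous (y (o n)) by exact: deriv_continuous (sy (o n)).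
  have cyc n m : ccts (fun x => y (o n) x +i* y (o m) x) by split; exact: cy.
  have cqc : ccts (fun x => (q x)%:C) by exact: cctsR.
  split.
  - by split; [apply: (deriv_extr (S 0 isT))|apply: (deriv_extr (S 1 isT))] => x;
      rewrite linE//= /gb !oE//= /ode_coef /=; ring.
  - by split; [apply: (deriv_extr (S 2 isT))|apply: (deriv_extr (S 3 isT))] => x;
      rewrite linE//= /gb !oE//= /ode_coef /=; ring.
  - by split; [apply: (deriv_extr (S 4 isT))|apply: (deriv_extr (S 5 isT))] => x;
      rewrite linE//= /gb !oE//= /ode_coef ?cE /= -/s -/t; ring.
  - have := cyc 2 3; have := cyc 0 1; have := cyc 6 7 => ? ? ?.
    by apply: cctsD => //; apply: cctsD; [apply: cctsB => //; apply: cctsM|apply: cctsM => //; exact: ccts_cst].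
  - split.
    + by move=> x; rewrite !py.
    + by split; [apply: (deriv_extr (S 6 isT))|apply: (deriv_extr (S 7 isT))] => x;
        rewrite linE//= /gb !oE//= /ode_coef ?cE /= -/e; ring.
    + by move=> x; rewrite !py.
    + by move=> x; ring.
pose yv (V V1 V2 Z : R -> R[i]) (i : 'I_8) (x : R) : R := nth 0 [:: Re (V x); Im (V x);
   Re (V1 x); Im (V1 x); Re (V2 x); Im (V2 x); Re (Z x); Im (Z x)] i.
have yvE V V1 V2 Z n x : (n < 8)%N -> yv V V1 V2 Z (o n) x = nth 0 [:: Re (V x); Im (V x);
   Re (V1 x); Im (V1 x); Re (V2 x); Im (V2 x); Re (Z x); Im (Z x)] n.
  by move=> n8; rewrite /yv inordK.
have to_r G V V1 V2 V3 Z : ode_sol q lam l G V V1 V2 V3 Z ->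
    solves M (gb G) (yv V V1 V2 Z) /\ forall i, per (yv V V1 V2 Z i).
  move=> [[d0r d0i] [d1r d1i] [d2r d2i] _ [pV [dzr dzi] pZ E]].
  have pV1 : per V1 by exact: cper_deriv (conj d0r d0i) pV.
  have pV2 : per V2 by exact: cper_deriv (conj d1r d1i) pV1.
  split; last by move=> i x; rewrite /yv pV pV1 pV2 pZ.
  have V3E x : V3 x = G x - (q x)%:C * V1 x + lam * V x + Z x by rewrite -(E x); ring.
  suff S n : (n < 8)%N -> deriv_of (yv V V1 V2 Z (o n)) (fun x => lin M (yv V V1 V2 Z) (o n) x + gb G (o n) x).
    by move=> i; have := S i (ltn_ord i); rewrite /o inord_val.
  have ext r f g : (r < 8)%N -> deriv_of f g -> (forall x, f x = yv V V1 V2 Z (o r) x) ->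
     g =1 (fun x => lin M (yv V V1 V2 Z) (o r) x + gb G (o r) x) ->
     deriv_of (yv V V1 V2 Z (o r)) (fun x => lin M (yv V V1 V2 Z) (o r) x + gb G (o r) x).
    by move=> _ D fE gE; exact: (deriv_ext D fE gE).
  case: n => [|[|[|[|[|[|[|[|//]]]]]]]] _.
  - by apply: (ext _ _ _ _ d0r) => // x; rewrite ?yvE// linE// !yvE//= /gb !oE//= /ode_coef /=; ring.
  - by apply: (ext _ _ _ _ d0i) => // x; rewrite ?yvE// linE// !yvE//= /gb !oE//= /ode_coef /=; ring.
  - by apply: (ext _ _ _ _ d1r) => // x; rewrite ?yvE// linE// !yvE//= /gb !oE//= /ode_coef /=; ring.
  - by apply: (ext _ _ _ _ d1i) => // x; rewrite ?yvE// linE// !yvE//= /gb !oE//= /ode_coef /=; ring.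
  - apply: (ext _ _ _ _ d2r) => // x; rewrite ?yvE// linE// !yvE//= /gb !oE//= /ode_coef /=.
    by rewrite V3E !cE /= -/s -/t; ring.
  - apply: (ext _ _ _ _ d2i) => // x; rewrite ?yvE// linE// !yvE//= /gb !oE//= /ode_coef /=.
    by rewrite V3E !cE /= -/s -/t; ring.
  - apply: (ext _ _ _ _ dzr) => // x; rewrite ?yvE// linE// !yvE//= /gb !oE//= /ode_coef /=.
    by rewrite !cE /= -/e; ring.
  - apply: (ext _ _ _ _ dzi) => // x; rewrite ?yvE// linE// !yvE//= /gb !oE//= /ode_coef /=.
    by rewrite !cE /= -/e; ring.
have H0 y : solves M (fun _ _ => 0) y -> (forall i, per (y i)) -> forall i x, y i x = 0.
  move=> sy py i x.
  have gb0 : gb (fun=> 0) = fun _ _ => 0.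
    by apply/funext => j; apply/funext => z; rewrite /gb; case: ifP => // _; case: ifP.
  have sol := to_c (fun=> 0) y (ccts_cst 0); rewrite gb0 in sol.
  have [a1 a2 a3 a4] := ode_sol_trivial adm sig (sol sy py) x.
  rewrite (yo y i).
  have : (i < 8)%N by exact: ltn_ord.
  case: (nat_of_ord i) => [|[|[|[|[|[|[|[|//]]]]]]]] _;
    by [case: a1|case: a2|case: a3|case: a4].
have [C hC] := periodic_linear_system cM MK pM H0.
exists (2 * C) => G beta cG pG Gb.
have beta0 : 0 <= beta by exact: le_trans (normc_ge0 _) (Gb 0).
have [cG1 cG2] := cG.
have g1 i : continuous (gb G i).
  have -> : gb G i = if i == o 4 then (fun x => Re (G x)) else
      if i == o 5 then (fun x => Im (G x)) else fun=> 0.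
    by apply/funext => x; rewrite /gb; case: (i == o 4) => //; case: (i == o 5).
  by case: (i == o 4); [exact: cG1|case: (i == o 5); [exact: cG2|exact: cts_cst]].
have g2 i : per (gb G i) by move=> x; rewrite /gb pG.
have g3 i x : `|gb G i x| <= beta.
  rewrite /gb; case: ifP => _; first exact: le_trans (normr_Re _) (Gb x).
  case: ifP => _; last by rewrite normr0.
  exact: le_trans (normr_Im _) (Gb x).
have [[y sy py] bd] := hC (gb G) beta g1 g2 g3 beta0.
split; first by do 5 eexists; exact: to_c cG sy py.
move=> V V1 V2 V3 Z sol x; have [sv pv] := to_r _ _ _ _ _ _ sol.
apply: (le_trans (normc_le _)).
have h1 := bd _ sv pv (o 2) x; have h2 := bd _ sv pv (o 3) x.
rewrite yvE//= in h1; rewrite yvE//= in h2.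
by have -> : 2 * C * beta = C * beta + C * beta by [ring|]; exact: lerD.
Qed.

End ResolventODE.

(** * Weak derivatives *)

Section SmoothStep.
Context {R : realType}.
Implicit Types (f g : R -> R).

Fixpoint ndiff (n : nat) f : Prop :=
  if n is n'.+1 then exists2 g, deriv_of f g & ndiff n' g else True.

Definition smooth f := forall n, ndiff n f.

Lemma ndiffS n f : ndiff n.+1 f -> ndiff n f.
Proof.
elim: n f => [//|n IH] f [g Df [h Dg H]].
by exists g => //; apply: IH; exists h.
Qed.

Lemma ndiffD n f g : ndiff n f -> ndiff n g -> ndiff n (fun x => f x + g x).
Proof.
elim: n f g => [//|n IH] f g [f' Df Hf] [g' Dg Hg].
by exists (fun x => f' x + g' x); [exact: derivD|exact: IH].
Qed.

Lemma ndiffM n f g : ndiff n f -> ndiff n g -> ndiff n (fun x => f x * g x).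
Proof.
elim: n f g => [//|n IH] f g Hf Hg.
have Hf0 := ndiffS Hf; have Hg0 := ndiffS Hg.
case: Hf Hg => [f' Df Hf] [g' Dg Hg].
by exists (fun x => f' x * g x + f x * g' x); [exact: derivM|apply: ndiffD; exact: IH].
Qed.

Lemma ndiff_cst n (c : R) : ndiff n (fun=> c).
Proof. by elim: n c => [//|n IH] c; exists (fun=> 0); [exact: deriv_cst|]. Qed.

Lemma ndiff_affine n f (a b : R) : ndiff n f -> ndiff n (fun x => f (a * x + b)).
Proof.
elim: n f => [//|n IH] f [g Df Hg].
exists (fun x => a * g (a * x + b)).
  have D : deriv_of (fun x => a * x + b) (fun=> a) by deriv; ring.
  by apply: (deriv_extr (deriv_comp Df D)) => x; rewrite mulrC.
by apply: ndiffM; [exact: ndiff_cst|exact: IH].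
Qed.

Lemma ndiff_ext n f g : f =1 g -> ndiff n f -> ndiff n g.
Proof. by move=> /funext ->. Qed.

Lemma deriv_derive1 f g : deriv_of f g -> derive1 f = g.
Proof. by move=> D; apply/funext => x; rewrite derive1E; have [_] := D x. Qed.

Lemma smooth_derive1n f n x : smooth f -> derivable (derive1n n f) x 1.
Proof.
move=> Hf; suff : ndiff 1 (derive1n n f) by case=> g Dg _; have [] := Dg x.
have : ndiff n.+1 f by [].
elim: n f {Hf} => [//|n IH] f [g Dg Hg].
by rewrite derive1Sn (deriv_derive1 Dg); exact: IH.
Qed.

(** Raise [y / n <= expR (y / n)] to the power [n]. *)
Lemma pow_le_exp n : exists2 C : R, 0 <= C & forall y, 0 <= y -> y ^+ n <= C * expR y.
Proof.
case: n => [|n].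
  exists 1 => // y y0; rewrite expr0 mul1r -expR0 ler_expR//.
exists (n.+1%:R ^+ n.+1) => [|y y0]; first exact: exprn_ge0.
have n0 : (n.+1%:R : R) != 0 by rewrite pnatr_eq0.
have h : y / n.+1%:R <= expR (y / n.+1%:R).
  by apply: (le_trans _ (expR_ge1Dx _)); rewrite lerDr.
have h2 : (y / n.+1%:R) ^+ n.+1 <= expR (y / n.+1%:R) ^+ n.+1.
  by rewrite ler_pXn2r// nnegrE ?divr_ge0// expR_ge0.
rewrite -expRM_natl mulrCA divff// mulr1 in h2.
have -> : y ^+ n.+1 = n.+1%:R ^+ n.+1 * (y / n.+1%:R) ^+ n.+1.
  by rewrite -exprMn mulrCA divff// mulr1.
by rewrite ler_wpM2l// exprn_ge0.
Qed.

Lemma poly_le_exp (p : {poly R}) : exists2 C : R, 0 <= C &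
  forall y, 0 <= y -> `|p.[y]| <= C * expR y.
Proof.
have H n : exists C : R, 0 <= C /\ forall y, 0 <= y -> y ^+ n <= C * expR y.
  by have [C ? ?] := pow_le_exp n; exists C.
have /choice[C hC] := H.
exists (\sum_(i < size p) `|p`_i| * C i).
  by apply: sumr_ge0 => i _; rewrite mulr_ge0//; have [] := hC i.
move=> y y0; rewrite horner_coef; apply: (le_trans (ler_norm_sum _ _ _)).
rewrite mulr_suml; apply: ler_sum => i _.
rewrite normrM -mulrA ler_wpM2l// ger0_norm ?exprn_ge0//.
by have [_] := hC i; apply.
Qed.

(** The functions [p (1 / x) exp (- 1 / x)], extended by 0, form a class closed under
    differentiation: [p] becomes [X ^ 2 (p - p')]. This makes all of them smooth by a single
    induction. *)
Definition flat (p : {poly R}) (x : R) : R :=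
  if 0 < x then p.[x^-1] * expR (- x^-1) else 0.

Lemma flat_quadratic p : exists C, forall x, `|flat p x| <= C * x ^+ 2.
Proof.
have [C C0 hC] := poly_le_exp (p * 'X^2).
exists C => x; rewrite /flat; case: ltP => x0; last by rewrite normr0 mulr_ge0// sqr_ge0.
have xV : 0 <= x^-1 by rewrite invr_ge0 ltW.
have := hC _ xV; rewrite hornerM hornerXn normrM [`|_ ^+ 2|]ger0_norm ?exprn_ge0// => h.
rewrite normrM [`|expR _|]ger0_norm ?expR_ge0// expRN ler_pdivrMr ?expR_gt0//.
have x2 : 0 < x ^+ 2 by rewrite exprn_gt0.
rewrite -(ler_pM2r (_ : 0 < x^-1 ^+ 2)) ?exprn_gt0 ?invr_gt0//.
apply: (le_trans h); rewrite le_eqVlt; apply/orP; left; apply/eqP.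
have xn : x != 0 by rewrite gt_eqF.
by field.
Qed.

(** The slope [f z / z] is at most [|C| * |z|], hence continuous at 0; the convention [0 / 0 = 0]
    supplies its value there. *)
Lemma deriv0_quadratic f C : f 0 = 0 -> (forall x, `|f x| <= C * x ^+ 2) ->
  is_derive (0 : R) (1 : R) f 0.
Proof.
move=> f0 fC; apply/is_derive1_caratheodory.
exists (fun z => f z / z); split.
- move=> z; rewrite f0 !subr0; have [->|zn] := eqVneq z 0; first by rewrite f0 mulr0.
  by rewrite mulfVK.
- rewrite /prop_for /continuous_at /= f0 mul0r; apply/cvgrPdist_lt => e e0.
  have K0 : 0 < `|C| + 1 by rewrite ltr_wpDl.
  near=> z; rewrite sub0r normrN.
  have [->|zn] := eqVneq z 0; first by rewrite f0 mul0r normr0.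
  have zp : 0 < `|z| by rewrite normr_gt0.
  rewrite normrM normfV ltr_pdivrMr//; apply: (le_lt_trans (fC z)).
  rewrite -(real_normK (num_real z)) expr2 mulrA ltr_pM2r//.
  apply: (@le_lt_trans _ _ ((`|C| + 1) * `|z|)).
    by rewrite ler_wpM2r//; apply: (le_trans (ler_norm _)); rewrite lerDl.
  rewrite mulrC -ltr_pdivlMr//; near: z.
  exists (e / (`|C| + 1)); first by rewrite /= divr_gt0.
  by move=> z /=; rewrite sub0r normrN.
- by rewrite f0 mul0r.
Unshelve. all: by end_near. Qed.

Lemma deriv_flat p : deriv_of (flat p) (flat ('X^2 * (p - p^`()))).
Proof.
move=> x; have [x0|x0|x0] := ltgtP x 0.
- have -> : flat ('X^2 * (p - p^`())) x = 0 by rewrite /flat ltNge (ltW x0).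
  apply: (@near_eq_is_derive _ _ _ (cst 0)).
  near=> z; rewrite /flat ltNge ltW//; near: z; exact: lt_nbhsl.
- have xn : x != 0 by rewrite gt_eqF.
  have -> : flat ('X^2 * (p - p^`())) x = ('X^2 * (p - p^`())).[x^-1] * expR (- x^-1).
    by rewrite /flat x0.
  have DV : is_derive x (1 : R) (fun z => z^-1) (- x ^- 2).
    by apply: is_derive_eq; [exact: (@is_deriveV _ id x 1 1)|rewrite /GRing.scale /= mulr1].
  have Dp : is_derive x (1 : R) (fun z => p.[z^-1]) (p^`().[x^-1] * - x ^- 2).
    exact: (@is_derive1_comp _ (horner p) (fun z => z^-1)).
  have DN : is_derive x (1 : R) (fun z => - z^-1) (x ^- 2).
    by apply: is_derive_eq; rewrite opprK.
  have De : is_derive x (1 : R) (fun z => expR (- z^-1)) (expR (- x^-1) * x ^- 2).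
    exact: (@is_derive1_comp _ expR (fun z => - z^-1)).
  have DM : is_derive x (1 : R) (fun z => p.[z^-1] * expR (- z^-1))
      (('X^2 * (p - p^`())).[x^-1] * expR (- x^-1)).
    have := is_deriveM Dp De.
    move=> h; apply: (is_derive_eq h).
    by rewrite /GRing.scale /= hornerM hornerXn hornerD hornerN exprVn; ring.
  apply: (near_eq_is_derive _ DM).
  near=> z; rewrite /flat; suff -> : 0 < z by [].
  by near: z; exact: lt_nbhsr.
- rewrite x0.
  have -> : flat ('X^2 * (p - p^`())) 0 = 0 by rewrite /flat ltxx.
  have [C hC] := flat_quadratic p.
  by apply: deriv0_quadratic hC; rewrite /flat ltxx.
Unshelve. all: by end_near. Qed.

Lemma ndiff_flat n p : ndiff n (flat p).
Proof. by elim: n p => [//|n IH] p; exists (flat ('X^2 * (p - p^`()))); [exact: deriv_flat|]. Qed.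

(** The normalised primitive of the bump [flat 1 x * flat 1 (1 - x)], which is supported in the unit
    interval. *)
Lemma smooth_step : exists S rho : R -> R,
  [/\ smooth S, deriv_of S rho, continuous rho,
      (forall x, x <= 0 -> S x = 0) & (forall x, 1 <= x -> S x = 1)] /\
  [/\ (forall x, 0 <= S x <= 1), (forall x, x <= 0 -> rho x = 0),
      (forall x, 1 <= x -> rho x = 0) & exists B, forall x, `|rho x| <= B].
Proof.
pose r x := flat 1 x * flat 1 (1 - x).
have smr n : ndiff n r.
  apply: ndiffM; first exact: ndiff_flat.
  by apply: (@ndiff_ext n (fun x => flat 1 (-1 * x + 1))) => [x|]; [congr flat; ring|apply: ndiff_affine; exact: ndiff_flat].
have cr : continuous r by have [g Dg _] := smr 1; exact: deriv_continuous Dg.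
have flat0 x : x <= 0 -> flat 1 x = 0 by rewrite /flat ltNge => ->.
have flat_ge0 x : 0 <= flat 1 x.
  by rewrite /flat; case: ifP => // _; rewrite hornerC mul1r expR_ge0.
have flat_gt0 x : 0 < x -> 0 < flat 1 x.
  by rewrite /flat => ->; rewrite hornerC mul1r expR_gt0.
have r0 x : x <= 0 -> r x = 0 by move=> x0; rewrite /r flat0// mul0r.
have r1 x : 1 <= x -> r x = 0 by move=> x1; rewrite /r [flat 1 (1 - x)]flat0 ?mulr0// subr_le0.
have rge0 x : 0 <= r x by rewrite /r mulr_ge0.
have DP := deriv_prim cr.
pose c := prim r 1.
have mono x y : x <= y -> prim r x <= prim r y.
  by move=> xy; apply: (deriv_nondecreasing DP).
have P0 x : x <= 0 -> prim r x = 0.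
  move=> x0; apply/eqP; rewrite eq_le; apply/andP; split; first by rewrite -(prim0 r) mono.
  rewrite -oppr_le0 -(prim0 r) -[leLHS]add0r -[X in X - _](prim0 r).
  rewrite lerBlDr prim0 add0r.
  have D1 : deriv_of (fun x => - prim r x) (fun x => - r x) by exact: derivN.
  have := deriv_nondecreasing D1 (a := x) (b := 0).
  rewrite prim0 oppr0 oppr_le0; apply => //.
  by move=> y /andP[_ y0]; rewrite r0 ?oppr0.
have P1 x : 1 <= x -> prim r x = c.
  move=> x1; apply/eqP; rewrite eq_le; apply/andP; split; last exact: mono.
  have D1 : deriv_of (fun x => - prim r x) (fun x => - r x) by exact: derivN.
  have := deriv_nondecreasing D1 (a := 1) (b := x).
  rewrite lerN2; apply => //.
  by move=> y /andP[y1 _]; rewrite r1 ?oppr0.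
(* Otherwise the primitive vanishes on the unit interval, and so does the bump at 1/2, where it is
   positive. *)
have c0 : 0 < c.
  rewrite lt_neqAle; apply/andP; split; last by rewrite -(prim0 r) mono.
  apply/eqP => cz.
  have Z x : 0 <= x <= 1 -> prim r x = 0.
    move=> /andP[x0 x1]; apply/eqP; rewrite eq_le; apply/andP; split.
      by rewrite [leRHS]cz; exact: mono.
    by rewrite -(prim0 r); exact: mono.
  have : r (2^-1) = 0.
    have [_ <-] := DP (2^-1); apply: derive_val.
    apply: (@near_eq_is_derive _ _ _ (cst 0)).
    near=> z; rewrite Z//; apply/andP; split; near: z.
      by have : 0 < 2^-1 :> R by [lra|]; move/lt_nbhsr; apply: filterS => z /ltW.
    by apply: lt_le_nbhsl; lra.
  by apply/eqP; rewrite gt_eqF// /r mulr_gt0// flat_gt0//; lra.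
exists (fun x => c^-1 * prim r x), (fun x => c^-1 * r x).
have DS : deriv_of (fun x => c^-1 * prim r x) (fun x => c^-1 * r x) by deriv; ring.
split; split.
- by move=> [//|n]; exists (fun x => c^-1 * r x) => //; apply: ndiffM; [exact: ndiff_cst|].
- exact: DS.
- by cts.
- by move=> x x0; rewrite P0// mulr0.
- by move=> x x1; rewrite P1// mulVf// gt_eqF.
- move=> x; rewrite mulrC divr_ge0 ?(ltW c0)//=; last first.
    by have [x0|/ltW x0] := leP x 0; [rewrite P0|rewrite -(prim0 r) mono].
  rewrite ler_pdivrMr// mul1r.
  by have [x1|/ltW x1] := leP 1 x; [rewrite P1|rewrite mono].
- by move=> x x0; rewrite r0// mulr0.
- by move=> x x1; rewrite r1// mulr0.
- have [d _ hd] := @EVT_max R r 0 1 ler01 (continuous_subspaceT cr).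
  exists (c^-1 * r d) => x; rewrite normrM gtr0_norm ?invr_gt0// ger0_norm//.
  apply: ler_wpM2l; first by rewrite invr_ge0 ltW.
  have [x0|/ltW x0] := leP x 0; first by rewrite r0.
  have [x1|/ltW x1] := leP 1 x; first by rewrite [leLHS]r1.
  by apply: hd; rewrite in_itv/= x0.
Unshelve. all: by end_near. Qed.

End SmoothStep.

(** * Locally integrable functions and du Bois-Reymond's lemma *)

Section LocallyIntegrable.
Context {R : realType}.
Implicit Types (f g h phi : R -> R) (a b x y M : R).
Notation mu := (@lebesgue_measure R).

Lemma itv_cover x : exists n : nat, `[- n%:R, n%:R]%classic x.
Proof.
have xr : 0 <= `|x| by [].
have H := archi_boundP xr; exists (Num.bound `|x|) => /=.
by rewrite in_itv /= -ler_norml ltW.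
Qed.

Lemma locint_measurable f : locint f -> measurable_fun setT f.
Proof.
move=> lf; have -> : [set: R] = \bigcup_n `[- n%:R, n%:R]%classic.
  by apply/seteqP; split=> // x _; have [n] := itv_cover x; exists n.
apply/measurable_fun_bigcup => // n.
by have /measurable_int/measurable_EFinP := lf (- n%:R) n%:R.
Qed.

Lemma compact_sub_itv (K : set R) : compact K -> exists M, K `<=` `[- M, M].
Proof.
move=> /compact_bounded[M [_ H]]; exists (M + 1) => x Kx.
by rewrite /= in_itv /= -ler_norml; apply: H => //; rewrite ltrDl.
Qed.

Lemma locint_locally f : locint f -> locally_integrable setT f.
Proof.
move=> lf; split; [exact: locint_measurable|exact: openT|move=> K _ cK].
have [M KM] := compact_sub_itv cK.
have /integrableP[] // : mu.-integrable K (EFin \o f).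
by apply: integrableS (lf (- M) M) => //; exact: compact_measurable.
Qed.

Lemma locintD f g : locint f -> locint g -> locint (fun x => f x + g x).
Proof. by move=> lf lg a b; exact: (integrableD _ (lf a b) (lg a b)). Qed.

Lemma locintB f g : locint f -> locint g -> locint (fun x => f x - g x).
Proof. by move=> lf lg a b; exact: (integrableB _ (lf a b) (lg a b)). Qed.

Lemma locintM f g : locint f -> continuous g -> locint (fun x => f x * g x).
Proof.
move=> lf cg a b; apply: (@integrableMl _ _ R mu `[a, b] _ (EFin \o f) g) => //.
  by apply: measurable_funTS; exact: continuous_measurable_fun.
have /compact_bounded[M [Mr H]] : compact (g @` `[a, b]).
  by apply: continuous_compact; [exact: continuous_subspaceT|exact: segment_compact].
by exists M; split=> // N MN x abx; apply: H => //; exists x.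
Qed.

Lemma locintZ c f : locint f -> locint (fun x => c * f x).
Proof.
move=> lf; have -> : (fun x => c * f x) = (fun x => f x * c) by apply/funext => x; rewrite mulrC.
by apply: locintM => //; exact: cts_cst.
Qed.

Lemma locint_norm f : locint f -> locint (fun x => `|f x|).
Proof. by move=> lf a b; exact: (integrable_abse (lf a b)). Qed.

Lemma Rintegral_subset f a b M : locint f -> (forall x, 0 <= f x) ->
  - M <= a -> a <= b -> b <= M ->
  \int[mu]_(t in `[a, b]) f t <= \int[mu]_(t in `[- M, M]) f t.
Proof.
move=> lf f0 Ma ab bM.
rewrite (Rintegral_chasles lf Ma (le_trans ab bM)) (Rintegral_chasles lf ab bM).
have P c d : 0 <= \int[mu]_(t in `[c, d]) f t by apply: Rintegral_ge0.
by rewrite -[leLHS]add0r lerD// lerDl.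
Qed.

Lemma norm_primB f a b : locint f -> a <= b ->
  `|prim f b - prim f a| <= \int[mu]_(t in `[a, b]) `|f t|.
Proof. by move=> lf ab; rewrite primB//; exact: le_normr_Rintegral. Qed.

Lemma norm_prim f M x : locint f -> - M <= x <= M ->
  `|prim f x| <= \int[mu]_(t in `[- M, M]) `|f t|.
Proof.
move=> lf /andP[Mx xM]; have ln := locint_norm lf.
have M0 : 0 <= M by lra.
have [x0|/ltW x0] := leP 0 x.
  have := norm_primB lf x0; rewrite prim0 subr0 => /le_trans; apply.
  by apply: Rintegral_subset => //; lra.
have := norm_primB lf x0; rewrite prim0 sub0r normrN => /le_trans; apply.
by apply: Rintegral_subset => //; lra.
Qed.

Lemma primD f g x : locint f -> locint g ->
  prim (fun x => f x + g x) x = prim f x + prim g x.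
Proof.
move=> lf lg; rewrite /prim; case: (leP 0 x) => _; first by rewrite RintegralD.
by rewrite RintegralD// opprD.
Qed.

Lemma primZ c f x : locint f -> prim (fun x => c * f x) x = c * prim f x.
Proof.
move=> lf; rewrite /prim; case: (leP 0 x) => _; first by rewrite RintegralZl.
by rewrite RintegralZl// mulrN.
Qed.

Lemma prim_sub f g x : locint f -> locint g ->
  prim (fun x => f x - g x) x = prim f x - prim g x.
Proof.
move=> lf lg; rewrite /prim; case: (leP 0 x) => _; first by rewrite RintegralB.
by rewrite RintegralB// opprB opprK addrC.
Qed.

Lemma prim_bounded_cts f M : locint f -> {within `[- M, M], continuous (prim f)}.
Proof.
move=> lf; have [M0|M0] := ltP M 0.
  by rewrite set_itv_ge ?bnd_simp -?ltNge; [exact: continuous_subspace0|lra].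
have H : {within `[- M, M], continuous (fun x => \int[mu]_(t in `[- M, x]) f t)}.
  by apply: parameterized_integral_continuous => //; lra.
have H2 : {within `[- M, M], continuous (fun x => \int[mu]_(t in `[- M, x]) f t + prim f (- M))}.
  by move=> x; apply: cvgD; [exact: H|exact: cvg_cst].
apply: subspace_eq_continuous H2 => x; rewrite inE /= in_itv /= => /andP[Mx xM].
by have E := primB lf Mx; rewrite /from_subspace -E subrK.
Qed.

Lemma prim_cts f : locint f -> continuous (prim f).
Proof.
move=> lf x; have H := @prim_bounded_cts f (`|x| + 1) lf.
have xx : - (`|x| + 1) < `|x| + 1 by have := normr_ge0 x; lra.
have [+ _ _] := (continuous_within_itvP (prim f : R -> R^o) xx).1 H; apply.
by rewrite in_itv /=; have := ler_norm x; have := ler_norm (- x); rewrite normrN; lra.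
Qed.

Lemma approx_cts f M e : locint f -> 0 < e ->
  exists2 g, continuous g & \int[mu]_(t in `[- M, M]) `|f t - g t| < e.
Proof.
move=> lf e0; pose D : set R := `[- M, M]%classic; have mM : measurable D by exact: measurable_itv.
have fM : (mu D < +oo)%E.
  by apply: compact_finite_measure; exact: segment_compact.
have [g [cg ig /fine_cvgP[_ /cvgrPdist_lt/(_ _ e0)[n _ H]]]] :=
  approximation_continuous_integrable mM fM (lf (- M) M).
exists (g n) => //; have := H n (leqnn n); rewrite sub0r normrN /= => /(le_lt_trans _); apply.
exact: ler_norm.
Qed.

Lemma RintegralT h M : (forall x, M < `|x| -> h x = 0) ->
  \int[mu]_(x in setT) h x = \int[mu]_(x in `[- M, M]) h x.
Proof.
move=> h0; rewrite [RHS]Rintegral_mkcond; apply: eq_Rintegral => x _.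
rewrite patchE; case: ifPn => // /negP; rewrite inE /= in_itv /= -ler_norml => /negP.
by rewrite -ltNge; exact: h0.
Qed.

Lemma cts_bounded f M : continuous f -> exists2 B, 0 <= B & forall x, - M <= x <= M -> `|f x| <= B.
Proof.
move=> cf; have /compact_bounded[B [Br H]] : compact (f @` `[- M, M]).
  by apply: continuous_compact; [exact: continuous_subspaceT|exact: segment_compact].
exists (Num.max 0 (B + 1)) => [|x xM]; first by rewrite le_max lexx.
by rewrite le_max; apply/orP; right; apply: (H (B + 1)); [rewrite ltrDl|exists x].
Qed.

(** For continuous [g] this is the product rule. In general [g] is approximated by a continuous
    function in the L1 norm on the interval, and the sum of the two sides moves by at most
    [K = 2 * M * B' + B] times the error. *)
Lemma prim_parts g phi phi' M : locint g -> deriv_of phi phi' -> continuous phi' ->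
  0 <= M -> phi M = 0 -> phi (- M) = 0 ->
  \int[mu]_(x in `[- M, M]) (prim g x * phi' x) =
  - \int[mu]_(x in `[- M, M]) (g x * phi x).
Proof.
move=> lg D cp' M0 pM pM'; have MM : - M <= M by lra.
have cp := deriv_continuous D.
have [B B0 Hp] := cts_bounded M cp; have [B' B0' Hp'] := cts_bounded M cp'.
apply/eqP; rewrite -subr_eq0 opprK -normr_le0; apply/ler_addgt0Pr => e e0.
rewrite add0r; pose K := 2 * M * B' + B.
have K0 : 0 <= K by rewrite addr_ge0// mulr_ge0// mulr_ge0.
have [g1 cg1 Hg1] := approx_cts M lg (divr_gt0 e0 (ltr_wpDl K0 ltr01)).
have lg1 := continuous_locint cg1.
have ld := locintB lg lg1.
have lp' := continuous_locint cp'.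
have lpg : locint (prim g) by exact: (continuous_locint (prim_cts lg)).
have lpg1 : locint (prim g1) by exact: (continuous_locint (prim_cts lg1)).
set A := \int[mu]_(t in _) `|_| in Hg1.
have A0 : 0 <= A by apply: Rintegral_ge0.
have parts : \int[mu]_(x in `[- M, M]) (prim g1 x * phi' x) +
    \int[mu]_(x in `[- M, M]) (g1 x * phi x) = 0.
  rewrite -RintegralD//; [|exact: locintM|exact: locintM].
  have Dp := deriv_prim cg1.
  have DD : deriv_of (fun x => prim g1 x * phi x) (fun x => prim g1 x * phi' x + g1 x * phi x).
    by apply: (deriv_extr (derivM Dp D)) => x; rewrite addrC.
  have cc : continuous (fun x => prim g1 x * phi' x + g1 x * phi x).
    by apply: ctsD; apply: ctsM => //; exact: deriv_continuous Dp.
  rewrite -primB//; last exact: continuous_locint.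
  by rewrite !(primE _ DD cc) pM pM' !mulr0 subrr.
have -> : \int[mu]_(x in `[- M, M]) (prim g x * phi' x) +
    \int[mu]_(x in `[- M, M]) (g x * phi x) =
    \int[mu]_(x in `[- M, M]) (prim (fun x => g x - g1 x) x * phi' x) +
    \int[mu]_(x in `[- M, M]) ((g x - g1 x) * phi x).
  have -> : \int[mu]_(x in `[- M, M]) (prim (fun x => g x - g1 x) x * phi' x) =
     \int[mu]_(x in `[- M, M]) (prim g x * phi' x) - \int[mu]_(x in `[- M, M]) (prim g1 x * phi' x).
    rewrite -RintegralB//; [|exact: locintM|exact: locintM].
    by apply: eq_Rintegral => x _; rewrite prim_sub// mulrBl.
  have -> : \int[mu]_(x in `[- M, M]) ((g x - g1 x) * phi x) =
     \int[mu]_(x in `[- M, M]) (g x * phi x) - \int[mu]_(x in `[- M, M]) (g1 x * phi x).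
    rewrite -RintegralB//; [|exact: locintM|exact: locintM].
    by apply: eq_Rintegral => x _; rewrite mulrBl.
  have gen (p q r s : R) : r + s = 0 -> p + q = (p - r) + (q - s) by lra.
  exact: gen parts.
apply: le_trans (ler_normD _ _) _.
have cpd := prim_cts ld.
have T1 : `|\int[mu]_(x in `[- M, M]) (prim (fun x => g x - g1 x) x * phi' x)| <= 2 * M * B' * A.
  apply: le_trans (le_normr_Rintegral _ _) _ => //.
    by apply: (locintM (continuous_locint cpd)).
  have -> : 2 * M * B' * A = \int[mu]_(x in `[- M, M]) (A * B').
    rewrite Rintegral_cst//= lebesgue_measure_itv /= lte_fin.
    case: ifP => [_|/negbT]; first by rewrite -EFinB /=; ring.
    by rewrite -leNgt => ?; have -> : M = 0; [lra|rewrite /=; ring].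
  apply: le_Rintegral => //.
  - by apply: locint_norm; apply: (locintM (continuous_locint cpd)).
  - exact: (continuous_locint (@cts_cst R _)).
  - move=> x; rewrite /= in_itv /= => xM; rewrite normrM ler_pM//.
      exact: norm_prim.
    exact: Hp'.
have T2 : `|\int[mu]_(x in `[- M, M]) ((g x - g1 x) * phi x)| <= B * A.
  apply: le_trans (le_normr_Rintegral _ _) _ => //.
    exact: locintM.
  rewrite /A -RintegralZl//; last exact: locint_norm.
  apply: le_Rintegral => //.
  - by apply: locint_norm; exact: locintM.
  - by apply: locintZ; exact: locint_norm.
  - by move=> x; rewrite /= in_itv /= => xM; rewrite normrM mulrC ler_wpM2r// Hp.
have : K * A <= e.
  have : A * (K + 1) < e by rewrite -ltr_pdivlMr// ltr_wpDl.
  by move: A0; clear; nra.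
rewrite /K; move: T1 T2; clear; lra.
Qed.

(** The rescaled [rho] has integral 1 over [[c, c + r / 2]], which lies inside the ball of radius
    [r], and is bounded by [2 * B / r]. Against the average over a ball of length [2 * r] this is
    the factor [4 * B]. *)
Lemma lebesgue_pt_step h (c r : R) S rho (B : R) : locint h -> 0 < r ->
  deriv_of S rho -> continuous rho -> S 0 = 0 -> S 1 = 1 -> (forall x, `|rho x| <= B) ->
  (`|\int[mu]_(x in `[c, c + r / 2]) (h x * (2 / r * rho (2 / r * (x - c)))) - h c|%:E
    <= (4 * B)%:E * davg h c r)%E.
Proof.
move=> lh r0 D crho S0 S1 HB; pose k := 2 / r.
have k0 : 0 < k by exact: divr_gt0.
have B0 : 0 <= B by apply: le_trans (HB 0).
pose w x := k * rho (k * (x - c)).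
have cw : continuous w by apply: ctsM; [exact: cts_cst|apply: cts_comp => //; cts].
have Dw : deriv_of (fun x => S (k * (x - c))) w.
  have Da : deriv_of (fun x => k * (x - c)) (fun=> k) by deriv; ring.
  by apply: (deriv_extr (deriv_comp D Da)) => x; rewrite mulrC.
have cc : c <= c + r / 2 by rewrite lerDl divr_ge0// ltW.
have w1 : \int[mu]_(x in `[c, c + r / 2]) w x = 1.
  rewrite -primB//; last exact: continuous_locint.
  rewrite !(primE _ Dw cw) (_ : k * (c + r / 2 - c) = 1); last first.
    by rewrite /k; field; rewrite gt_eqF.
  by rewrite subrr mulr0 S0 S1; lra.
pose D0 : set R := ball c r.
have lc : locint (fun x => h x - h c).
  by apply: locintB => //; apply: continuous_locint; exact: cts_cst.
have -> : \int[mu]_(x in `[c, c + r / 2]) (h x * w x) - h c =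
   \int[mu]_(x in `[c, c + r / 2]) ((h x - h c) * w x).
  have lw := continuous_locint cw.
  have -> : h c = \int[mu]_(x in `[c, c + r / 2]) (h c * w x).
    by rewrite RintegralZl// w1 mulr1.
  rewrite -RintegralB//; [|exact: locintM|exact: locintZ].
  by apply: eq_Rintegral => x _; rewrite RintegralZl// w1 mulr1 mulrBl.
have T : `|\int[mu]_(x in `[c, c + r / 2]) ((h x - h c) * w x)| <=
   \int[mu]_(x in `[c, c + r / 2]) (k * B * `|h x - h c|).
  apply: le_trans (le_normr_Rintegral _ _) _ => //; first exact: locintM.
  apply: le_Rintegral => //.
  - by apply: locint_norm; exact: locintM.
  - by apply: locintZ; exact: locint_norm.
  - move=> x _; rewrite normrM mulrC ler_wpM2r// /w normrM gtr0_norm//.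
    by rewrite ler_pM2l.
rewrite -lee_fin in T; apply: (le_trans T).
rewrite RintegralZl//; last exact: locint_norm.
rewrite EFinM /davg /iavg lebesgue_measure_ball; last exact: ltW.
rewrite inver mulrn_eq0 /= gt_eqF// muleA -[X in (_ <= X * _)%E]EFinM.
have -> : 4 * B * (r *+ 2)^-1 = k * B.
  by rewrite /k -mulr_natl; field; rewrite gt_eqF.
apply: lee_wpmul2l; first by rewrite lee_fin mulr_ge0// ltW.
rewrite /Rintegral fineK; last exact: (integrable_fin_num _ (locint_norm lc _ _)).
apply: ge0_subset_integral => //=.
- by rewrite ball_itv; exact: measurable_itv.
- by apply/measurable_EFinP/measurable_funTS; exact: locint_measurable (locint_norm lc).
- by move=> x /=; rewrite ball_itv /= !in_itv /=; move: r0; clear; lra.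
Qed.

Lemma lebesgue_pt_approx h (c e : R) : lebesgue_pt h c -> 0 < e ->
  \forall r \near 0^'+, (davg h c r <= e%:E)%E.
Proof.
move=> /fine_cvgP[F /cvgrPdist_lt/(_ _)H] e0; have {}H := H _ e0.
near=> r; have : `|0 - (fine \o davg h c) r| < e by near: r.
have Fr : davg h c r \is a fin_num by near: r.
by rewrite sub0r normrN /= -[in leLHS](fineK Fr) lee_fin => /ltW; apply: le_trans; exact: ler_norm.
Unshelve. all: by end_near. Qed.

(** The values at two Lebesgue points [a] and [b] agree: testing with a step at [a] minus a step at
    [b] equates two local averages, which tend to [h a] and [h b] as the steps steepen. Almost every
    point is a Lebesgue point. *)
Lemma du_bois_reymond h : locint h ->
  (forall phi, test_function phi -> \int[mu]_(x in setT) (h x * derive1 phi x) = 0) ->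
  exists c, {ae mu, forall x, h x = c}.
Proof.
move=> lh Hphi.
have [S [rho [[smoothS DS crho S0 S1] [_ r0 r1 [B HB]]]]] := @smooth_step R.
have key a b : lebesgue_pt h a -> lebesgue_pt h b -> h a = h b.
  move=> La Lb; apply/eqP; rewrite -subr_eq0 -normr_le0; apply/ler_addgt0Pr => e e0.
  have B0 : 0 <= B by apply: le_trans (HB 0).
  (* Chosen so that the factor [4 * B] of the averaging estimate leaves at most [e / 2] at each
     point. *)
  have e1 : 0 < e / (8 * (B + 1)) by rewrite divr_gt0// mulr_gt0//; lra.
  have [r [r0' da db]] : exists r, [/\ 0 < r, (davg h a r <= (e / (8 * (B + 1)))%:E)%E &
      (davg h b r <= (e / (8 * (B + 1)))%:E)%E].
    near (0 : R)^'+ => r; exists r; split; near: r.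
    - exact: nbhs_right_gt.
    - exact: lebesgue_pt_approx.
    - exact: lebesgue_pt_approx.
  have step c : (davg h c r <= (e / (8 * (B + 1)))%:E)%E ->
      `|\int[mu]_(x in `[c, c + r / 2]) (h x * (2 / r * rho (2 / r * (x - c)))) - h c| <= e / 2.
    move=> dc; rewrite -lee_fin; apply: le_trans.
      by apply: lebesgue_pt_step DS crho _ _ HB => //; [exact: S0|exact: S1].
    apply: le_trans (lee_wpmul2l _ dc) _; first by rewrite lee_fin mulr_ge0.
    rewrite -EFinM lee_fin.
    have -> : 4 * B * (e / (8 * (B + 1))) = e / 2 * (B / (B + 1)) by field; lra.
    have X : B / (B + 1) <= 1 by rewrite ler_pdivrMr ?mul1r; [rewrite lerDl|rewrite ltr_wpDl].
    by rewrite ler_piMr// divr_ge0// ltW.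
  pose k := 2 / r; have k0 : 0 < k by exact: divr_gt0.
  pose w c x := k * rho (k * (x - c)).
  have cw c : continuous (w c) by apply: ctsM; [exact: cts_cst|apply: cts_comp => //; cts].
  have Dw c : deriv_of (fun x => S (k * (x - c))) (w c).
    have Da : deriv_of (fun x => k * (x - c)) (fun=> k) by deriv; ring.
    by apply: (deriv_extr (deriv_comp DS Da)) => x; rewrite mulrC.
  pose M := `|a| + `|b| + r.
  have w0 c x : x \notin `[c, c + r / 2]%classic -> w c x = 0.
    rewrite notin_setE /= in_itv /= => /negP; rewrite negb_and -!ltNge => /orP[xc|xc].
      by rewrite /w r0 ?mulr0// pmulr_rle0// subr_le0 ltW.
    rewrite /w r1 ?mulr0//.
    have -> : 1 = k * (r / 2) by rewrite /k; field; rewrite gt_eqF.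
    by rewrite ler_pM2l//; lra.
  have wM c : `|c| <= `|a| + `|b| -> \int[mu]_(x in `[c, c + r / 2]) (h x * w c x) =
      \int[mu]_(x in `[- M, M]) (h x * w c x).
    move=> cM; rewrite Rintegral_mkcond [RHS]Rintegral_mkcond; apply: eq_Rintegral => x _.
    rewrite !patchE; case: ifPn => [|xn].
      rewrite inE /= in_itv /= => /andP[cx xc]; rewrite mem_set//= in_itv /= /M.
      by move: cM; rewrite ler_norml; lra.
    by case: ifP => // _; rewrite w0// mulr0.
  (* The two steps cancel far to the right, where both are 1, and vanish far to the left, so their
     difference has compact support. *)
  pose phi x := S (k * (x - a)) - S (k * (x - b)).
  have Dphi : deriv_of phi (fun x => w a x - w b x) by exact: derivB.
  have tphi : test_function phi.
    split.
      move=> n x; apply: smooth_derive1n => m; rewrite /phi.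
      have E c : ndiff m (fun x => S (k * (x - c))).
        have := ndiff_affine k (- k * c) (smoothS m); apply: ndiff_ext => y; congr S; ring.
      have E2 := ndiffM (ndiff_cst m (-1)) (E b).
      by apply: ndiff_ext (ndiffD (E a) E2) => y; rewrite mulN1r.
    exists M => x; rewrite /M => Mx; rewrite /phi.
    have [x0|x0] := leP 0 x.
      rewrite (ger0_norm x0) in Mx; have ha := ler_norm a; have hb := ler_norm b.
      have Q c : r <= x - c -> 1 <= k * (x - c).
        move=> rx; apply: le_trans (_ : k * r <= _); last by rewrite ler_pM2l.
        by rewrite /k mulfVK ?gt_eqF// ler1n.
      have na := normr_ge0 a; have nb := normr_ge0 b.
      have Qa : r <= x - a by clear -Mx ha na nb; lra.
      have Qb : r <= x - b by clear -Mx hb na nb; lra.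
      by rewrite !S1 ?subrr//; exact: Q.
    rewrite (ltr0_norm x0) in Mx; have ha := ler_norm (- a); have hb := ler_norm (- b).
    rewrite !normrN in ha hb; have na := normr_ge0 a; have nb := normr_ge0 b.
    by rewrite !S0 ?subrr// pmulr_rle0//; lra.
  have := Hphi _ tphi; rewrite (deriv_derive1 Dphi) (@RintegralT _ M); last first.
    move=> x; rewrite /M => Mx.
    have P c : `|c| <= `|a| + `|b| -> w c x = 0.
      move=> cM; apply: w0; rewrite notin_setE /= in_itv /=.
      have rr : r / 2 <= r by lra.
      move=> /andP[cx xc]; move: Mx; apply/negP; rewrite -leNgt ler_norml.
      by move: cM; rewrite ler_norml; lra.
    by rewrite !P ?lerDl ?lerDr// subrr mulr0.
  have -> : \int[mu]_(x in `[- M, M]) (h x * (w a x - w b x)) =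
      \int[mu]_(x in `[- M, M]) (h x * w a x) - \int[mu]_(x in `[- M, M]) (h x * w b x).
    rewrite -RintegralB//; [|exact: locintM|exact: locintM].
    by apply: eq_Rintegral => x _; rewrite mulrBr.
  rewrite -!wM ?lerDl ?lerDr//.
  have := step a da; have := step b db; rewrite /w /k.
  set A1 := Rintegral _ _ _; set A2 := Rintegral _ _ _.
  by rewrite add0r !ler_norml; lra.
have [A [mA A0 HA]] := lebesgue_differentiation (locint_locally lh).
have [c Ac] : exists c, lebesgue_pt h c.
  apply/not_existsP => N.
  have : (mu `[0%R : R, 1%R]%classic <= mu A)%E.
    by apply: le_measure; rewrite ?inE//= => x _; apply: HA; exact: N.
  by rewrite A0 lebesgue_measure_itv /= lte_fin ltr01 sube0 lee_fin ler10.
exists (h c), A; split=> // x /= xc; apply: HA => L; apply: xc; exact: key.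
Unshelve. all: by end_near. Qed.

End LocallyIntegrable.

(** * Weak derivatives and primitives *)

Section WeakDerivative.
Context {R : realType}.
Notation mu := (@lebesgue_measure R).
Notation Re := complex.Re.
Notation Im := complex.Im.
Notation normc := Normc.normc.
Implicit Types (f g h u : R -> R[i]) (phi : R -> R) (c : R[i]) (x y M : R).

Lemma ae_mono (P Q : R -> Prop) : (forall x, P x -> Q x) ->
  {ae mu, forall x, P x} -> {ae mu, forall x, Q x}.
Proof. by have F := @ae_filter_ringOfSetsType _ _ R mu; exact: filterS. Qed.

Lemma ae_mono2 (P Q S : R -> Prop) : (forall x, P x -> Q x -> S x) ->
  {ae mu, forall x, P x} -> {ae mu, forall x, Q x} -> {ae mu, forall x, S x}.
Proof. by have F := @ae_filter_ringOfSetsType _ _ R mu; exact: filterS2. Qed.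

Lemma ae_all (P : R -> Prop) : (forall x, P x) -> {ae mu, forall x, P x}.
Proof. by have F := @ae_filter_ringOfSetsType _ _ R mu; move=> H; exact: filterE. Qed.

Lemma test_functionP phi : test_function phi ->
  [/\ deriv_of phi (derive1 phi), continuous (derive1 phi) &
    exists2 M, 0 <= M & forall x, M <= `|x| -> phi x = 0 /\ derive1 phi x = 0].
Proof.
move=> [sm [M suppM]].
have D : deriv_of phi (derive1 phi).
  by move=> x; rewrite derive1E; apply/derivableP; exact: (sm 0%N).
have D2 : deriv_of (derive1 phi) (derive1 (derive1 phi)).
  by move=> x; rewrite [X in is_derive _ _ _ X]derive1E; apply/derivableP; exact: (sm 1%N).
split=> //; first exact: deriv_continuous D2.
exists (`|M| + 1) => [|x Mx]; first by rewrite addr_ge0.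
have Mx' : M < `|x| by have := ler_norm M; lra.
split; first exact: suppM.
have H : is_derive x (1 : R) phi 0.
  have C0 : is_derive x (1 : R) (fun=> 0 : R) 0 by exact: is_derive_cst.
  apply: (near_eq_is_derive _ C0).
  have nx : \forall y \near x, M < `|y|.
    have := @norm_continuous R R^o x; move/cvgr_gt/(_ _ Mx'); exact.
  by near=> y; rewrite suppM//; near: y.
by rewrite derive1E; case: H.
Unshelve. all: by end_near. Qed.

Definition clocint f := locint (fun x => Re (f x)) /\ locint (fun x => Im (f x)).

Definition cprim f x : R[i] := (prim (fun y => Re (f y)) x) +i* (prim (fun y => Im (f y)) x).

(** Through [|z| <= 1 + |z| ^ 2], constants being integrable on bounded intervals. *)
Lemma L2loc_clocint f : L2loc f -> clocint f.
Proof.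
move=> Lf.
have H M : mu.-integrable `[- M, M] (EFin \o (fun x => 1 + normc (f x) ^+ 2)).
  have [_ _ i2] := Lf M.
  have i1 : mu.-integrable `[- M, M] (EFin \o (fun=> 1 : R)).
    by apply: continuous_locint; exact: cts_cst.
  exact: (integrableD _ i1 i2).
have sub (a b : R) : `[a, b] `<=` `[- (`|a| + `|b|), `|a| + `|b|].
  move=> x; rewrite /= !in_itv /=; have := ler_norm b; have := ler_norm (- a).
  by rewrite normrN; have := normr_ge0 a; have := normr_ge0 b; lra.
have sq (y z : R) : `|y| <= z -> `|y| <= 1 + z ^+ 2 by have := normr_ge0 y; nra.
have nn (y : R) : `|1 + y ^+ 2| = 1 + y ^+ 2 by rewrite ger0_norm// addr_ge0// sqr_ge0.
split=> a b; have [mR mI _] := Lf (`|a| + `|b|).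
  have iR : mu.-integrable `[- (`|a| + `|b|), `|a| + `|b|] (EFin \o (fun x => Re (f x))).
    apply: le_integrable (H _) => //; first exact/measurable_EFinP.
    by move=> x _ /=; rewrite lee_fin nn; apply: sq; exact: normr_Re.
  by apply: integrableS iR => //; exact: sub.
have iI : mu.-integrable `[- (`|a| + `|b|), `|a| + `|b|] (EFin \o (fun x => Im (f x))).
  apply: le_integrable (H _) => //; first exact/measurable_EFinP.
  by move=> x _ /=; rewrite lee_fin nn; apply: sq; exact: normr_Im.
by apply: integrableS iI => //; exact: sub.
Qed.

Lemma L2_le f (D : set R) (G : R -> R) : measurable D ->
  measurable_fun D (fun x => Re (f x)) -> measurable_fun D (fun x => Im (f x)) ->
  mu.-integrable D (EFin \o G) -> (forall x, D x -> normc (f x) ^+ 2 <= G x) -> L2 D f.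
Proof.
move=> mD mR mI iG fG; split=> //; apply: le_integrable iG => //.
  apply/measurable_EFinP.
  rewrite (_ : (fun x => _) = (fun x => Re (f x) ^+ 2 + Im (f x) ^+ 2)); last first.
    by apply/funext => x; rewrite normc2.
  by apply: measurable_funD; exact: measurable_funX.
move=> x Dx /=; rewrite lee_fin ger0_norm ?sqr_ge0//.
by apply: le_trans (ler_norm _); exact: fG.
Qed.

Lemma ccts_L2loc f : ccts f -> L2loc f.
Proof.
move=> [cR cI0] M; apply: (@L2_le _ _ (fun x => Re (f x) ^+ 2 + Im (f x) ^+ 2)) => //.
- by apply: measurable_funTS; exact: continuous_measurable_fun.
- by apply: measurable_funTS; exact: continuous_measurable_fun.
- by apply: continuous_locint; apply: ctsD; exact: ctsX.
- by move=> x _; rewrite normc2.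
Qed.

Lemma normc_leD (z w : R[i]) : normc (z + w) ^+ 2 <= 2 * normc z ^+ 2 + 2 * normc w ^+ 2.
Proof.
rewrite !normc2 !cE -subr_ge0; set t := _ - _.
have -> : t = (Re z - Re w) ^+ 2 + (Im z - Im w) ^+ 2 by rewrite /t; ring.
by rewrite addr_ge0// sqr_ge0.
Qed.

Lemma L2D f g (D : set R) : measurable D -> L2 D f -> L2 D g -> L2 D (fun x => f x + g x).
Proof.
move=> mD [fR fI f2] [gR gI g2].
apply: (@L2_le _ _ (fun x => 2 * normc (f x) ^+ 2 + 2 * normc (g x) ^+ 2)) => //.
- by rewrite (_ : (fun x => _) = (fun x => Re (f x) + Re (g x))); [exact: measurable_funD|apply/funext => x; rewrite cE].
- by rewrite (_ : (fun x => _) = (fun x => Im (f x) + Im (g x))); [exact: measurable_funD|apply/funext => x; rewrite cE].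
- by apply: (integrableD _ (integrableZl _ _ f2) (integrableZl _ _ g2)).
- by move=> x _; exact: normc_leD.
Qed.

Lemma L2Z c f (D : set R) : measurable D -> L2 D f -> L2 D (fun x => c * f x).
Proof.
move=> mD [fR fI f2].
apply: (@L2_le _ _ (fun x => normc c ^+ 2 * normc (f x) ^+ 2)) => //.
- rewrite (_ : (fun x => _) = (fun x => Re c * Re (f x) - Im c * Im (f x))); last first.
    by apply/funext => x; rewrite cE.
  by apply: measurable_funB; apply: measurable_funM => //; exact: measurable_cst.
- rewrite (_ : (fun x => _) = (fun x => Re c * Im (f x) + Im c * Re (f x))); last first.
    by apply/funext => x; rewrite cE.
  by apply: measurable_funD; apply: measurable_funM => //; exact: measurable_cst.
- exact: (integrableZl _ _ f2).
- by move=> x _; rewrite Normc.normcM exprMn.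
Qed.

Lemma L2locD f g : L2loc f -> L2loc g -> L2loc (fun x => f x + g x).
Proof. by move=> Lf Lg M; exact: L2D. Qed.

Lemma L2locZ c f : L2loc f -> L2loc (fun x => c * f x).
Proof. by move=> Lf M; exact: L2Z. Qed.

Lemma L2locN f : L2loc f -> L2loc (fun x => - f x).
Proof.
move=> /(@L2locZ (-1)); suff -> : (fun x => -1 * f x) = (fun x => - f x) by [].
by apply/funext => x; rewrite mulN1r.
Qed.

Lemma L2locM (p : R -> R) f : continuous p -> L2loc f -> L2loc (fun x => (p x)%:C * f x).
Proof.
move=> cp Lf M; have [fR fI f2] := Lf M.
have [B B0 HB] := cts_bounded M cp.
have mp : measurable_fun `[- M, M] p by apply: measurable_funTS; exact: continuous_measurable_fun.
apply: (@L2_le _ _ (fun x => B ^+ 2 * normc (f x) ^+ 2)) => //.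
- rewrite (_ : (fun x => _) = (fun x => p x * Re (f x))); last first.
    by apply/funext => x; rewrite !cE /= mul0r subr0.
  exact: measurable_funM.
- rewrite (_ : (fun x => _) = (fun x => p x * Im (f x))); last first.
    by apply/funext => x; rewrite !cE /= mul0r addr0.
  exact: measurable_funM.
- exact: (integrableZl _ _ f2).
- move=> x; rewrite /= in_itv /= => /HB px.
  by rewrite Normc.normcM normcR exprMn ler_wpM2r ?sqr_ge0// lerXn2r// nnegrE.
Qed.

(** By parts, the function minus the primitive of its weak derivative integrates to zero against
    every derivative of a test function, separately in real and imaginary parts. *)
Lemma weak_derivative_prim f g : weak_derivative f g ->
  exists c, {ae mu, forall x, f x = c + cprim g x}.
Proof.
move=> [Lf Lg W].
have [fR fI] := L2loc_clocint Lf; have [gR gI] := L2loc_clocint Lg.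
have real (p q : R -> R) : locint p -> locint q ->
    (forall phi, test_function phi -> \int[mu]_x (p x * derive1 phi x) = - \int[mu]_x (q x * phi x)) ->
    exists e : R, {ae mu, forall x, p x - prim q x = e}.
  move=> lp lq Wpq; have lpq := continuous_locint (prim_cts lq).
  apply: du_bois_reymond; first exact: locintB.
  move=> phi tphi; have [D cD [M M0 HM]] := test_functionP tphi.
  have := Wpq _ tphi.
  have supp (r : R -> R) x : M < `|x| -> r x * derive1 phi x = 0.
    by move=> /ltW/HM[_ ->]; rewrite mulr0.
  rewrite !(@RintegralT _ _ M); [|exact: supp|by move=> x /ltW/HM[-> _]; rewrite mulr0|exact: supp].
  have pM : phi M = 0 by have [] := HM M; rewrite ?ger0_norm.
  have pM' : phi (- M) = 0 by have [] := HM (- M); rewrite ?normrN ?ger0_norm.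
  rewrite -(prim_parts lq D cD M0 pM pM') => E.
  have -> : \int[mu]_(x in `[- M, M]) ((p x - prim q x) * derive1 phi x) =
      \int[mu]_(x in `[- M, M]) (p x * derive1 phi x) -
      \int[mu]_(x in `[- M, M]) (prim q x * derive1 phi x).
    rewrite -RintegralB//; [|exact: locintM|exact: locintM].
    by apply: eq_Rintegral => x _; rewrite mulrBl.
  by rewrite E subrr.
have ER h (p : R -> R) : (fun x => Re (h x * (p x)%:C)) = (fun x => Re (h x) * p x).
  by apply/funext => x; rewrite cE /= mulr0 subr0.
have EI h (p : R -> R) : (fun x => Im (h x * (p x)%:C)) = (fun x => Im (h x) * p x).
  by apply/funext => x; rewrite cE /= mulr0 add0r.
have WR phi : test_function phi ->
    \int[mu]_x (Re (f x) * derive1 phi x) = - \int[mu]_x (Re (g x) * phi x).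
  by move=> /W /(congr1 (@complex.Re R)); rewrite cReN /Cintegral /= !ER.
have WI phi : test_function phi ->
    \int[mu]_x (Im (f x) * derive1 phi x) = - \int[mu]_x (Im (g x) * phi x).
  by move=> /W /(congr1 (@complex.Im R)); rewrite cImN /Cintegral /= !EI.
have [a Ha] := real _ _ fR gR WR.
have [b Hb] := real _ _ fI gI WI.
exists (a +i* b); apply: ae_mono2 Ha Hb => x Hax Hbx.
by apply: complex_eq; rewrite !cE /= -?Hax -?Hbx subrK.
Qed.

Lemma prim_weak_derivative f g c : L2loc f -> L2loc g ->
  {ae mu, forall x, f x = c + cprim g x} -> weak_derivative f g.
Proof.
move=> Lf Lg E.
have [fR fI] := L2loc_clocint Lf; have [gR gI] := L2loc_clocint Lg.
split=> // phi tphi.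
have real (p q : R -> R) (a : R) : locint p -> locint q ->
    {ae mu, forall x, p x = a + prim q x} ->
    \int[mu]_x (p x * derive1 phi x) = - \int[mu]_x (q x * phi x).
  move=> lp lq Ep; have lpq := continuous_locint (prim_cts lq).
  have [D cD [M M0 HM]] := test_functionP tphi.
  have cphi := deriv_continuous D.
  rewrite !(@RintegralT _ _ M); [|by move=> x /ltW/HM[-> _]; rewrite mulr0|by move=> x /ltW/HM[_ ->]; rewrite mulr0].
  have MM : - M <= M by lra.
  have pM : phi M = 0 by have [] := HM M; rewrite ?ger0_norm.
  have pM' : phi (- M) = 0 by have [] := HM (- M); rewrite ?normrN ?ger0_norm.
  rewrite -(prim_parts lq D cD M0 pM pM').
  have lcst : locint (fun=> a) by apply: continuous_locint; exact: cts_cst.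
  have -> : \int[mu]_(x in `[- M, M]) (p x * derive1 phi x) =
      \int[mu]_(x in `[- M, M]) (a * derive1 phi x + prim q x * derive1 phi x).
    have l1 : locint (fun x => p x * derive1 phi x) by exact: locintM.
    have l2 : locint (fun x => a * derive1 phi x + prim q x * derive1 phi x).
      by apply: locintD; exact: locintM.
    rewrite /Rintegral; congr fine; apply: ae_eq_integral => //.
    - exact: measurable_int (l1 _ _).
    - exact: measurable_int (l2 _ _).
    - by apply: ae_mono Ep => x -> _; rewrite mulrDl.
  rewrite RintegralD//; [|exact: locintM|exact: locintM].
  rewrite RintegralZl//; last exact: continuous_locint.
  rewrite -(primB (continuous_locint cD) MM) !(primE _ D cD) pM pM'.
  by rewrite subrr mulr0 add0r.
have ER h (p : R -> R) : (fun x => Re (h x * (p x)%:C)) = (fun x => Re (h x) * p x).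
  by apply/funext => x; rewrite cE /= mulr0 subr0.
have EI h (p : R -> R) : (fun x => Im (h x * (p x)%:C)) = (fun x => Im (h x) * p x).
  by apply/funext => x; rewrite cE /= mulr0 add0r.
rewrite /Cintegral !ER !EI; apply: complex_eq; rewrite ?cReN ?cImN /=.
- by apply: (real _ _ (Re c)) => //; apply: ae_mono E => x ->; rewrite ?cReD ?cImD.
- by apply: (real _ _ (Im c)) => //; apply: ae_mono E => x ->; rewrite ?cReD ?cImD.
Qed.

Lemma cprim_cts f : clocint f -> ccts (cprim f).
Proof. by move=> [lR lI]; split; exact: prim_cts. Qed.

(** Where two continuous functions differ, they differ on a ball, which has positive measure. *)
Lemma ae_open_eq f g (U : set R) : open U -> ccts f -> ccts g ->
  {ae mu, forall x, U x -> f x = g x} -> forall x, U x -> f x = g x.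
Proof.
move=> oU [fR fI] [gR gI] E x Ux.
have real (p q : R -> R) : continuous p -> continuous q ->
    {ae mu, forall y, U y -> p y = q y} -> p x = q x.
  move=> cp cq [A [mA A0 HA]]; apply/eqP; apply/negP => /negP pq.
  have c2 : continuous (fun y => p y - q y) by exact: ctsB.
  have : \forall y \near x, U y /\ p y - q y != 0.
    have Nz : \forall y \near x, p y - q y != 0.
      by have := c2 x; move/(@cvgr_neq0 R R^o); apply; rewrite subr_eq0.
    near=> y; split; near: y => //.
    exact: open_nbhs_nbhs.
  move=> /nbhs_ballP[e /= e0 He].
  have BA : ball x e `<=` A.
    move=> y /He[Uy]; rewrite subr_eq0 => /eqP pqy; apply: HA => H; exact: pqy (H Uy).
  have : (mu (ball x e) <= mu A)%E.
    by apply: le_measure => //; rewrite inE//; rewrite ball_itv; exact: measurable_itv.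
  rewrite A0 lebesgue_measure_ball; last exact: ltW.
  by rewrite lee_fin pmulrn_rle0// leNgt e0.
apply: complex_eq.
- by apply: (real (fun x => Re (f x)) (fun x => Re (g x))) => //; apply: ae_mono E => y H /H ->.
- by apply: (real (fun x => Im (f x)) (fun x => Im (g x))) => //; apply: ae_mono E => y H /H ->.
Unshelve. all: by end_near. Qed.

(** At each Lebesgue point of [h] the primitive has derivative [h x], and here the primitive is
    zero. *)
Lemma prim_const_ae0 (h : R -> R) : locint h -> (forall x, prim h x = 0) ->
  {ae mu, forall x, h x = 0}.
Proof.
move=> lh H; apply: ae_mono (lebesgue_differentiation (locint_locally lh)) => x Lx.
have xx : x < x + 1 by rewrite ltrDl.
have [|_ <-] := FTC1_lebesgue_pt xx (lh (x - 1) (x + 1)) _ Lx.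
  by rewrite /= lte_fin; lra.
rewrite (_ : (fun y => _) = (fun=> 0)) ?derive1_cst//.
apply/funext => y; have [xy|xy] := leP (x - 1) y.
  by rewrite -primB// !H subrr.
by rewrite set_itv_ge ?Rintegral_set0// bnd_simp -ltNge.
Qed.

Lemma weak_derivative_unique f g h : weak_derivative f g -> weak_derivative f h ->
  {ae mu, forall x, g x = h x}.
Proof.
move=> Wg Wh; have [c Hc] := weak_derivative_prim Wg; have [d Hd] := weak_derivative_prim Wh.
have [_ /L2loc_clocint Lg _] := Wg; have [_ /L2loc_clocint Lh _] := Wh.
have E x : c + cprim g x = d + cprim h x.
  apply: (@ae_open_eq (fun x => c + cprim g x) (fun x => d + cprim h x) setT) => //.
  - exact: openT.
  - by apply: cctsD; [exact: ccts_cst|exact: cprim_cts].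
  - by apply: cctsD; [exact: ccts_cst|exact: cprim_cts].
  - by apply: ae_mono2 Hc Hd => y -> ->.
have cd : c = d.
  by have := E 0; rewrite /cprim !prim0 -[0 +i* 0]/(0 : R[i]) !addr0.
have P x : cprim g x = cprim h x by have := E x; rewrite cd => /addrI.
case: Lg Lh => [gR gI] [hR hI].
have AR : {ae mu, forall x, Re (g x) - Re (h x) = 0}.
  apply: prim_const_ae0; first exact: locintB.
  by move=> x; rewrite prim_sub//; have := congr1 (@complex.Re R) (P x) => /= ->; rewrite subrr.
have AI : {ae mu, forall x, Im (g x) - Im (h x) = 0}.
  apply: prim_const_ae0; first exact: locintB.
  by move=> x; rewrite prim_sub//; have := congr1 (@complex.Im R) (P x) => /= ->; rewrite subrr.
by apply: ae_mono2 AR AI => x /eqP; rewrite subr_eq0 => /eqP ? /eqP; rewrite subr_eq0 => /eqP ?; exact: complex_eq.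
Qed.

(** Needed to iterate [dz], whose value is an arbitrary representative of the weak derivative. *)
Lemma weak_derivative_ae f f1 g : L2loc f1 -> {ae mu, forall x, f x = f1 x} ->
  weak_derivative f g -> weak_derivative f1 g.
Proof.
move=> L1 E W; have [c Hc] := weak_derivative_prim W; have [_ Lg _] := W.
by apply: (@prim_weak_derivative f1 g c) => //; apply: ae_mono2 E Hc => x ->.
Qed.

Lemma dz_spec f g : weak_derivative f g -> weak_derivative f (dz f).
Proof. by move=> W; rewrite /dz; apply: (@xgetPex _ (fun=> 0) [set g | weak_derivative f g]); exists g. Qed.

Lemma dz_ae f g : weak_derivative f g -> {ae mu, forall x, dz f x = g x}.
Proof. by move=> W; exact: weak_derivative_unique (dz_spec W) W. Qed.

Lemma cprimE f F x : cderiv F f -> ccts f -> cprim f x = F x - F 0.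
Proof.
move=> [DR DI] [cR cI0].
by apply: complex_eq; rewrite !cE /= ?(primE _ DR cR) ?(primE _ DI cI0).
Qed.

Lemma cderiv_weak f f' : cderiv f f' -> ccts f' -> weak_derivative f f'.
Proof.
move=> D cf'; apply: (@prim_weak_derivative f f' (f 0)).
- exact/ccts_L2loc/(cderiv_ccts D).
- exact: ccts_L2loc.
- by apply: ae_all => x; rewrite (cprimE _ D cf') addrC subrK.
Qed.

End WeakDerivative.

(** * Periodic functions in L2 *)

Section Translation.
Context {R : realType}.
Notation mu := (@lebesgue_measure R).
Notation Re := complex.Re.
Notation Im := complex.Im.
Notation normc := Normc.normc.
Implicit Types (f g h u : R -> R[i]) (c x y M T : R).

Lemma measurable_shift c : measurable_fun setT ((fun x => x + c) : R -> measurableTypeR R).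
Proof. by apply: continuous_measurable_fun; cts. Qed.

Lemma lebesgue_measure_shift c (A : set R) : measurable A ->
  pushforward mu ((fun x => x + c) : R -> measurableTypeR R) A = mu A.
Proof.
move=> mA; apply/esym/lebesgue_measure_unique => //=.
  exact: measurable_shift.
move=> ? _ [[a b]] _ <-; rewrite /pushforward.
have -> : (fun x => x + c) @^-1` `]a, b] = `](a - c), (b - c)]%classic.
  by apply/seteqP; split=> x; rewrite /= !in_itv /= ltrBlDr lerBrDr.
rewrite /= !lebesgue_measure_itv/= !lte_fin ltrD2r.
by rewrite -!EFinB opprB addrA subrK.
Qed.

Lemma ae_shift c (P : R -> Prop) : {ae mu, forall x, P x} -> {ae mu, forall x, P (x + c)}.
Proof.
move=> [A [mA A0 HA]]; exists ((fun x => x + c) @^-1` A); split.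
- by rewrite -[X in measurable X]setTI; exact: measurable_shift.
- by rewrite -A0 -(lebesgue_measure_shift c mA).
- by move=> x /= Px; apply: HA.
Qed.

Lemma L2U f (D E : set R) : measurable D -> measurable E -> L2 D f -> L2 E f -> L2 (D `|` E) f.
Proof.
move=> mD mE [fR fI f2] [gR gI g2]; split.
- exact/measurable_funU.
- exact/measurable_funU.
- have K (B : set R) (F : R -> \bar R) : measurable B ->
    mu.-integrable B F <-> mu.-integrable setT (F \_ B).
    move=> mB. refine (@integrable_mkcond _ _ R mu B F mB).
  have mU : measurable (D `|` E) by exact: measurableU.
  have F2 : mu.-integrable setT ((fun x => (normc (f x) ^+ 2)%:E) \_ D).
    exact: (iffLR (K _ _ mD) f2).
  have G2 : mu.-integrable setT ((fun x => (normc (f x) ^+ 2)%:E) \_ E).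
    exact: (iffLR (K _ _ mE) g2).
  apply: (iffRL (K _ _ mU)).
  apply: le_integrable (integrableD _ F2 G2) => //.
    have m1 : measurable_fun D (fun x => (normc (f x) ^+ 2)%:E) by exact: measurable_int f2.
    have m2 : measurable_fun E (fun x => (normc (f x) ^+ 2)%:E) by exact: measurable_int g2.
    have m3 : measurable_fun (D `|` E) (fun x => (normc (f x) ^+ 2)%:E) by exact/measurable_funU.
    exact: (iffLR (measurable_restrictT _ mU) m3).
  move=> x _; rewrite /= !patchE in_setU; set t := ((normc (f x) ^+ 2)%:E).
  have t0 : (0 <= t)%E by rewrite lee_fin sqr_ge0.
  case: (x \in D); case: (x \in E); rewrite /= ?addr0 ?add0r ?lee_fin//.
  by rewrite !ger0_norm ?addr_ge0 ?sqr_ge0// lerDl sqr_ge0.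
Qed.

Lemma L2_sub f (D E : set R) : measurable D -> measurable E -> D `<=` E -> L2 E f -> L2 D f.
Proof.
move=> mD mE DE [fR fI f2]; split.
- exact: measurable_funS DE fR.
- exact: measurable_funS DE fI.
- by apply: integrableS f2.
Qed.

Lemma L2_shift f T a b : (forall x, f (x + T) = f x) ->
  L2 `[a, b[ f -> L2 `[a + T, b + T[ f.
Proof.
move=> pf [fR fI f2].
have E : f = (fun x => f (x + - T)) by apply/funext => x; rewrite -[RHS]pf subrK.
have sub : (fun x => x + - T) @` `[a + T, b + T[ `<=` `[a, b[.
  by move=> _ [x + <-]; rewrite /= !in_itv /= lerBrDr ltrBlDr.
have ms : measurable_fun `[a + T, b + T[ ((fun x => x + - T) : R -> measurableTypeR R).
  by apply: measurable_funTS; exact: measurable_shift.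
split.
- by rewrite E; exact: (measurable_comp _ sub fR ms).
- by rewrite E; exact: (measurable_comp _ sub fI ms).
- have mf2 : measurable_fun `[a + T, b + T[ (fun x => (normc (f x) ^+ 2)%:E).
    have := measurable_comp (measurable_itv _) sub (measurable_int _ f2) ms.
    by rewrite [X in measurable_fun _ X](_ : _ = (fun x => (normc (f x) ^+ 2)%:E))//; apply/funext => x /=; rewrite -[f (x - T)]pf subrK.
  apply/integrableP; split=> //; case/integrableP: f2 => _; apply: le_lt_trans.
  pose F x := (normc (f x) ^+ 2)%:E.
  have nn : (fun x => `|F x|%E) = F.
    by apply/funext => x; rewrite gee0_abs// lee_fin sqr_ge0.
  rewrite -/F; change ((\int[mu]_(x in `[(a + T)%R, (b + T)%R[) `|F x| <= \int[mu]_(x in `[a, b[) `|F x|)%E).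
  rewrite nn.
  pose phi := (fun x => x + T) : R -> measurableTypeR R.
  have -> : (\int[mu]_(x in `[(a + T)%R, (b + T)%R[) F x =
     \int[pushforward mu phi]_(x in `[(a + T)%R, (b + T)%R[) F x)%E.
    apply: eq_measure_integral; first exact: measurable_shift.
    by move=> ? A mA _; apply/esym; exact: lebesgue_measure_shift.
  rewrite ge0_integral_pushforward//.
  - have -> : phi @^-1` `[(a + T)%R, (b + T)%R[ = `[a, b[%classic.
      by apply/seteqP; split=> x; rewrite /phi /= !in_itv /= lerD2r ltrD2r.
    by rewrite (_ : F \o phi = F)//; apply/funext => x; rewrite /F /phi /= pf.
  - exact: measurable_shift.
  - by move=> x _; rewrite lee_fin sqr_ge0.
Qed.

Lemma L2_eq f g (D : set R) : measurable D -> (forall x, D x -> f x = g x) -> L2 D f -> L2 D g.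
Proof.
move=> mD E [fR fI f2]; split.
- by apply: eq_measurable_fun fR => x; rewrite inE => /E ->.
- by apply: eq_measurable_fun fI => x; rewrite inE => /E ->.
- by apply: eq_integrable f2 => // x; rewrite inE => /E ->.
Qed.

(** By induction: the interval of [n + 1] periods on each side of 0 is covered by the translates,
    one period to the left and to the right, of that of [n] periods. *)
Lemma per_L2loc f : per f -> L2 `[0, 2 * pi[ f -> L2loc f.
Proof.
move=> pf L; have T0 := @pi2_gt0 R; set T := 2 * pi in T0 L.
have pfN x : f (x - T) = f x by rewrite -[LHS]pf subrK.
have mI (a b : R) : measurable `[a, b[ by exact: measurable_itv.
have H n : L2 `[- (n.+1%:R * T), n.+1%:R * T[ f.
  elim: n => [|n IH].
    have L' : L2 `[- T, 0[ f by rewrite -[- T]add0r -[X in `[_, X[](subrr T); exact: (L2_shift pfN).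
    apply: L2_sub (L2U _ _ L' L) => //; first exact: measurableU.
    move=> x /=; rewrite !in_itv /= mul1r => /andP[-> ->]; rewrite andbT /=.
    by case: (ltP x 0) => _; [left|right].
  have L1 := L2_shift pf IH; have L2' := L2_shift pfN IH.
  apply: L2_sub (L2U _ _ L2' L1) => //; first exact: measurableU.
  move=> x /=; rewrite !in_itv /= -(natr1 n.+1) mulrDl mul1r opprD => /andP[x1 x2].
  have [x0|x0] := leP (- (n.+1%:R * T) + T) x; [right|left]; apply/andP; split=> //.
  apply: lt_le_trans x0 _.
  have : T <= n.+1%:R * T by rewrite ler_peMl ?ler1n// ltW.
  lra.
move=> M; have [n Mn] : exists n : nat, `|M| < n.+1%:R * T.
  exists (Num.bound (`|M| / T)); rewrite -ltr_pdivrMr//.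
  have := archi_boundP (divr_ge0 (normr_ge0 M) (ltW T0)).
  by move=> /lt_trans; apply; rewrite ltr_nat.
apply: L2_sub (H n) => // x; rewrite /= !in_itv /=.
by move: Mn; rewrite ltr_norml; lra.
Qed.

Lemma periodization g : L2 period g ->
  exists h, [/\ per h, L2loc h & forall x, period x -> h x = g x].
Proof.
move=> Lg; have T0 := @pi2_gt0 R; set T : R := 2 * pi in T0.
pose h x := g (x - (Num.floor (x / T))%:~R * T).
have ph : per h.
  move=> x; rewrite /h -/T mulrDl divff ?gt_eqF// floorDrz ?intr1 ?rpred1// floor1.
  by rewrite rmorphD /=; congr g; ring.
have hg x : 0 <= x -> x < T -> h x = g x.
  move=> x0 xT; rewrite /h; suff -> : Num.floor (x / T) = 0 by rewrite mul0r subr0.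
  have xT1 : x / T < 1 by rewrite ltr_pdivrMr// mul1r.
  by apply: floor_def; rewrite xT1 andbT divr_ge0// ltW.
exists h; split=> //; last by move=> x; rewrite /period /= in_itv /= => /andP[/ltW x0]; exact: hg.
(* At multiples of the period [h] equals [g 0], about which integrability on the open period says
   nothing; the point 0 is therefore added separately. *)
apply: per_L2loc => //; have m0 : measurable [set (0 : R)] by exact: measurable_set1.
have mI : measurable (`]0, T[ : set R) by exact: measurable_itv.
have Lh : L2 `]0, T[ h.
  by apply: L2_eq Lg => // x; rewrite /period /= in_itv /= => /andP[/ltW x0 xT]; rewrite hg.
have L0 : L2 [set 0] h.
  apply: (@L2_eq (fun=> h 0)) => //; first by move=> x ->.
  apply: (@L2_sub _ _ `[- 0, 0]) => //; last exact: (ccts_L2loc (ccts_cst _)).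
  by move=> x ->; rewrite /= in_itv /= oppr0 lexx.
apply: L2_sub (L2U m0 mI L0 Lh) => //; first exact: measurableU.
move=> x; rewrite /= !in_itv /= => /andP[x0 xT]; move: x0; rewrite le_eqVlt => /predU1P[<-|x0].
  by left.
by right; rewrite x0.
Qed.

End Translation.

(** * Integrals and norms over a period for functions known almost everywhere *)

Section PeriodAnalysis.
Context {R : realType}.
Notation mu := (@lebesgue_measure R).
Notation Re := complex.Re.
Notation Im := complex.Im.
Notation normc := Normc.normc.
Implicit Types (f g h u : R -> R[i]) (c : R[i]) (x y : R).

Lemma period_int (h : R -> R) : locint h -> \int[mu]_(x in period) h x = prim h (2 * pi).
Proof.
move=> lh; have T0 := @pi2_gt0 R; rewrite /prim ltW// /period.
have io : mu.-integrable `]0, 2 * pi] (EFin \o h).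
  by apply: integrableS (lh 0 (2 * pi)) => //; apply: subset_itvr; rewrite bnd_simp.
have ioo : mu.-integrable `]0, 2 * pi[ (EFin \o h).
  by apply: integrableS (lh 0 (2 * pi)) => //; apply: subset_itv; rewrite bnd_simp.
by rewrite Rintegral_itv_bndo_bndc// Rintegral_itv_obnd_cbnd.
Qed.

Lemma prim_oo (h : R -> R) x : locint h -> 0 <= x -> prim h x = \int[mu]_(t in `]0, x[) h t.
Proof.
move=> lh x0; rewrite /prim x0.
have io : mu.-integrable `]0, x] (EFin \o h).
  by apply: integrableS (lh 0 x) => //; apply: subset_itvr; rewrite bnd_simp.
have ioo : mu.-integrable `]0, x[ (EFin \o h).
  by apply: integrableS (lh 0 x) => //; apply: subset_itv; rewrite bnd_simp.
by rewrite Rintegral_itv_bndo_bndc// Rintegral_itv_obnd_cbnd.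
Qed.

Lemma Rintegral_ae (h k : R -> R) (D : set R) : measurable D ->
  measurable_fun D h -> measurable_fun D k ->
  {ae mu, forall y, D y -> h y = k y} -> \int[mu]_(t in D) h t = \int[mu]_(t in D) k t.
Proof.
move=> mD mh mk E; rewrite /Rintegral; congr fine; apply: ae_eq_integral => //.
- by apply/measurable_EFinP.
- by apply/measurable_EFinP.
- by apply: ae_mono E => y H /H ->.
Qed.

Lemma prim_ae_pos (h k : R -> R) x : locint h -> locint k -> 0 <= x ->
  {ae mu, forall y, 0 < y -> y < x -> h y = k y} -> prim h x = prim k x.
Proof.
move=> lh lk x0 E; rewrite !prim_oo//; apply: Rintegral_ae => //.
- exact: measurable_funTS (locint_measurable lh).
- exact: measurable_funTS (locint_measurable lk).
- by apply: ae_mono E => y H; rewrite /= in_itv /= => /andP[y0 yx]; exact: H.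
Qed.

Lemma prim_ae (h k : R -> R) x : locint h -> locint k ->
  {ae mu, forall y, h y = k y} -> prim h x = prim k x.
Proof.
move=> lh lk E; rewrite /prim; case: (leP 0 x) => _.
  apply: Rintegral_ae => //.
  - exact: measurable_funTS (locint_measurable lh).
  - exact: measurable_funTS (locint_measurable lk).
  - by apply: ae_mono E => y ->.
congr (- _); apply: Rintegral_ae => //.
- exact: measurable_funTS (locint_measurable lh).
- exact: measurable_funTS (locint_measurable lk).
- by apply: ae_mono E => y ->.
Qed.

Lemma cprim_ae_pos f g x : clocint f -> clocint g -> 0 <= x ->
  {ae mu, forall y, 0 < y -> y < x -> f y = g y} -> cprim f x = cprim g x.
Proof.
move=> [fR fI] [gR gI] x0 E; apply: complex_eq; apply: prim_ae_pos => //;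
  by apply: ae_mono E => y H y0 yx; rewrite H.
Qed.

Lemma cprim_ae f g x : clocint f -> clocint g ->
  {ae mu, forall y, f y = g y} -> cprim f x = cprim g x.
Proof.
by move=> [fR fI] [gR gI] E; apply: complex_eq; apply: prim_ae => //; apply: ae_mono E => y ->.
Qed.

Lemma ccts_clocint f : ccts f -> clocint f.
Proof. by move=> [cR cI0]; split; exact: continuous_locint. Qed.

Lemma clocintD f g : clocint f -> clocint g -> clocint (fun x => f x + g x).
Proof.
move=> [fR fI] [gR gI]; split.
- rewrite (_ : (fun x => _) = (fun x => Re (f x) + Re (g x))); first exact: locintD.
  by apply/funext => x; rewrite cE.
- rewrite (_ : (fun x => _) = (fun x => Im (f x) + Im (g x))); first exact: locintD.
  by apply/funext => x; rewrite cE.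
Qed.

Lemma cprimD f g x : clocint f -> clocint g ->
  cprim (fun y => f y + g y) x = cprim f x + cprim g x.
Proof.
move=> [fR fI] [gR gI]; apply: complex_eq; rewrite !cE /= -primD//;
  by congr prim; apply/funext => y; rewrite cE.
Qed.

Lemma cprim_deriv f : ccts f -> cderiv (cprim f) f.
Proof. by move=> [cR cI0]; split; exact: deriv_prim. Qed.

Lemma cI_cst c : cI (fun=> c) = c * (2 * pi : R)%:C.
Proof. by clear; apply: complex_eq; rewrite [LHS]I_cst !cE; case: c => a b /=; ring. Qed.

Lemma per_of_ae f g : periodic f (2 * pi) -> ccts g -> {ae mu, forall x, f x = g x} -> per g.
Proof.
move=> pf cg E x.
have cg2 : ccts (fun x => g (x + 2 * pi)).
  by case: cg => c1 c2; split; [exact: (@cts_shift R (fun y => Re (g y)))|exact: (@cts_shift R (fun y => Im (g y)))].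
apply: (@ae_open_eq _ (fun x => g (x + 2 * pi)) g setT) => //; first exact: openT.
by apply: ae_mono2 (ae_shift (2 * pi) E) E => y E1 E2 _; rewrite -E1 -E2 pf.
Qed.

Lemma L2loc_period f : L2loc f -> L2 period f.
Proof.
move=> Lf; apply: (@L2_sub _ _ _ `[- (2 * pi), 2 * pi]) (Lf _) => //.
  exact: measurable_itv.
have T0 := @pi2_gt0 R.
by move=> x; rewrite /period /= !in_itv /=; lra.
Qed.

Lemma Cintegral_ae f g : L2 period f -> ccts g ->
  {ae mu, forall x, period x -> f x = g x} -> Cintegral period f = cI g.
Proof.
move=> [fR fI _] [gR gI] E.
have mP : measurable (period : set R) by exact: measurable_itv.
apply: complex_eq; rewrite /= /I.
- rewrite -(period_int (continuous_locint gR)); apply: Rintegral_ae => //.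
    by apply: measurable_funTS; exact: continuous_measurable_fun.
  by apply: ae_mono E => y H /H ->.
- rewrite -(period_int (continuous_locint gI)); apply: Rintegral_ae => //.
    by apply: measurable_funTS; exact: continuous_measurable_fun.
  by apply: ae_mono E => y H /H ->.
Qed.

(** Young's inequality [|y| <= t / 2 + y ^ 2 / (2 t)], integrated over the period, gives
    [pi t + N ^ 2 / (2 t)], and [t = N] is taken. Real and imaginary parts contribute [pi + 1/2]
    each. *)
Lemma L2norm_bound f x : L2loc f -> 0 <= x -> x <= 2 * pi ->
  normc (cprim f x) <= (2 * pi + 1) * L2norm f.
Proof.
move=> Lf x0 x2; have T0 := @pi2_gt0 R.
have [fR fI] := L2loc_clocint Lf.
pose N := L2norm f; have N0 : 0 <= N by exact: sqrtr_ge0.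
pose sq := fun y => normc (f y) ^+ 2.
have lsq : locint sq.
  move=> a b; pose M := `|a| + `|b|; have [_ _ i2] := Lf M.
  apply: integrableS i2 => // y; rewrite /= !in_itv /= /M.
  have := ler_norm b; have := ler_norm (- a); rewrite normrN.
  by have := normr_ge0 a; have := normr_ge0 b; lra.
have N2 : prim sq (2 * pi) = N ^+ 2.
  rewrite -period_int// /N /L2norm sqr_sqrtr//.
  by apply: Rintegral_ge0 => y _; exact: sqr_ge0.
have bnd (h : R -> R) : locint h -> (forall y, `|h y| <= normc (f y)) ->
    `|prim h x| <= (pi + 2^-1) * N.
  move=> lh hf.
  have B (t : R) : 0 < t -> `|prim h x| <= pi * t + N ^+ 2 / (2 * t).
    move=> t0; have := norm_primB lh x0; rewrite prim0 subr0 => /le_trans; apply.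
    have lG : locint (fun y => t / 2 + (2 * t)^-1 * sq y).
      by apply: locintD; [apply: continuous_locint; exact: cts_cst|exact: locintZ].
    apply: (@le_trans _ _ (\int[mu]_(y in `[0, x]) (t / 2 + (2 * t)^-1 * sq y))).
      apply: le_Rintegral => //; first exact: locint_norm.
      move=> y _; apply: le_trans (hf y) _; rewrite /sq; set z := normc _.
      rewrite -subr_ge0 (_ : _ - z = (2 * t)^-1 * (z - t) ^+ 2); last by field; rewrite gt_eqF.
      by rewrite mulr_ge0 ?sqr_ge0// invr_ge0 mulr_ge0// ltW.
    have -> : pi * t + N ^+ 2 / (2 * t) = \int[mu]_(y in `[0, 2 * pi]) (t / 2 + (2 * t)^-1 * sq y).
      rewrite -primB ?(ltW T0)// prim0 subr0 primD//; [|apply: continuous_locint; exact: cts_cst|exact: locintZ].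
      by rewrite (primZ (2 * t)^-1 (2 * pi) lsq) N2 -[prim (fun=> _) _]/(I (fun=> t / 2)) I_cst; field; rewrite gt_eqF.
    rewrite [leRHS](Rintegral_chasles lG x0 x2) lerDl.
    apply: Rintegral_ge0 => y _; apply: addr_ge0; first exact/ltW/divr_gt0.
    by rewrite mulr_ge0 ?sqr_ge0// invr_ge0 mulr_ge0// ltW.
  (* For [N = 0] the choice [t = N] is excluded; arbitrarily small [t] gives zero. *)
  move: N0; rewrite le_eqVlt => /predU1P[N00|N0].
    rewrite -N00 mulr0; apply/ler_addgt0Pr => e e0; rewrite add0r.
    have := B (e / pi) (divr_gt0 e0 (pi_gt0 R)).
    by rewrite -N00 expr0n /= mul0r addr0 mulrC divfK ?gt_eqF ?pi_gt0.
  apply: le_trans (B N N0) _; rewrite le_eqVlt; apply/orP; left; apply/eqP.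
  by field; rewrite gt_eqF.
have b1 := bnd _ fR (fun y => normr_Re (f y)).
have b2 := bnd _ fI (fun y => normr_Im (f y)).
have b3 : normc (cprim f x) <= `|Re (cprim f x)| + `|Im (cprim f x)|.
  exact: normc_le.
apply: le_trans b3 _; rewrite -/N.
have -> : (2 * pi + 1) * N = (pi + 2^-1) * N + (pi + 2^-1) * N by field.
exact: lerD.
Qed.

Lemma L2norm_le f g (B : R) : L2 period f -> ccts g ->
  {ae mu, forall x, period x -> f x = g x} -> (forall x, normc (g x) <= B) ->
  L2norm f <= Num.sqrt (2 * pi) * B.
Proof.
move=> [fR fI f2] [gR gI] E gB; have T0 := @pi2_gt0 R.
have B0 : 0 <= B by apply: le_trans (gB 0); exact: normc_ge0.
have mP : measurable (period : set R) by exact: measurable_itv.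
rewrite -[X in _ <= _ * X](ger0_norm B0) -sqrtr_sqr -sqrtrM; last exact: ltW.
have cG : continuous (fun x => Re (g x) ^+ 2 + Im (g x) ^+ 2) by apply: ctsD; exact: ctsX.
apply: ler_wsqrtr.
have -> : \int[mu]_(x in period) (normc (f x) ^+ 2) = I (fun x => Re (g x) ^+ 2 + Im (g x) ^+ 2).
  rewrite /I -(period_int (continuous_locint cG)); apply: Rintegral_ae => //.
  - by apply/measurable_EFinP; exact: measurable_int f2.
  - by apply: measurable_funTS; exact: continuous_measurable_fun.
  - by apply: ae_mono E => y H /H ->; rewrite normc2.
have -> : 2 * pi * B ^+ 2 = I (fun=> B ^+ 2) by rewrite I_cst mulrC.
apply: I_le => //; first exact: cts_cst.
by move=> x; rewrite -normc2 lerXn2r ?nnegrE ?normc_ge0.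
Qed.

End PeriodAnalysis.

(** * The resolvent *)

Section Operator.
Context {R : realType}.
Notation mu := (@lebesgue_measure R).
Notation Re := complex.Re.
Notation Im := complex.Im.
Notation normc := Normc.normc.
Implicit Types (f g h u U W : R -> R[i]) (c : R[i]) (x y : R).

Lemma per_cprim U : ccts U -> per U -> cI U = 0 -> per (cprim U).
Proof.
move=> cU pU U0 x.
have D := cprim_deriv cU.
have D2 : cderiv (fun x => cprim U (x + 2 * pi)) U.
  case: D => DR DI; split.
    by apply: (deriv_extr (deriv_shift (2 * pi) DR)) => y; rewrite pU.
  by apply: (deriv_extr (deriv_shift (2 * pi) DI)) => y; rewrite pU.
have := cprimE x D2 cU; rewrite add0r.
have -> : cprim U (2 * pi) = 0 by exact: U0.
by rewrite subr0 => <-.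
Qed.

(** The mean-free primitive of [U] shows that the defining set is inhabited. The chosen element then
    has weak derivative [U] almost everywhere on the period, so it differs from [cprim U] by a
    constant there, and its zero mean fixes that constant. *)
Lemma dzinv_repr u U : ccts U -> per U -> cI U = 0 -> {ae mu, forall x, u x = U x} ->
  exists W, [/\ cderiv W U, per W, cI W = 0, L2loc (dzinv u) & L2eq (dzinv u) W].
Proof.
move=> cU pU U0 E; have T0 := @pi2_gt0 R.
have pc := per_cprim cU pU U0; have D := cprim_deriv cU; have cc := cderiv_ccts D.
have DW c : cderiv (fun x => cprim U x + c) U.
  by apply: (cderiv_extr (cderivD D (cderiv_cst c))) => x; rewrite addr0.
have pW c : per (fun x => cprim U x + c) by move=> x /=; rewrite pc.
pose m := cI (cprim U) / (2 * pi : R)%:C.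
pose V x := cprim U x + - m.
have IV : cI V = 0.
  rewrite /V cID//; last exact: ccts_cst.
  by rewrite cI_cst /m mulNr divfK ?subrr// fmorph_eq0 gt_eqF.
have WV : weak_derivative V U by exact: cderiv_weak (DW (- m)) cU.
have Hspec : [set g | [/\ Hper 1 g, L20 g & L2eq (dz g) u]] V.
  have LV : L2loc V by exact: ccts_L2loc (cderiv_ccts (DW (- m))).
  split.
  - split; first exact: pW.
    by exists U => //; exact: ccts_L2loc.
  - split; first exact: L2loc_period.
    rewrite (@Cintegral_ae _ V V) ?IV//; [exact: L2loc_period|exact: cderiv_ccts (DW (- m))|].
    exact: ae_all.
  - by apply: ae_mono2 (dz_ae WV) E => x -> ->.
have [] : [set g | [/\ Hper 1 g, L20 g & L2eq (dz g) u]] (dzinv u).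
  by apply: (@xgetPex _ (fun=> 0) [set g | [/\ Hper 1 g, L20 g & L2eq (dz g) u]]); exists V.
set w := dzinv u => -[_ [h Wh _]] [L2w Iw] Ew.
have [c Hc] := weak_derivative_prim Wh; have [Lw Lh _] := Wh.
have clU := ccts_clocint cU; have clh := L2loc_clocint Lh.
have hU : {ae mu, forall x, period x -> h x = U x}.
  have A1 : {ae mu, forall x, period x -> dz w x = U x}.
    by apply: ae_mono2 Ew E => x H1 H2 px; rewrite H1.
  by apply: ae_mono2 (dz_ae Wh) A1 => x -> .
have wW : {ae mu, forall x, period x -> w x = cprim U x + c}.
  apply: ae_mono Hc => x -> px; rewrite addrC; congr (_ + _).
  move: px; rewrite /period /= in_itv /= => /andP[x0 xT].
  apply: cprim_ae_pos => //; first exact: ltW.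
  apply: ae_mono hU => y H y0 yx; apply: H; rewrite /period /= in_itv /= y0.
  exact: lt_trans xT.
exists (fun x => cprim U x + c); split=> //.
by rewrite -(Cintegral_ae L2w _ wW)//; exact: cderiv_ccts (DW c).
Qed.

(** Integrating three times from the last weak derivative gives continuous representatives of [u]
    and of two derivatives; the third one is only locally square integrable. *)
Lemma domA_repr u : domA u -> exists U0 U1 U2 h c,
  [/\ cderiv U0 U1, cderiv U1 U2, ccts U2, per U0 & cI U0 = 0] /\
  [/\ L2loc u, L2loc h, forall x, U2 x = c + cprim h x, {ae mu, forall x, u x = U0 x} &
      L2loc (dz (dz (dz u))) /\ {ae mu, forall x, dz (dz (dz u)) x = h x}].
Proof.
move=> [[pu [g1 W1 [g2 W2 [g3 W3 _]]]] [L2u Iu]].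
have [c2 E2] := weak_derivative_prim W3; have [c1 E1] := weak_derivative_prim W2.
have [c0 E0] := weak_derivative_prim W1.
have [Lu Lg1 _] := W1; have [_ Lg2 _] := W2; have [_ Lg3 _] := W3.
have cl3 := L2loc_clocint Lg3.
pose U2 x := c2 + cprim g3 x.
have cU2 : ccts U2 by apply: cctsD; [exact: ccts_cst|exact: cprim_cts].
pose U1 x := c1 + cprim U2 x.
have D1 : cderiv U1 U2.
  by apply: (cderiv_extr (cderivD (cderiv_cst c1) (cprim_deriv cU2))) => x; rewrite add0r.
have cU1 := cderiv_ccts D1.
have E1' : {ae mu, forall x, g1 x = U1 x}.
  apply: ae_mono E1 => x ->; rewrite /U1; congr (_ + _).
  by apply: cprim_ae; [exact: L2loc_clocint|exact: ccts_clocint|exact: E2].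
pose U0 x := c0 + cprim U1 x.
have D0 : cderiv U0 U1.
  by apply: (cderiv_extr (cderivD (cderiv_cst c0) (cprim_deriv cU1))) => x; rewrite add0r.
have cU0 := cderiv_ccts D0.
have E0' : {ae mu, forall x, u x = U0 x}.
  apply: ae_mono E0 => x ->; rewrite /U0; congr (_ + _).
  by apply: cprim_ae; [exact: L2loc_clocint|exact: ccts_clocint|exact: E1'].
(* The weak derivatives in the hypothesis and the iterates of [dz] are different representatives, so
   each stage is transported along almost everywhere equality. *)
have A1 := dz_ae W1; have [_ Ld1 _] := dz_spec W1.
have A1' : {ae mu, forall x, g1 x = dz u x} by apply: ae_mono A1 => x ->.
have W2' := weak_derivative_ae Ld1 A1' W2.
have A2 := dz_ae W2'; have [_ Ld2 _] := dz_spec W2'.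
have A2' : {ae mu, forall x, g2 x = dz (dz u) x} by apply: ae_mono A2 => x ->.
have W3' := weak_derivative_ae Ld2 A2' W3.
have A3 := dz_ae W3'; have [_ Ld3 _] := dz_spec W3'.
exists U0, U1, U2, g3, c2; split; split=> //.
- exact: per_of_ae cU0 E0'.
- by rewrite -(Cintegral_ae L2u cU0)//; apply: ae_mono E0' => x ->.
Qed.

(** The operator minus [lam] for a general differentiable coefficient; with [p = 1 + P_a] and
    [kappa = 1 / k_a ^ 2] it is the original one by conversion. *)
Definition opT (p : R -> R) (kappa l : R) (lam : R[i]) u : R -> R[i] := fun z =>
  dz (dz (dz u)) z + kappa%:C * dz (fun y => (p y)%:C * u y) z
  - (l ^+ 2)%:C * dzinv u z - lam * u z.

(** One integration from 0 turns the equation for [u] into one between periodic functions. Since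
    [dzinv u] is known only on a period, [G] is defined by that periodic formula and agrees with the
    primitive of the image of [u] only on [[0, 2 * pi]]. *)
Lemma opT_forward (p p1 : R -> R) (kappa l : R) lam u : lam != 0 ->
  deriv_of p p1 -> continuous p1 -> per p -> domA u ->
  L2loc (opT p kappa l lam u) /\ exists V V1 V2 V3 Z G,
  [/\ ode_sol (fun x => kappa * p x) lam l G V V1 V2 V3 Z, ccts G, per G,
      forall x, 0 <= x -> x <= 2 * pi -> G x = cprim (opT p kappa l lam u) x &
      {ae mu, forall x, u x = V1 x}].
Proof.
move=> lam0 Dp cp1 pp /domA_repr[U0 [U1 [U2 [h [c [[D0 D1 cU2 pU0 IU0] [Lu Lh EU2 Eu [Ld3 E3]]]]]]]].
have cp := deriv_continuous Dp.
have cU0 := cderiv_ccts D0; have cU1 := cderiv_ccts D1.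
have pU1 := cper_deriv D0 pU0; have pU2 := cper_deriv D1 pU1.
have [W [DW pW IW Lw Ew]] := dzinv_repr cU0 pU0 IU0 Eu.
have cW := cderiv_ccts DW.
pose pU x := (p x)%:C * U0 x; pose pU' x := (p1 x)%:C * U0 x + (p x)%:C * U1 x.
have DpU : cderiv pU pU' by exact: cderivM (cderivR Dp) D0.
have cpU' : ccts pU' by rewrite /pU'; ccts.
have Wp : weak_derivative (fun y => (p y)%:C * u y) pU'.
  apply: (@weak_derivative_ae _ pU) (cderiv_weak DpU cpU').
  - exact: L2locM.
  - by apply: ae_mono Eu => x ->.
have Ep := dz_ae Wp; have [_ Ldp _] := dz_spec Wp.
have LT : L2loc (opT p kappa l lam u).
  rewrite /opT; apply: L2locD; last by apply: L2locN; exact: L2locZ.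
  apply: L2locD; last by apply: L2locN; exact: L2locZ.
  by apply: L2locD => //; exact: L2locZ.
split=> //.
pose L2c : R[i] := (l ^+ 2)%:C.
pose cc x := kappa%:C * pU' x - L2c * W x - lam * U0 x.
have ccc : ccts cc by rewrite /cc; ccts.
have ET : {ae mu, forall x, period x -> opT p kappa l lam u x = h x + cc x}.
  have A : {ae mu, forall x, dz (dz (dz u)) x = h x /\ dz (fun y => (p y)%:C * u y) x = pU' x}.
    by apply: ae_mono2 E3 Ep.
  have B : {ae mu, forall x, (period x -> dzinv u x = W x) /\ u x = U0 x} by apply: ae_mono2 Ew Eu.
  apply: ae_mono2 A B => x [e1 e2] [e3 e4] px.
  by rewrite /opT e1 e2 (e3 px) e4 /cc /L2c; ring.
have clh := L2loc_clocint Lh.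
have CT x : 0 <= x -> x <= 2 * pi -> cprim (opT p kappa l lam u) x = cprim h x + cprim cc x.
  move=> x0 xT; rewrite -cprimD//; last exact: ccts_clocint.
  apply: cprim_ae_pos => //; [exact: L2loc_clocint|by apply: clocintD => //; exact: ccts_clocint|].
  apply: ae_mono ET => y H y0 yx; apply: H; rewrite /period /= in_itv /= y0 /=.
  exact: lt_le_trans xT.
pose F x := kappa%:C * pU x - L2c * cprim W x - lam * W x.
have DF : cderiv F cc.
  by apply: cderivB; [apply: cderivB; apply: cderivZ => //; exact: cprim_deriv|exact: cderivZ].
have Ccc x : cprim cc x = F x - F 0 by exact: cprimE.
have cp0 f : cprim f 0 = 0 by rewrite /cprim !prim0.
have pcW : per (cprim W) by exact: per_cprim.
pose z0 : R[i] := U2 0 + kappa%:C * pU 0 - lam * W 0.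
have F0 : F 0 = kappa%:C * pU 0 - lam * W 0 by rewrite /F cp0 mulr0 subr0.
have GE x : 0 <= x -> x <= 2 * pi -> cprim (opT p kappa l lam u) x =
    U2 x + kappa%:C * pU x - lam * W x - L2c * cprim W x - z0.
  move=> x0 xT; rewrite CT// Ccc F0 /z0 !EU2 cp0 /F; ring.
pose G x := U2 x + kappa%:C * pU x - lam * W x - L2c * cprim W x - z0.
have cG : ccts G.
  have cpU := cderiv_ccts DpU; have ccW := cderiv_ccts (cprim_deriv cW).
  by rewrite /G; ccts.
have pG : per G by move=> x; rewrite /G /pU pU2 pp pU0 pW pcW.
have qE x : (kappa * p x)%:C * U0 x = kappa%:C * pU x by rewrite CM /pU mulrA.
(* The integration constant [z0] is placed in [Z] when [l] is nonzero. For [l = 0] the system forces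
   [Z = 0], and the constant goes into [V] as [z0 / lam]. *)
case: (eqVneq l 0) => [l0|l0].
  exists (fun x => W x + z0 / lam), U0, U1, U2, (fun=> 0), G; split=> //; last by move=> x x0 xT; rewrite GE.
  split=> //.
    by apply: (cderiv_extr (cderivD DW (cderiv_cst _))) => x; rewrite addr0.
  split=> //.
  - by move=> x; rewrite pW.
  - by apply: (cderiv_extr (cderiv_cst 0)) => x; rewrite l0 expr0n /= mul0r mulr0 subr0.
  - move=> x; rewrite qE /G /L2c l0 expr0n /= mul0r !subr0 mulrDr [lam * (z0 / lam)]mulrC divfK//; ring.
exists W, U0, U1, U2, (fun x => L2c * cprim W x + z0), G; split=> //; last by move=> x x0 xT; rewrite GE.
split=> //; split=> //.
- apply: (cderiv_extr (cderivD (cderivZ L2c (cprim_deriv cW)) (cderiv_cst z0))) => x.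
  by rewrite (negPf l0) /= mul0r subr0 addr0.
- by move=> x; rewrite pcW.
- by move=> x; rewrite qE /G; ring.
Qed.

End Operator.

(** * From the differential system back to the operator *)

Section Resolvent.
Context {R : realType}.
Notation mu := (@lebesgue_measure R).
Notation Re := complex.Re.
Notation Im := complex.Im.
Notation normc := Normc.normc.
Implicit Types (f g h u U W : R -> R[i]) (c : R[i]) (x y : R).

Lemma Rintegral_shift (r : R -> R) (a b T : R) : locint r -> (forall x, r (x + T) = r x) ->
  \int[mu]_(x in `[a + T, b + T]) r x = \int[mu]_(x in `[a, b]) r x.
Proof.
move=> lr pr; pose phi := (fun x => x + T) : R -> measurableTypeR R.
have preim : phi @^-1` `[a + T, b + T] = `[a, b]%classic.
  by apply/seteqP; split=> x; rewrite /phi /= !in_itv /= !lerD2r.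
have rphi : (EFin \o r) \o phi = EFin \o r by apply/funext => x; rewrite /= /phi pr.
rewrite /Rintegral; congr fine.
have -> : (\int[mu]_(x in `[(a + T)%R, (b + T)%R]) (r x)%:E =
   \int[pushforward mu phi]_(x in `[(a + T)%R, (b + T)%R]) (EFin \o r) x)%E.
  apply: eq_measure_integral; first exact: measurable_shift.
  by move=> ? A mA _; apply/esym; exact: lebesgue_measure_shift.
rewrite integral_pushforward//; first by rewrite preim rphi.
- exact: measurable_shift.
- by apply/measurable_EFinP; exact: locint_measurable.
- by rewrite preim rphi; exact: lr.
Qed.

(** Increments of the primitive are invariant under translation by a period; zero mean makes the
    primitive itself invariant. *)
Lemma per_prim (r : R -> R) : locint r -> per r -> prim r (2 * pi) = 0 -> per (prim r).
Proof.
move=> lr pr rT x.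
have H a b : a <= b -> prim r (b + 2 * pi) - prim r (a + 2 * pi) = prim r b - prim r a.
  by move=> ab; rewrite !primB ?lerD2r// Rintegral_shift.
have [x0|/ltW x0] := leP 0 x.
  by have := H _ _ x0; rewrite add0r rT prim0 !subr0.
by have := H _ _ x0; rewrite add0r rT prim0 !sub0r => /oppr_inj.
Qed.

Lemma opT_backward (p p1 : R -> R) (kappa l : R) lam h V V1 V2 V3 Z :
  deriv_of p p1 -> continuous p1 -> L2loc h ->
  ode_sol (fun x => kappa * p x) lam l (cprim h) V V1 V2 V3 Z ->
  domA V1 /\ L2eq (opT p kappa l lam V1) h.
Proof.
move=> Dp cp1 Lh S; have DZ := ode_sol_primZ S.
have [D0 D1 D2 c3 [pV _ pZ E]] := S.
have cp := deriv_continuous Dp.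
have cV := cderiv_ccts D0; have cV1 := cderiv_ccts D1; have cV2 := cderiv_ccts D2.
have pV1 := cper_deriv D0 pV.
have IV1 : cI V1 = 0 by exact: cI_deriv_per D0 cV1 pV.
pose pV1' x := (p1 x)%:C * V1 x + (p x)%:C * V2 x.
have DpV : cderiv (fun x => (p x)%:C * V1 x) pV1' by exact: cderivM (cderivR Dp) D1.
have cpV' : ccts pV1' by rewrite /pV1'; ccts.
pose L2c : R[i] := (l ^+ 2)%:C.
pose cc x := lam * V1 x + L2c * V x - kappa%:C * pV1' x.
have ccc : ccts cc by rewrite /cc; ccts.
pose F x := lam * V x + Z x - kappa%:C * ((p x)%:C * V1 x).
have DF : cderiv F cc.
  by apply: cderivB; [apply: cderivD => //; exact: cderivZ|exact: cderivZ].
have V3E x : V3 x = cprim h x + F x.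
  by rewrite -(E x) /F CM; ring.
pose h3 x := h x + cc x.
have Lh3 : L2loc h3 by apply: L2locD => //; exact: ccts_L2loc.
have W1 : weak_derivative V1 V2 by exact: cderiv_weak.
have W2 : weak_derivative V2 V3 by exact: cderiv_weak.
have W3 : weak_derivative V3 h3.
  apply: (@prim_weak_derivative _ V3 h3 (F 0)) => //; first exact: ccts_L2loc.
  apply: ae_all => x; rewrite V3E cprimD; [|exact: L2loc_clocint|exact: ccts_clocint].
  by rewrite (cprimE x DF ccc); ring.
have LV1 := ccts_L2loc cV1.
split.
  split.
    split; first exact: pV1.
    by exists V2 => //; exists V3 => //; exists h3.
  split; first exact: L2loc_period.
  by rewrite (@Cintegral_ae _ V1 V1) ?IV1//; [exact: L2loc_period|exact: ae_all].
have A1 := dz_ae W1; have [_ Ld1 _] := dz_spec W1.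
have W2' : weak_derivative (dz V1) V3.
  by apply: weak_derivative_ae Ld1 _ W2; apply: ae_mono A1 => x ->.
have A2 := dz_ae W2'; have [_ Ld2 _] := dz_spec W2'.
have W3' : weak_derivative (dz (dz V1)) h3.
  by apply: weak_derivative_ae Ld2 _ W3; apply: ae_mono A2 => x ->.
have A3 := dz_ae W3'.
have Ap := dz_ae (cderiv_weak DpV cpV').
have [W [DW pW IW Lw Ew]] := dzinv_repr cV1 pV1 IV1 (ae_all (fun x => erefl (V1 x))).
(* [W] is the mean-free primitive of [V1] and [V] is another one. For nonzero [l] the periodicity of
   [Z] makes [V] mean-free as well; for [l = 0] both sides are zero. *)
have WV x : L2c * W x = L2c * V x.
  have [l0|l0] := eqVneq l 0; first by rewrite /L2c l0 expr0n !mul0r.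
  have L0 : L2c != 0 by rewrite fmorph_eq0 sqrf_eq0.
  have IV : cI V = 0.
    have := cI_deriv_per DZ _ pZ; rewrite cIZ// => H.
    by apply/eqP; rewrite -(mulrI_eq0 _ (mulfI L0)); apply/eqP; apply: H; ccts.
  have EW y : W y = V y + (W 0 - V 0).
    have := cprimE y DW cV1; rewrite (cprimE y D0 cV1) => /eqP.
    by rewrite -subr_eq => /eqP <-; ring.
  have : cI W = 0 by [].
  rewrite (_ : W = (fun y => V y + (W 0 - V 0))); last by apply/funext.
  rewrite cID//; last exact: ccts_cst.
  rewrite IV cI_cst add0r => /eqP; rewrite mulf_eq0 fmorph_eq0 (gt_eqF (@pi2_gt0 R)) orbF => /eqP W0.
  by rewrite W0 addr0.
have A : {ae mu, forall x, dz (dz (dz V1)) x = h3 x /\ dz (fun y => (p y)%:C * V1 y) x = pV1' x}.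
  by apply: ae_mono2 A3 Ap.
apply: ae_mono2 A Ew => x [e1 e2] e3 px.
by rewrite /opT e1 e2 (e3 px) -/L2c WV /h3 /cc; ring.
Qed.

Lemma ode_sol_unique (q : R -> R) (d l : R) lam (G V V1 V2 V3 Z V' V1' V2' V3' Z' : R -> R[i]) :
  admissible q d (l ^+ 2) -> Re lam != 0 ->
  ode_sol q lam l G V V1 V2 V3 Z -> ode_sol q lam l G V' V1' V2' V3' Z' ->
  forall x, V1 x = V1' x.
Proof.
move=> adm sig [D0 D1 D2 c3 [pV DZ pZ E]] [D0' D1' D2' c3' [pV' DZ' pZ' E']] x.
apply/eqP; rewrite -subr_eq0.
have S : ode_sol q lam l (fun=> 0) (fun x => V x - V' x) (fun x => V1 x - V1' x)
    (fun x => V2 x - V2' x) (fun x => V3 x - V3' x) (fun x => Z x - Z' x).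
  split; [exact: cderivB|exact: cderivB|exact: cderivB|exact: cctsB|split].
  - by move=> y; rewrite pV pV'.
  - by apply: (cderiv_extr (cderivB DZ DZ')) => y; ring.
  - by move=> y; rewrite pZ pZ'.
  - by move=> y; rewrite -(subrr (G y)) -{1}(E y) -(E' y); ring.
by have [_ /= -> _ _] := ode_sol_trivial adm sig S x.
Qed.

(** Injectivity: equal images have equal primitives on a period, hence the same [G], and the system
    determines [V1]. Surjectivity: the periodized datum has a periodic primitive because its mean is
    zero. Boundedness: the norm of the image bounds [G] uniformly, [G] bounds [V1] uniformly, and
    [V1] represents [u]. *)
Lemma opT_resolvent (p p1 : R -> R) (kappa l d : R) lam :
  deriv_of p p1 -> continuous p1 -> per p ->
  admissible (fun x => kappa * p x) d (l ^+ 2) -> Re lam != 0 ->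
  [/\ forall u v, domA u -> domA v ->
        L2eq (opT p kappa l lam u) (opT p kappa l lam v) -> L2eq u v,
      forall g, L20 g -> exists2 u, domA u & L2eq (opT p kappa l lam u) g &
      exists C : R, forall u, domA u -> L2norm u <= C * L2norm (opT p kappa l lam u)].
Proof.
move=> Dp cp1 pp adm sig; have T0 := @pi2_gt0 R.
have lam0 : lam != 0 by apply: contraNneq sig => ->.
have fwd u := @opT_forward R p p1 kappa l lam u lam0 Dp cp1 pp.
have [C HC] := resolvent_ode adm sig.
split.
- move=> u v du dv E.
  have [LTu [V [V1 [V2 [V3 [Z [G [S cG pG GE Eu]]]]]]]] := fwd u du.
  have [LTv [W [W1 [W2 [W3 [Y [H [S' cH pH HE Ev]]]]]]]] := fwd v dv.
  have GH : G = H.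
    apply/funext => x; apply/eqP; rewrite -subr_eq0; apply/eqP.
    apply: (@per_zero R (fun y => G y - H y)) => [y|y /andP[y0 yT]]; first by rewrite pG pH.
    rewrite GE// HE//; apply/eqP; rewrite subr_eq0; apply/eqP.
    apply: cprim_ae_pos => //; [exact: L2loc_clocint|exact: L2loc_clocint|].
    apply: ae_mono E => t Ht t0 ty; apply: Ht; rewrite /period /= in_itv /= t0 /=.
    exact: lt_le_trans yT.
  rewrite -GH in S'; have VW := ode_sol_unique adm sig S S'.
  by apply: ae_mono2 Eu Ev => x -> -> _; exact: VW.
- move=> g [Lg Ig].
  have [h [ph Lh hg]] := periodization Lg.
  have clh := L2loc_clocint Lh; have ch := cprim_cts clh.
  have hT : cprim h (2 * pi) = 0.
    have [hR hI] := clh; rewrite -Ig; apply: complex_eq; rewrite /= -period_int//;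
    by apply: eq_Rintegral => x; rewrite inE => /hg ->.
  have pch : per (cprim h).
    case: clh => hR hI x; apply: complex_eq; apply: per_prim => //.
    - by move=> y; rewrite ph.
    - exact: (congr1 (@complex.Re R) hT).
    - by move=> y; rewrite ph.
    - exact: (congr1 (@complex.Im R) hT).
  have [B HB] : exists B, forall x, normc (cprim h x) <= B.
    have [cR cI0] := ch.
    have [B1 HB1] : exists B, forall x, `|Re (cprim h x)| <= B.
      by apply: (@per_bounded R (fun x => Re (cprim h x))) => // x; rewrite pch.
    have [B2 HB2] : exists B, forall x, `|Im (cprim h x)| <= B.
      by apply: (@per_bounded R (fun x => Im (cprim h x))) => // x; rewrite pch.
    by exists (B1 + B2) => x; apply: le_trans (normc_le _) _; exact: lerD.
  have [[V [V1 [V2 [V3 [Z S]]]]] _] := HC _ B ch pch HB.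
  have [dV EV] := opT_backward Dp cp1 Lh S.
  exists V1 => //; apply: ae_mono EV => x H px; by rewrite H// hg.
- exists (Num.sqrt (2 * pi) * (C * (2 * pi + 1))) => u du.
  have [LTu [V [V1 [V2 [V3 [Z [G [S cG pG GE Eu]]]]]]]] := fwd u du.
  have Gb x : normc (G x) <= (2 * pi + 1) * L2norm (opT p kappa l lam u).
    have [k k0 k1] := per_rep x.
    rewrite -(per_int (- k) x pG) rmorphN mulNr GE ?(ltW k1)//.
    by apply: L2norm_bound => //; exact: ltW.
  have [_ /(_ _ _ _ _ _ S) V1b] := HC G _ cG pG Gb.
  have [_ [L2u _]] := du.
  have [_ D1 _ _ _] := S.
  rewrite -!mulrA; apply: L2norm_le L2u (cderiv_ccts D1) _ V1b.
  by apply: ae_mono Eu => x ->.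
Qed.

End Resolvent.

Theorem lemma6p1 (R : realType) (P : R -> R -> R) (k : R -> R)
    (hP : periodic_waves P k) :
  exists lstar astar : R, [/\ 0 < lstar, 0 < astar &
    forall l a : R, `|l| <= lstar -> `|a| <= astar ->
      spectrum domA (opA P k a l) `<=` [set lambda | complex.Re lambda = 0]].
Proof.
have [lstar [astar [l0 a0 H]]] := waves_admissible hP.
exists lstar, astar; split=> // l a hl ha lam; rewrite /spectrum /setC /=.
have [k0 pP [P1 DP cP1] [d adm]] := H l a hl ha.
move=> notres; apply/eqP/negP => /negP sig; apply: notres.
have Dp : deriv_of (fun y => 1 + P a y) P1 by apply: (deriv_extr (derivD (deriv_cst 1) DP)) => x; rewrite add0r.
have pp : per (fun y => 1 + P a y) by move=> x; rewrite pP.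
exact: (opT_resolvent Dp cP1 pp adm sig).
Qed.
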